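(* Let $A$ be an apartment of an affine building $X$ with fixed special vertex $0$ and fundamental Weyl chamber $C_f$. Let $x$ be a special vertex in $A$ and let $x^+$ denote the unique element of $W.x$ contained in $C_f$. Let $t$ be the type of a fixed minimal gallery $\gamma:0\rightsquigarrow x^+$. Let $Q$ be the lattice ($\mathbb{Z}$-span) generated by $R$ and let $A^{\mathrm{type}}(x)=\{y\in\mathrm{conv}(W.x)\cap(x+Q)\}$. Then every vertex in $A^{\mathrm{type}}(x)$ is the target of a positively folded gallery in $A$ with source $0$ and type $t$. Conversely, the target of every positively folded gallery in $A$ with source $0$ and type $t$ is contained in $A^{\mathrm{type}}(x)$.
   Context: Root system and Coxeter complex. $V$ is a finite-dimensional real vector space and $R\subset V$ an irreducible root system: $R$ is finite, $0\notin R$, $R$ spans $V$, for each $\alpha\in R$ there is $\alpha^\vee\in V^*$ with $\langle\alpha,\alpha^\vee\rangle=2$ such that $v\mapsto v-\langle v,\alpha^\vee\rangle\alpha$ preserves $R$, and $\langle R,\alpha^\vee\rangle\subset\mathbb{Z}$. $B=\{\alpha_i\}_{i\in I}$ is a basis of $R$; the fundamental co-weights $\{\omega_i\}_{i\in I}\subset V$ form the basis dual to $\{\alpha_i^\vee\}_{i\in I}$. $E$ is the affine space underlying $V$, with origin $0$. Hyperplanes are $H_{\alpha,k}=\{v\in E:\langle v,\alpha^\vee\rangle=k\}$, $\alpha\in R$, $k\in\mathbb{Z}$; each determines two closed half apartments. $W^a$ is the affine Weyl group generated by the reflections at all $H_{\alpha,k}$, and $W$ (the spherical Weyl group) is the stabilizer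 of $0$ in $W^a$. Alcoves are closures of connected components of $E\setminus\bigcup_{\alpha,k}H_{\alpha,k}$. A vertex is special if every hyperplane is parallel to a hyperplane through it. Weyl chambers are the $W^a$-translates of closures of connected components of $E\setminus\bigcup_{\alpha\in R}H_{\alpha,0}$. The fundamental Weyl chamber is $C_f=\{v:\langle v,\alpha_i^\vee\rangle\ge 0\ \forall i\in I\}$ and its opposite is $C_f^{\mathrm{op}}=-C_f$. Building. $X$ is an irreducible simplicial affine building whose apartments are isomorphic to the Coxeter complex $E$ of $W^a$; $A$ is identified with $E$, with $0$ a special vertex. Simplices of $X$ carry the usual types. Two Weyl chambers are parallel if their intersection contains a Weyl chamber; $\partial S$ denotes the parallel class of $S$. Galleries. A (combinatorial) gallery is a sequence $\gamma=(c_0',c_0,c_1',c_1,\ldots,c_n',c_n,c_{n+1}')$, where the $c_i$ are alcoves, the source $c_0'$ is a vertex of $c_0$, the target $c_{n+1}'$ is a vertex of $c_n$, and $c_i'$ is a codimension one face of both $c_{i-1}$ and $c_i$ for $1\le i\le n$ (repetitions $c_{i-1}=c_i$ are allowed). Its type is the list of the types of $c_0',c_1',\ldots,c_{n+1}'$. It is minimal if it is a shortest gallery with source $c_0'$ and target $c_{n+1}'$; $\gamma:a\rightsquigarrow b$ means source $a$ and target $b$. A hyperplane $H$ in $A$ separates an alcove $d$ and a Weyl chamber $S$ of $A$ if there is a representative $S'$ of $\partial S$ in $A$ such that $S'$ and $d$ lie in different half apartments determined by $H$. A gallery in $A$ is positively folded at $i$ if $c_i=c_{i-1}$ and the hyperplane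 spanned by $c_i'$ separates $c_i$ and $C_f^{\mathrm{op}}$; it is positively folded if it is positively folded at $i$ whenever $c_{i-1}=c_i$. (Dual) convexity. Fix a $W$-invariant inner product $(\cdot\,|\,\cdot)$ on $V$. Dual hyperplanes are the sets $\{v\in E: (w\omega_i\,|\,v)=k\}$ with $w\in W$, $i\in I$, $k\in\mathbb{R}$; each determines two closed dual half apartments. The convex hull $\mathrm{conv}(C)$ of a set $C\subset A$ is the intersection of all dual half apartments containing $C$. *)

(* Defs.v *)
From HB Require Import structures.
From mathcomp Require Import all_boot all_order all_algebra.
From mathcomp Require Import all_classical all_reals all_analysis.

Set Implicit Arguments.
Unset Strict Implicit.
Unset Printing Implicit Defensive.

Import Order.TTheory GRing.Theory Num.Theory.
Import numFieldNormedType.Exports.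
Local Open Scope classical_set_scope.
Local Open Scope ring_scope.

(* Crystallographic, not necessarily reduced.  [coroot] is only meaningful on
   [roots], where it is uniquely determined by the axioms. *)
Record root_system (R : realType) (n : nat) := RootSystem {
  roots : set 'rV[R]_n;
  coroot : 'rV[R]_n -> {scalar 'rV[R]_n};
  roots_finite : finite_set roots;
  roots_neq0 : ~ roots 0;
  roots_span : forall U : {vspace 'rV[R]_n},
    (forall a, roots a -> a \in U) -> U = fullv;
  coroot_diag : forall a, roots a -> coroot a a = 2;
  roots_stable : forall a b, roots a -> roots b ->
    roots (b - coroot a b *: a);
  coroot_int : forall a b, roots a -> roots b -> coroot a b \is a Num.int }.

Definition irreducible_roots R n (D : root_system R n) : Prop :=
  roots D !=set0 /\
  forall P Q : set 'rV[R]_n, P `|` Q = roots D -> P `&` Q = set0 ->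
    (forall a b, P a -> Q b -> coroot D a b = 0) -> P = set0 \/ Q = set0.

Definition root_basis R n (D : root_system R n) (I : finType)
    (alpha : I -> 'rV[R]_n) : Prop :=
  [/\ forall i, roots D (alpha i),
      basis_of fullv [seq alpha i | i : I]
    & forall b, roots D b -> exists c : I -> nat,
        b = \sum_i alpha i *+ c i \/ b = - \sum_i alpha i *+ c i].

Definition fundamental_coweights R n (D : root_system R n) (I : finType)
    (alpha omega : I -> 'rV[R]_n) : Prop :=
  forall i j, coroot D (alpha j) (omega i) = (i == j)%:R.

Definition root_lattice R n (D : root_system R n) : set 'rV[R]_n :=
  [set q | exists2 s : seq (int * 'rV[R]_n),
     (forall z, z \in s -> roots D z.2) & q = \sum_(z <- s) z.2 *~ z.1].

Definition hyperplane R n (D : root_system R n) a (k : int) : set 'rV[R]_n :=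
  [set v | coroot D a v = k%:~R].

Definition half_above R n (D : root_system R n) a (k : int) : set 'rV[R]_n :=
  [set v | k%:~R <= coroot D a v].

Definition half_below R n (D : root_system R n) a (k : int) : set 'rV[R]_n :=
  [set v | coroot D a v <= k%:~R].

Definition affine_reflection R n (D : root_system R n) a (k : int)
    (v : 'rV[R]_n) : 'rV[R]_n :=
  v - (coroot D a v - k%:~R) *: a.

(* The generators are involutions, so closure under composition suffices. *)
Inductive affine_weyl R n (D : root_system R n) :
    ('rV[R]_n -> 'rV[R]_n) -> Prop :=
| affine_weyl_id : affine_weyl D id
| affine_weyl_refl a k w : roots D a -> affine_weyl D w ->
    affine_weyl D (affine_reflection D a k \o w).

Definition spherical_weyl R n (D : root_system R n)
    (w : 'rV[R]_n -> 'rV[R]_n) : Prop :=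
  affine_weyl D w /\ w 0 = 0.

Definition weyl_orbit R n (D : root_system R n) (x : 'rV[R]_n) :
    set 'rV[R]_n :=
  [set w x | w in spherical_weyl D].

Definition alcove R n (D : root_system R n) (c : set 'rV[R]_n) : Prop :=
  let U := [set v | forall a k, roots D a -> ~ hyperplane D a k v] in
  exists2 p, U p & c = closure (connected_component U p).

Definition weyl_chamber R n (D : root_system R n) (S : set 'rV[R]_n) : Prop :=
  let U := [set v | forall a, roots D a -> ~ hyperplane D a 0 v] in
  exists w p, [/\ affine_weyl D w, U p
    & S = w @` closure (connected_component U p)].

Definition parallel_chambers R n (D : root_system R n)
    (S S' : set 'rV[R]_n) : Prop :=
  exists2 S'', weyl_chamber D S'' & S'' `<=` S `&` S'.

Definition fundamental_chamber R n (D : root_system R n) (I : finType)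
    (alpha : I -> 'rV[R]_n) : set 'rV[R]_n :=
  [set v | forall i, 0 <= coroot D (alpha i) v].

Definition opposite_chamber R n (D : root_system R n) (I : finType)
    (alpha : I -> 'rV[R]_n) : set 'rV[R]_n :=
  -%R @` fundamental_chamber D alpha.

(* A vertex is a point that is cut out by the hyperplanes through it. *)
Definition vertex R n (D : root_system R n) (x : 'rV[R]_n) : Prop :=
  forall v, (forall a k, roots D a -> hyperplane D a k x -> hyperplane D a k v)
    -> v = x.

Definition parallel_sets (R : realType) n (H H' : set 'rV[R]_n) : Prop :=
  exists u, H' = [set v + u | v in H].

Definition special_vertex R n (D : root_system R n) (x : 'rV[R]_n) : Prop :=
  vertex D x /\
  forall a k, roots D a -> exists b l,
    [/\ roots D b, hyperplane D b l x
      & parallel_sets (hyperplane D a k) (hyperplane D b l)].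

(* Simplicial complexes on a type T of vertices are given by the set of their
   nonempty simplices, a simplex being identified with its set of vertices. *)
Definition simplicial_complex T (K : set (set T)) : Prop :=
  forall s, K s -> [/\ finite_set s, s !=set0
    & forall s', s' !=set0 -> s' `<=` s -> K s'].

Definition complex_vertices T (K : set (set T)) : set T :=
  [set x | K [set x]].

Definition chamber T (K : set (set T)) (c : set T) : Prop :=
  K c /\ forall s, K s -> c `<=` s -> s = c.

Definition codim1_face T (K : set (set T)) (p c : set T) : Prop :=
  K p /\ exists2 x, c x & p = c `\ x.

Definition complex_iso T T' (K : set (set T)) (K' : set (set T'))
    (f : T -> T') : Prop :=
  set_inj (complex_vertices K) f /\ [set f @` s | s in K] = K'.

(* A labelling of the vertices of K by types; the type of a simplex s is
   typ @` s.  On a building the labelling is unique up to renaming the types. *)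
Definition type_function T (K : set (set T)) (J : Type) (typ : T -> J) : Prop :=
  forall c, chamber K c -> set_bij c setT typ.

(* The gallery (c_0', c_0, c_1', c_1, ..., c_n', c_n, c_{n+1}') has source
   c_0', first alcove c_0, steps (c_1', c_1), ..., (c_n', c_n) and target
   c_{n+1}'. *)
Record gallery T := Gallery {
  source : T;
  first_chamber : set T;
  steps : seq (set T * set T);
  target : T }.

Definition last_chamber T (g : gallery T) : set T :=
  last (first_chamber g) (unzip2 (steps g)).

Fixpoint steps_in T (K : set (set T)) (c : set T) (s : seq (set T * set T)) :
    Prop :=
  if s is (p, c') :: s' then
    [/\ codim1_face K p c, codim1_face K p c', chamber K c' & steps_in K c' s']
  else True.

Definition gallery_in T (K : set (set T)) (g : gallery T) : Prop :=
  [/\ chamber K (first_chamber g), first_chamber g (source g),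
      steps_in K (first_chamber g) (steps g) & last_chamber g (target g)].

Definition minimal_gallery T (K : set (set T)) (g : gallery T) : Prop :=
  gallery_in K g /\
  forall g', gallery_in K g' -> source g' = source g -> target g' = target g ->
    (size (steps g) <= size (steps g'))%N.

Definition gallery_type T J (typ : T -> J) (g : gallery T) : seq (set J) :=
  (typ @` [set source g]) ::
  rcons [seq typ @` z.1 | z <- steps g] (typ @` [set target g]).

Definition coxeter_complex R n (D : root_system R n) : set (set 'rV[R]_n) :=
  [set s | s !=set0 /\
     exists2 c, alcove D c & s `<=` [set x | c x /\ vertex D x]].

Record affine_building R n (D : root_system R n) := AffineBuilding {
  points : Type;
  simplices : set (set points);
  apartments : set (set (set points));
  building_complex : simplicial_complex simplices;
  apartment_sub : forall A, apartments A -> A `<=` simplices;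
  apartment_coxeter : forall A, apartments A ->
    exists f, complex_iso (coxeter_complex D) A f;
  common_apartment : forall s s', simplices s -> simplices s' ->
    exists2 A, apartments A & A s /\ A s';
  apartment_exchange : forall A A' s s', apartments A -> apartments A' ->
    A s -> A' s -> A s' -> A' s' ->
    exists2 f, complex_iso A A' f & forall x, (s `|` s') x -> f x = x }.

Arguments simplices {R n D} a.
Arguments apartments {R n D} a.

(* The simplex d is given by its vertices; as half apartments are convex, it
   lies in a half apartment iff its vertices do. *)
Definition separates R n (D : root_system R n) a (k : int)
    (d S : set 'rV[R]_n) : Prop :=
  exists S', [/\ weyl_chamber D S', parallel_chambers D S S'
    & (S' `<=` half_above D a k /\ d `<=` half_below D a k) \/
      (S' `<=` half_below D a k /\ d `<=` half_above D a k)].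

(* A codimension one simplex p lies in exactly one hyperplane, the one it
   spans. *)
Definition positive_fold R n (D : root_system R n) (I : finType)
    (alpha : I -> 'rV[R]_n) (p c : set 'rV[R]_n) : Prop :=
  exists a k, [/\ roots D a, p `<=` hyperplane D a k
    & separates D a k c (opposite_chamber D alpha)].

Fixpoint folds_positive R n (D : root_system R n) (I : finType)
    (alpha : I -> 'rV[R]_n) (c : set 'rV[R]_n)
    (s : seq (set 'rV[R]_n * set 'rV[R]_n)) : Prop :=
  if s is (p, c') :: s' then
    (c' = c -> positive_fold D alpha p c') /\ folds_positive D alpha c' s'
  else True.

Definition positively_folded R n (D : root_system R n) (I : finType)
    (alpha : I -> 'rV[R]_n) (g : gallery 'rV[R]_n) : Prop :=
  folds_positive D alpha (first_chamber g) (steps g).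

Definition weyl_invariant R n (D : root_system R n)
    (ip : 'rV[R]_n -> 'rV[R]_n -> R) : Prop :=
  forall w u v, spherical_weyl D w -> ip (w u) (w v) = ip u v.

Definition dual_half_apartment R n (D : root_system R n) (I : finType)
    (omega : I -> 'rV[R]_n) (ip : 'rV[R]_n -> 'rV[R]_n -> R)
    (H : set 'rV[R]_n) : Prop :=
  exists w i (k : R), spherical_weyl D w /\
    (H = [set v | ip (w (omega i)) v <= k] \/
     H = [set v | k <= ip (w (omega i)) v]).

Definition dual_convex_hull R n (D : root_system R n) (I : finType)
    (omega : I -> 'rV[R]_n) (ip : 'rV[R]_n -> 'rV[R]_n -> R)
    (C : set 'rV[R]_n) : set 'rV[R]_n :=
  \bigcap_(H in [set H | dual_half_apartment D omega ip H /\ C `<=` H]) H.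

Definition A_type R n (D : root_system R n) (I : finType)
    (omega : I -> 'rV[R]_n) (ip : 'rV[R]_n -> 'rV[R]_n -> R)
    (x : 'rV[R]_n) : set 'rV[R]_n :=
  dual_convex_hull D omega ip (weyl_orbit D x) `&`
  [set x + q | q in root_lattice D].

(* Main.v *)
(** Retracting along type-preserving isomorphisms of apartments shows that the type
    of [gamma] is the type of a minimal gallery of the Coxeter complex, that is, of
    a reduced word in the reflections at the walls of the fundamental alcove; the
    galleries of this type, folded or not, are its subwords.

    Targets lie in the hull: by the lifting property of the Bruhat order the target
    of a subword arises from a W-conjugate of [xp] by reflections that move a point
    across a wall towards the fundamental alcove.  Such a reflection stays on the
    segment between the point and its mirror image in the parallel hyperplane
    through 0, and the hull is convex and W-invariant.

    Points of the hull are targets: a version of the root operators shows that the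
    targets of positively folded galleries are permuted by the simple reflections
    and that with [y] also [y - alpha i] is a target if [coroot (alpha i) y >= 1].
    Every dominant [y] in the hull with [xp - y] in the root lattice is reached from
    [xp] by steps of the second kind, as in the theory of saturated sets of weights. *)
Require Import Defs.
From HB Require Import structures.
From mathcomp Require Import all_boot all_order all_algebra.
From mathcomp Require Import all_classical all_reals all_analysis.
From mathcomp Require Import ring lra zify.
Set Implicit Arguments.
Unset Strict Implicit.
Unset Printing Implicit Defensive.
Import Order.TTheory GRing.Theory Num.Theory.
Import numFieldNormedType.Exports.
Local Open Scope classical_set_scope.
Local Open Scope ring_scope.

(* [fingraph] also exports a [roots]. *)
Local Notation roots := Defs.roots.

(** The system [D] may be nonreduced, so several roots can define one hyperplane. Roots are
    therefore compared through their coroots, the affine wall belongs to the highest coroot rather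
    than the highest root, and integrality at special vertices is available for indivisible roots.

    A gallery ends at a vertex, not at an alcove, so reducedness is measured on one vertex: a word
    is [shortest] if no shorter word sends [vtx i] to the same point. Instead of a length function,
    the exchange property is used, which comes from the geometry of a walk that crosses a
    hyperplane.

    The root operators do not act on individual galleries. Only sets of targets are followed, for
    two mirror-image starting alcoves at once: a letter may leave both in their strips, exchange
    them, or carry one into a new strip, and the last case shapes the induction.

    In the building, retraction alone does not control the target: the retracted gallery may end at
    another vertex than [xp], and is corrected by a type-preserving automorphism of the Coxeter
    complex that fixes 0. *)

Section AffineArrangement.
Variables (R : realType) (T : normedModType R) (L : set (T -> R)).
Hypothesis L_continuous : forall f, L f -> continuous f.
Hypothesis L_affine : forall f, L f ->
  forall u v t, f (u + t *: (v - u)) = f u + t * (f v - f u).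

Definition arrangement_complement : set T := [set v | forall f, L f -> f v <> 0].
Local Notation U := arrangement_complement.

Lemma segment_continuous (u v : T) : continuous (fun t : R => u + t *: (v - u)).
Proof.
move=> t; apply: cvgD; first exact: cvg_cst.
by apply: cvgZr_tmp; apply: cvg_id.
Qed.

Lemma sqr_sign_gt0 p f : U p -> L f -> 0 < f p * f p.
Proof.
by move=> Up Lf; rewrite -expr2 exprn_even_gt0 //=; apply/eqP; apply: Up.
Qed.

(** The image under [f] of a connected subset of the complement is an interval that misses 0, so [f]
    keeps its sign there. Conversely [f p * f] is affine and positive at both ends of the segment
    from [p] to [v], so the segment is a connected witness. *)
Lemma component_sign p : U p ->
  connected_component U p = [set v | forall f, L f -> 0 < f p * f v].
Proof.
move=> Up; apply/seteqP; split => v.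
  case=> C [Cp CU Cc] Cv f Lf.
  have /connected_intervalP fC : connected (f @` C).
    by apply: connected_continuous_connected => //; apply: continuous_subspaceT;
      apply: L_continuous.
  have fp : (f @` C) (f p) by exists p.
  have fv : (f @` C) (f v) by exists v.
  have n0 c : C c -> f c != 0 by move=> /CU /(_ f Lf) /eqP.
  have np := n0 _ Cp; have nv := n0 _ Cv.
  rewrite lt_neqAle eq_sym mulf_neq0 //= leNgt; apply/negP => lt0.
  suff [c Cc' fc] : (f @` C) 0 by have := n0 c Cc'; rewrite fc eqxx.
  have [pgt0|ple0] := ltP 0 (f p).
    by apply: (fC _ _ fv fp); rewrite (ltW pgt0) andbT; move: lt0;
      rewrite pmulr_rlt0 // => /ltW.
  have plt0 : f p < 0 by rewrite lt_neqAle np.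
  by apply: (fC _ _ fp fv); rewrite ple0 /=; move: lt0; rewrite nmulr_rlt0 // => /ltW.
move=> pos_v; exists ((fun t : R => p + t *: (v - p)) @` `[0, 1]); last first.
  by exists 1; rewrite /= ?in_itv /= ?lexx ?ler01 // scale1r addrC subrK.
split.
- by exists 0; rewrite /= ?in_itv /= ?lexx ?ler01 // scale0r addr0.
- move=> _ [t t01 <-] f Lf f0.
  move: t01; rewrite /= in_itv /= => /andP [t0 t1].
  have : 0 < f p * f (p + t *: (v - p)); last by rewrite f0 mulr0 ltxx.
  rewrite L_affine //; have fp_gt0 := sqr_sign_gt0 Up Lf; have fv_gt0 := pos_v f Lf.
  rewrite (_ : _ * _ = (1 - t) * (f p * f p) + t * (f p * f v)); last by ring.
  have [t_gt0|t_le0] := ltP 0 t; first by apply: ltr_wpDl;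
    [rewrite mulr_ge0 ?subr_ge0 // ltW|rewrite mulr_gt0].
  by rewrite (_ : t = 0) ?subr0 ?mul1r ?mul0r ?addr0 //; apply/eqP; rewrite eq_le t_le0.
- apply: connected_continuous_connected; first exact: segment_connected.
  by apply: continuous_subspaceT; apply: segment_continuous.
Qed.

(** Weak inequalities pass to the closure; conversely, moving a point that satisfies them slightly
    towards [p] makes them strict. *)
Lemma closure_component p : U p ->
  closure (connected_component U p) = [set v | forall f, L f -> 0 <= f p * f v].
Proof.
move=> Up; rewrite component_sign //; apply/seteqP; split => v.
  move=> clv f Lf; have cl : closed [set u | 0 <= f p * f u].
    apply: (preimage_closed (f := fun u => f p * f u) (D := [set x | 0 <= x]));
      last exact: closed_ge.
    by move=> u _; apply: cvgM; [apply: cvg_cst|apply: L_continuous].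
  apply: cl; apply: closureS clv => u /(_ f Lf); exact: ltW.
move=> ge0 B nB.
have nB0 : nbhs (v + (0 : R) *: (p - v)) B by rewrite scale0r addr0.
have [e /= e_gt0 eB] := @segment_continuous v p 0 B nB0.
(* Below [e] to stay in the given neighbourhood, at most 1 to stay on the segment. *)
pose t := Num.min (e / 2) 1.
have t_gt0 : 0 < t by rewrite lt_min ltr01 andbT divr_gt0.
have t_le1 : t <= 1 by rewrite ge_min lexx orbT.
exists (v + t *: (p - v)); split.
  move=> f Lf; rewrite L_affine //; have fp_gt0 := sqr_sign_gt0 Up Lf;
    have fv_ge0 := ge0 f Lf.
  rewrite (_ : _ * _ = (1 - t) * (f p * f v) + t * (f p * f p)); last by ring.
  by apply: ltr_wpDl; [rewrite mulr_ge0 ?subr_ge0|rewrite mulr_gt0].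
apply: (eB t); rewrite /= sub0r normrN gtr0_norm //.
apply: (@le_lt_trans _ _ (e / 2)); first by rewrite ge_min lexx.
by rewrite ltr_pdivrMr //; lra.
Qed.

End AffineArrangement.

(** * Isomorphisms of simplicial complexes and their action on galleries *)

Section Complexes.
Variables (T T' : Type) (K : set (set T)) (K' : set (set T')) (phi : T -> T').
Hypothesis K_vertex : forall s x, K s -> s x -> K [set x].
Hypothesis phi_iso : complex_iso K K' phi.

Lemma iso_simplex s : K s -> K' (phi @` s).
Proof. by move=> Ks; case: phi_iso => _ <-; exists s. Qed.

Lemma iso_lift t : K' t -> exists2 s, K s & t = phi @` s.
Proof. by case: phi_iso => _ <- [s Ks <-]; exists s. Qed.

Lemma iso_vertex_inj x y : K [set x] -> K [set y] -> phi x = phi y -> x = y.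
Proof. by case: phi_iso => inj _ Kx Ky; apply: inj; apply: mem_set. Qed.

Lemma iso_sub s t : K s -> K t -> phi @` s `<=` phi @` t -> s `<=` t.
Proof.
move=> Ks Kt sub x sx; have [|y ty e] := sub (phi x); first by exists x.
by rewrite -(iso_vertex_inj (K_vertex Kt ty) (K_vertex Ks sx) e).
Qed.

Lemma iso_eq s t : K s -> K t -> phi @` s = phi @` t -> s = t.
Proof. by move=> Ks Kt e; apply/seteqP; split; apply: iso_sub => //; rewrite e. Qed.

Lemma iso_chamber s : chamber K s -> chamber K' (phi @` s).
Proof.
move=> [Ks smax]; split; first exact: iso_simplex.
move=> u /iso_lift [t Kt ->] st; congr (_ @` _).
by apply: smax => //; apply: iso_sub.
Qed.

Lemma iso_chamber_inv s : K s -> chamber K' (phi @` s) -> chamber K s.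
Proof.
move=> Ks [_ smax]; split=> // t Kt st; apply: iso_eq => //.
by apply: smax; [exact: iso_simplex|exact: image_subset].
Qed.

Lemma iso_setD1 s x : K s -> s x -> phi @` (s `\ x) = (phi @` s) `\ phi x.
Proof.
move=> Ks sx; apply/seteqP; split => [_ [y [sy ne] <-]|_ [[y sy <-] ne]].
  split; first by exists y.
  by move=> e; apply: ne; apply: iso_vertex_inj e;
    [exact: K_vertex sy|exact: K_vertex sx].
by exists y => //; split => // e; apply: ne; rewrite e.
Qed.

Lemma iso_face p c : K c -> codim1_face K p c -> codim1_face K' (phi @` p) (phi @` c).
Proof.
move=> Kc [Kp [x cx e]]; split; first exact: iso_simplex.
by exists (phi x); [exists x|rewrite e iso_setD1].
Qed.

Lemma iso_steps c s : K c -> steps_in K c s ->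
  steps_in K' (phi @` c) [seq (phi @` z.1, phi @` z.2) | z <- s].
Proof.
elim: s c => //= -[p d] s IH c Kc [pc pd [Kd dmax] sd]; split => /=.
- exact: iso_face.
- exact: iso_face.
- exact: iso_chamber.
- exact: IH.
Qed.

Definition map_gallery (g : gallery T) : gallery T' :=
  Gallery (phi (source g)) (phi @` first_chamber g)
    [seq (phi @` z.1, phi @` z.2) | z <- steps g] (phi (target g)).

Lemma last_map_gallery c (s : seq (set T * set T)) :
  last (phi @` c) (unzip2 [seq (phi @` z.1, phi @` z.2) | z <- s]) =
  phi @` last c (unzip2 s).
Proof. by elim: s c => //= z s IH c; rewrite IH. Qed.

Lemma iso_gallery g : gallery_in K g -> gallery_in K' (map_gallery g).
Proof.
case=> cg sg st tg; split => /=; first exact: iso_chamber.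
- by exists (source g).
- by apply: iso_steps => //; case: cg.
- by rewrite /last_chamber /= last_map_gallery; exists (target g).
Qed.

End Complexes.

Lemma iso_comp T1 T2 T3 (K1 : set (set T1)) (K2 : set (set T2))
    (K3 : set (set T3)) f g :
  complex_iso K1 K2 f -> complex_iso K2 K3 g -> complex_iso K1 K3 (g \o f).
Proof.
move=> f_iso g_iso; split; last first.
  apply/seteqP; split => [_ [s Ks <-]|u Ku].
    by rewrite -image_comp; apply: (iso_simplex g_iso); apply: (iso_simplex f_iso).
  have [t /(iso_lift f_iso) [s Ks ->] ->] := iso_lift g_iso Ku.
  by exists s => //; rewrite image_comp.
have f1 x : K1 [set x] -> K2 [set f x].
  by move=> /(iso_simplex f_iso); rewrite image_set1.
move=> x y /set_mem Kx /set_mem Ky e; apply: (iso_vertex_inj f_iso) => //.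
by apply: (iso_vertex_inj g_iso) e; apply: f1.
Qed.
(** * Root systems and affine reflections *)

Section RootSystem.
Variables (R : realType) (n : nat) (D : root_system R n).
Local Notation V := 'rV[R]_n.
Variable ip : V -> V -> R.
Hypothesis ipC : forall u v, ip u v = ip v u.
Hypothesis ipP : forall c u v w, ip (c *: u + v) w = c * ip u w + ip v w.
Hypothesis ip_gt0 : forall u, u != 0 -> 0 < ip u u.
Hypothesis ipW : weyl_invariant D ip.
Local Notation h := (coroot D).
Local Notation refl := (affine_reflection D).
Local Notation sref a := (affine_reflection D a 0).

Lemma ipDl u v w : ip (u + v) w = ip u w + ip v w.
Proof. by rewrite -[u]scale1r ipP mul1r scale1r. Qed.

Lemma ip0l w : ip 0 w = 0.
Proof. by apply: (addIr (ip 0 w)); rewrite -ipDl !add0r. Qed.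

Lemma ipZl c u w : ip (c *: u) w = c * ip u w.
Proof. by rewrite -[c *: u]addr0 ipP ip0l addr0. Qed.

Lemma ipNl u w : ip (- u) w = - ip u w.
Proof. by rewrite -scaleN1r ipZl mulN1r. Qed.

Lemma ipBl u v w : ip (u - v) w = ip u w - ip v w.
Proof. by rewrite ipDl ipNl. Qed.

Lemma ipDr u v w : ip w (u + v) = ip w u + ip w v.
Proof. by rewrite ipC ipDl !(ipC w). Qed.

Lemma ipZr c u w : ip w (c *: u) = c * ip w u.
Proof. by rewrite ipC ipZl ipC. Qed.

Lemma ipNr u w : ip w (- u) = - ip w u.
Proof. by rewrite ipC ipNl ipC. Qed.

Lemma ipBr u v w : ip w (u - v) = ip w u - ip w v.
Proof. by rewrite ipDr ipNr. Qed.

Lemma ip_suml (J : finType) (F : J -> V) w :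
  ip (\sum_j F j) w = \sum_j ip (F j) w.
Proof. by apply: (big_morph (ip^~ w)) => [u v|]; rewrite ?ipDl ?ip0l. Qed.

Lemma ip_ge0 u : 0 <= ip u u.
Proof. by have [->|/ip_gt0/ltW//] := eqVneq u 0; rewrite ip0l. Qed.

Lemma ip_eq0 u : ip u u = 0 -> u = 0.
Proof.
by move=> u0; apply/eqP; apply/negP => /negP /ip_gt0; rewrite u0 ltxx.
Qed.

Lemma hD a u v : h a (u + v) = h a u + h a v.
Proof. exact: linearD. Qed.
Lemma hN a u : h a (- u) = - h a u.
Proof. exact: linearN. Qed.
Lemma hB a u v : h a (u - v) = h a u - h a v.
Proof. exact: linearB. Qed.
Lemma hZ a c u : h a (c *: u) = c * h a u.
Proof. exact: linearZ. Qed.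
Lemma h0 a : h a 0 = 0.
Proof. exact: linear0. Qed.
Lemma h_sum a (J : finType) (F : J -> V) : h a (\sum_j F j) = \sum_j h a (F j).
Proof. exact: linear_sum. Qed.

Lemma root_neq0 a : roots D a -> a != 0.
Proof. by move=> ra; apply/eqP => a0; apply: (@roots_neq0 _ _ D); rewrite -a0. Qed.

Lemma root_sq_gt0 a : roots D a -> 0 < ip a a.
Proof. by move/root_neq0/ip_gt0. Qed.

Lemma srefE a v : sref a v = v - h a v *: a.
Proof. by rewrite /affine_reflection subr0. Qed.

Lemma sref_aw a k : roots D a -> affine_weyl D (refl a k).
Proof. by move=> ra; apply: (affine_weyl_refl k ra (affine_weyl_id D)). Qed.

Lemma sref_root a b : roots D a -> roots D b -> roots D (sref a b).
Proof. by move=> ra rb; rewrite srefE; apply: roots_stable. Qed.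

Lemma sref_sph a : roots D a -> spherical_weyl D (sref a).
Proof.
by move=> ra; split; [exact: sref_aw|rewrite srefE h0 scale0r subr0].
Qed.

Lemma ip_sref a u v : roots D a -> ip (sref a u) (sref a v) = ip u v.
Proof. by move=> ra; apply: ipW; apply: sref_sph. Qed.

Lemma srefN a : roots D a -> sref a a = - a.
Proof. by move=> ra; rewrite srefE coroot_diag // -[2]/(1 *+ 2) scaler_nat mulr2n
  opprD addNKr. Qed.

Lemma rootN a : roots D a -> roots D (- a).
Proof. by move=> ra; rewrite -srefN //; apply: sref_root. Qed.

(** Invariance under the reflection at [a], which negates [a], identifies the coroot with
    [2 a / (a | a)]. Passages between roots and coroots rest on this. *)
Lemma ip_h a v : roots D a -> 2 * ip a v = h a v * ip a a.
Proof.
move=> ra; have := ip_sref a v ra; rewrite srefN // ipNl srefE ipBr ipZr.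
lra.
Qed.

Lemma hE a v : roots D a -> h a v = 2 * ip a v / ip a a.
Proof. by move=> ra; rewrite ip_h // mulfK // gt_eqF // root_sq_gt0. Qed.

Lemma srefK a v : roots D a -> sref a (sref a v) = v.
Proof.
move=> ra; rewrite !srefE hB hZ coroot_diag // -[RHS]addr0 -addrA; congr (_ + _).
rewrite -opprD -scalerDl; apply/eqP; rewrite oppr_eq0 scaler_eq0.
by apply/orP; left; apply/eqP; ring.
Qed.

Lemma h_sref a b v : roots D a -> roots D b -> h (sref a b) v = h b (sref a v).
Proof.
move=> ra rb; rewrite !hE //; last exact: sref_root.
by rewrite ip_sref // -[in RHS](ip_sref b _ ra) srefK.
Qed.

Lemma hN_root b v : roots D b -> h (- b) v = - h b v.
Proof.
move=> rb; have /(hE v) -> := rootN rb; rewrite ipNl ipNl ipNr opprK (hE v rb).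
by rewrite mulrN mulNr.
Qed.

Lemma reflE a k v : refl a k v = sref a v + k%:~R *: a.
Proof. by rewrite srefE /affine_reflection scalerBl opprB addrA -addrA [_ - _]addrC
  addrA addrAC. Qed.

Lemma h_refl a k b v : roots D a -> roots D b ->
  h b (refl a k v) = h (sref a b) v + k%:~R * h b a.
Proof. by move=> ra rb; rewrite reflE hD hZ h_sref. Qed.

Lemma h_refl_self a k v : roots D a -> h a (refl a k v) = 2 * k%:~R - h a v.
Proof. by move=> ra; rewrite /affine_reflection hB hZ coroot_diag //; ring. Qed.

Lemma reflK a k v : roots D a -> refl a k (refl a k v) = v.
Proof.
move=> ra; rewrite {1}/affine_reflection h_refl_self // /affine_reflection.
rewrite -[RHS]addr0 -addrA -opprD -scalerDl; congr (_ + _); apply/eqP.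
by rewrite oppr_eq0 scaler_eq0; apply/orP; left; apply/eqP; ring.
Qed.

Lemma refl_fix a k v : h a v = k%:~R -> refl a k v = v.
Proof. by move=> e; rewrite /affine_reflection e subrr scale0r subr0. Qed.

(** By [ip_h] a coroot is its root rescaled by the norm, so [c] has to be [m (b | b) / (a | a)], and
    [b - c *: a] is then orthogonal to itself. In a nonreduced system [m] can differ from 1 and
    -1. *)
Lemma proportional_roots a b m : roots D a -> roots D b ->
  (forall v, h b v = m * h a v) -> exists2 c, b = c *: a & m * c = 1.
Proof.
move=> ra rb e; have ga := root_sq_gt0 ra; have gb := root_sq_gt0 rb.
pose c := m * ip b b / ip a a.
have : b - c *: a = 0.
  apply: ip_eq0; set w := _ - _.
  rewrite {1}/w ipBl ipZl; have := ip_h w rb; rewrite e => ewb.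
  have ewa := ip_h w ra; apply/eqP; rewrite subr_eq0; apply/eqP.
  have -> : ip b w = m * h a w * ip b b / 2 by lra.
  have -> : ip a w = h a w * ip a a / 2 by lra.
  by rewrite /c; field; rewrite gt_eqF.
move/eqP; rewrite subr_eq0 => /eqP eb; exists c => //.
have := e b; rewrite coroot_diag // eb hZ coroot_diag //; lra.
Qed.

(** The factors [m] of the coroot and [c] of the root cancel: a reflection depends only on its
    hyperplane, whichever of several proportional roots describes it. *)
Lemma level_refl_eq a k b l m : roots D a -> roots D b ->
  (forall v, h b v - l%:~R = m * (h a v - k%:~R)) -> refl b l = refl a k.
Proof.
move=> ra rb e.
have el : l%:~R = m * k%:~R :> R by have := e 0; rewrite !h0; lra.
have [|c eb mc] := @proportional_roots a b m ra rb; first by move=> v; have := e v; lra.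
apply/funext => v; rewrite /affine_reflection e eb scalerA.
by congr (_ - _ *: _); rewrite -[RHS]mul1r -mc; ring.
Qed.

Lemma aw_comp w w' : affine_weyl D w -> affine_weyl D w' -> affine_weyl D (w \o w').
Proof.
move=> aw aw'; elim: aw => [//|a k u ra au IH].
exact: (affine_weyl_refl k ra IH).
Qed.

Lemma aw_inv w : affine_weyl D w ->
  exists w', [/\ affine_weyl D w', cancel w w' & cancel w' w].
Proof.
elim=> [|a k u ra _ [u' [au' c1 c2]]]; first by exists id; split => //; constructor.
exists (u' \o refl a k); split; first exact: aw_comp au' (sref_aw k ra).
- by move=> v /=; rewrite reflK.
- by move=> v /=; rewrite c2 reflK.
Qed.

(** Affine Weyl group elements permute the hyperplanes and conjugate their reflections; integrality
    of the pairing of two roots keeps the shift of level an integer. Questions about the image of an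
    alcove under [w] are thus pulled back to the alcove. *)
Lemma aw_pull w : affine_weyl D w -> forall b, roots D b ->
  exists b' k, [/\ roots D b', forall v, h b (w v) = h b' v + k%:~R
    & forall l v, refl b l (w v) = w (refl b' (l - k) v)].
Proof.
elim=> [|a k u ra _ IH] b rb.
  by exists b, 0; split=> // [v|l v]; rewrite ?addr0 ?subr0.
have [b' [k' [rb' e1 e2]]] := IH _ (sref_root ra rb).
have /intrP [z ez] := coroot_int rb ra.
exists b', (k' + k * z); split => // [v|l v] /=.
  by rewrite h_refl // e1 ez intrD intrM addrA.
rewrite opprD addrA addrAC -e2.
have e3 := h_refl k (u v) ra rb; rewrite ez in e3.
rewrite /(refl b) e3 {1 3}/affine_reflection.
have e4 : h a (u v - (h (sref a b) (u v) - (l - k * z)%:~R) *: sref a b) =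
  h a (u v) + (h (sref a b) (u v) - (l - k * z)%:~R) * h a b.
  rewrite hB hZ (_ : h a (sref a b) = - h a b) ?mulrN ?opprK //.
  by rewrite srefE hB hZ coroot_diag //; ring.
rewrite /affine_reflection e4 -/(affine_reflection D a 0 b) intrB intrM srefE.
apply/rowP => i; rewrite !mxE; ring.
Qed.

(** * Simple roots, positivity and heights *)

Variables (I : finType) (alpha omega : I -> V).
Hypothesis halpha : root_basis D alpha.
Hypothesis homega : fundamental_coweights D alpha omega.

Lemma alpha_root i : roots D (alpha i).
Proof. by case: halpha. Qed.

Lemma alpha_span v : exists c : I -> R, v = \sum_i c i *: alpha i.
Proof.
case: halpha => _ /andP [/eqP e _] _.
have := memvf v; rewrite -e span_def big_image /= => /memv_sumP [us h1 ->].
have {}h1 i : exists c, us i = c *: alpha i by have /vlineP := h1 i isT.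
by exists (fun i => projT1 (cid (h1 i))); apply: eq_bigr => i _; case: cid.
Qed.

Lemma ip_alpha_omega i j :
  2 * ip (alpha j) (omega i) = (i == j)%:R * ip (alpha j) (alpha j).
Proof. by rewrite ip_h ?homega //; apply: alpha_root. Qed.

Lemma simple_eq0 v : (forall i, h (alpha i) v = 0) -> v = 0.
Proof.
move=> hv; have [c ev] := alpha_span v; apply: ip_eq0.
rewrite {1}ev ip_suml big1 // => i _; rewrite ipZl.
by have := ip_h v (alpha_root i); rewrite hv => e; apply/eqP; rewrite mulf_eq0;
  apply/orP; right; apply/eqP; lra.
Qed.

Lemma coweight_sum v : v = \sum_i h (alpha i) v *: omega i.
Proof.
apply/eqP; rewrite -subr_eq0; apply/eqP; apply: simple_eq0 => i.
rewrite hB h_sum (bigD1 i) //= big1 => [|j ji]; rewrite hZ homega ?eqxx ?(negPf ji).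
  by rewrite mulr1 addr0 subrr.
by rewrite mulr0.
Qed.

Lemma h_omega b v : h b v = \sum_i h b (omega i) * h (alpha i) v.
Proof. by rewrite {1}(coweight_sum v) h_sum; apply: eq_bigr => i _;
  rewrite hZ mulrC. Qed.

(** The coordinate of [v] along [alpha i] in the basis of simple roots: with respect to [ip] the
    coweights [omega i] are dual to this basis up to the factor [(alpha i | alpha i) / 2]. *)
Definition coef v i : R := 2 * ip v (omega i) / ip (alpha i) (alpha i).

Lemma alpha_sq_gt0 i : 0 < ip (alpha i) (alpha i).
Proof. exact: root_sq_gt0 (alpha_root i). Qed.

Lemma coef_sum (c : I -> R) i : coef (\sum_j c j *: alpha j) i = c i.
Proof.
rewrite /coef ip_suml mulr_sumr (bigD1 i) //= big1 => [|j ji].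
  rewrite addr0 ipZl mulrCA ip_alpha_omega eqxx mul1r mulfK //.
  by rewrite gt_eqF // alpha_sq_gt0.
by rewrite ipZl mulrCA ip_alpha_omega eq_sym (negPf ji) mul0r mulr0.
Qed.

Lemma coefE v : v = \sum_i coef v i *: alpha i.
Proof.
have [c e] := alpha_span v; rewrite {1}e; apply: eq_bigr => i _.
by rewrite e coef_sum.
Qed.

Lemma coefD u v i : coef (u + v) i = coef u i + coef v i.
Proof. by rewrite /coef ipDl mulrDr mulrDl. Qed.

Lemma coefZ c v i : coef (c *: v) i = c * coef v i.
Proof. by rewrite /coef ipZl mulrCA !mulrA. Qed.

Lemma coefN v i : coef (- v) i = - coef v i.
Proof. by rewrite -scaleN1r coefZ mulN1r. Qed.

Lemma coefB u v i : coef (u - v) i = coef u i - coef v i.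
Proof. by rewrite coefD coefN. Qed.

Lemma coef_alpha j i : coef (alpha j) i = (i == j)%:R.
Proof.
by rewrite /coef ip_alpha_omega; case: eqP => [->|_];
  rewrite ?mul0r // mul1r divff // gt_eqF // alpha_sq_gt0.
Qed.

Lemma coef_root b i : roots D b ->
  coef b i = h b (omega i) * ip b b / ip (alpha i) (alpha i).
Proof. by move=> rb; rewrite /coef ip_h. Qed.

(** Positivity is read off the coroot: its values on the [omega i] are its coefficients over the
    simple coroots. By [coef_ge0] this agrees with positivity of the root. *)
Definition pos b := forall i, 0 <= h b (omega i).

Lemma coef_ge0 b i : roots D b -> (0 <= coef b i) = (0 <= h b (omega i)).
Proof.
move=> rb; rewrite coef_root // pmulr_lge0 ?invr_gt0 ?alpha_sq_gt0 //.
by rewrite pmulr_lge0 // root_sq_gt0.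
Qed.

Lemma coef_eq0 b i : roots D b -> (coef b i == 0) = (h b (omega i) == 0).
Proof.
move=> rb; rewrite coef_root // !mulf_eq0 invr_eq0.
by rewrite !(gt_eqF (root_sq_gt0 _)) ?orbF //; apply: alpha_root.
Qed.

Lemma root_nat b : roots D b -> exists c : I -> nat,
  (pos b /\ forall i, coef b i = (c i)%:R) \/
  (pos (- b) /\ forall i, coef b i = - (c i)%:R).
Proof.
move=> rb; case: halpha => _ _ /(_ b rb) [c e]; exists c.
have key i : coef (\sum_i alpha i *+ c i) i = (c i)%:R.
  by rewrite -(coef_sum (fun i => (c i)%:R)); congr coef; apply: eq_bigr => j _;
    rewrite scaler_nat.
case: e => e; [left|right]; (split; last by move=> i; rewrite e ?coefN key).
  by move=> i; rewrite -coef_ge0 // e key.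
by move=> i; rewrite -(coef_ge0 _ (rootN rb)) coefN e coefN opprK key.
Qed.

Lemma root_pos_neg b : roots D b -> pos b \/ pos (- b).
Proof. by move=> /root_nat [c [[]|[]]]; [left|right]. Qed.

(** For a root [b] this means proportionality to [alpha i]; a nonreduced system may contain twice a
    simple root. *)
Definition par b i := forall j, j != i -> h b (omega j) = 0.

Lemma par_h b i v : par b i -> h b v = h b (omega i) * h (alpha i) v.
Proof.
by move=> pb; rewrite h_omega (bigD1 i) //= big1 ?addr0 // => j /pb ->; rewrite mul0r.
Qed.

Lemma sref_omega i j : sref (alpha i) (omega j) = omega j - (j == i)%:R *: alpha i.
Proof. by rewrite srefE homega. Qed.

Lemma h_sref_omega i b j : roots D b ->
  h (sref (alpha i) b) (omega j) = h b (omega j) - (j == i)%:R * h b (alpha i).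
Proof.
by move=> rb; rewrite h_sref //; [rewrite sref_omega hB hZ|apply: alpha_root].
Qed.

(** The reflection changes only the coefficient at [i]. As [b] is not proportional to [alpha i],
    another coefficient is positive and stays so, which excludes a negative root. *)
Lemma sref_pos i b : roots D b -> pos b -> ~ par b i -> pos (sref (alpha i) b).
Proof.
move=> rb pb nb.
have [j ji hj] : exists2 j, j != i & h b (omega j) != 0.
  apply: contrapT => H; apply: nb => j ji; apply/eqP; apply/negP => /negP hj.
  by apply: H; exists j.
have rsb := sref_root (alpha_root i) rb.
case: (root_pos_neg rsb) => // /(_ j).
rewrite hN_root // h_sref_omega // (negPf ji) mul0r subr0 oppr_ge0 => le0.
by have := pb j; rewrite le_eqVlt eq_sym (negPf hj) /= => /lt_le_trans/(_ le0);
  rewrite ltxx.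
Qed.

Definition height v := \sum_i coef v i.

Lemma height_sref i v : height (sref (alpha i) v) = height v - h (alpha i) v.
Proof.
rewrite /height (eq_bigr (fun j => coef v j - h (alpha i) v * (j == i)%:R)); last first.
  by move=> j _; rewrite srefE coefB coefZ coef_alpha.
rewrite sumrB -mulr_sumr (_ : \sum_j (j == i)%:R = 1) ?mulr1 //.
by rewrite (bigD1 i) //= big1 ?eqxx ?addr0 // => j /negPf ->.
Qed.

(** The positive number [ip z z] is the sum of the [coef z i * ip (alpha i) z], so some summand is
    positive. *)
Lemma acute_simple z : z != 0 -> (forall i, 0 <= coef z i) ->
  exists2 i, 0 < coef z i & 0 < h (alpha i) z.
Proof.
move=> z0 pz; apply: contrapT => H; have := ip_gt0 z0.
rewrite {1}(coefE z) ip_suml ltNge => /negP; apply; apply: sumr_le0 => i _.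
rewrite ipZl; have := pz i; rewrite le_eqVlt => /orP [/eqP <-|ci];
  first by rewrite mul0r.
apply: mulr_ge0_le0; first exact: ltW.
have := ip_h z (alpha_root i); have := alpha_sq_gt0 i.
have : h (alpha i) z <= 0; last by nra.
by rewrite leNgt; apply/negP => gt; apply: H; exists i.
Qed.

Lemma pos_root_simple b : roots D b -> pos b ->
  exists2 i, 0 < coef b i & 1 <= h (alpha i) b.
Proof.
move=> rb pb; have [|i|i ci hi] := @acute_simple b; first exact: root_neq0.
  by rewrite coef_ge0.
exists i => //; have /intrP [z ez] := coroot_int (alpha_root i) rb.
by move: hi; rewrite ez ltr0z -[1]/(1%:~R) ler_int gtz0_ge1.
Qed.

(** By integrality a suitable simple reflection lowers the height of a positive root by at least 1,
    and keeps it positive unless the root is proportional to that simple root. An induction over an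
    integer bound on the height therefore ends at such multiples. *)
Lemma pos_root_ind (P : V -> Prop) :
  (forall i b, roots D b -> par b i -> P b) ->
  (forall i b, roots D b -> P b -> P (sref (alpha i) b)) ->
  forall b, roots D b -> pos b -> P b.
Proof.
move=> Ppar Ps.
suff key N : forall b, roots D b -> pos b -> height b < N%:R -> P b.
  move=> b rb pb; apply: (key (Num.trunc (height b)).+1) => //.
  have h_ge : 0 <= height b by apply: sumr_ge0 => i _; rewrite coef_ge0.
  exact: truncnS_gt.
elim: N => [|N IH] b rb pb hb.
  by move: hb; rewrite ltNge sumr_ge0 // => i _; rewrite coef_ge0.
have [i ci hi] := pos_root_simple rb pb.
case: (pselect (par b i)) => [|nb]; first exact: Ppar.
rewrite -(srefK b (alpha_root i)); apply: (Ps i).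
  by apply: sref_root => //; apply: alpha_root.
apply: IH; [by apply: sref_root => //; apply: alpha_root|exact: sref_pos|].
by rewrite height_sref; move: hb; rewrite -addn1 natrD; lra.
Qed.

Lemma root_ind (P : V -> Prop) :
  (forall i b, roots D b -> par b i -> P b) ->
  (forall i b, roots D b -> P b -> P (sref (alpha i) b)) ->
  forall b, roots D b -> P b.
Proof.
move=> Ppar Ps b rb; case: (root_pos_neg rb); first exact: pos_root_ind.
move=> pNb; rewrite -(opprK b).
apply: (pos_root_ind (P := fun v => P (- v))) (rootN rb) pNb => [i c rc pc|i c rc Pc].
  by apply: (Ppar i (- c) (rootN rc)) => j /pc; rewrite hN_root // => ->; rewrite oppr0.
have := Ps i _ (rootN rc) Pc.
by rewrite !srefE hN scaleNr opprK opprB addrC.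
Qed.

Lemma root_omega_neq0 b : roots D b -> exists i, h b (omega i) != 0.
Proof.
move=> rb; apply: contrapT => H; have := coroot_diag rb.
rewrite h_omega big1 => [/eqP|i _]; first by rewrite eq_sym pnatr_eq0.
by rewrite (_ : h b (omega i) = 0) ?mul0r //; apply/eqP/negP => /negP hi; apply: H;
  exists i.
Qed.

Definition indivisible a := ~ roots D (2^-1 *: a).

Lemma simple_indivisible i : indivisible (alpha i).
Proof.
move=> r; have [c ec] := root_nat r.
have e : coef (2^-1 *: alpha i) i = 2^-1 by rewrite coefZ coef_alpha eqxx mulr1.
have : (1 : R) = 2%:R * 2^-1 by rewrite divff.
case: ec => [] [_ /(_ i)]; rewrite e => ->.
  by rewrite -natrM -[1]/(1%:R) => /eqP; rewrite eqr_nat; lia.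
rewrite mulrN -natrM => eq1; have : 0 <= (2 * c i)%:R :> R by []; lra.
Qed.

(** For proportional roots the pairings [h a b] and [h b a] have product 4. If [h a b] were 1 or -1,
    half of [a] would be a root; so [h a b] is even, and [z] is half of it. *)
Lemma indivisible_int a b m : roots D a -> roots D b -> indivisible a ->
  (forall v, h b v = m * h a v) -> exists z : int, forall v, h a v = z%:~R * h b v.
Proof.
move=> ra rb na e; have [c eb mc] := proportional_roots ra rb e.
have /intrP [p ep] := coroot_int ra rb; have /intrP [q eq_q] := coroot_int rb ra.
rewrite eb hZ coroot_diag // in ep; rewrite e coroot_diag // in eq_q.
have pq : p * q = 4.
  apply/eqP; rewrite -(eqr_int R) intrM -ep -eq_q.
  have -> : c * 2 * (m * 2) = 4 * (m * c) by ring.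
  by rewrite mc mulr1.
have np1 : p != 1.
  apply/eqP => p1; apply: na; rewrite (_ : 2^-1 = c) -?eb //.
  by move: ep; rewrite p1; lra.
have npN1 : p != -1.
  apply/eqP => p1; apply: na; rewrite (_ : 2^-1 = - c); last by move: ep;
    rewrite p1; lra.
  by rewrite scaleNr -eb; apply: rootN.
have [z ez] : exists z : int, p = 2 * z.
  have : (`|p| * `|q|)%N = 4%N by rewrite -abszM pq.
  move=> pqN; have : (`|p| <= 4)%N by apply: dvdn_leq => //; rewrite -pqN dvdn_mulr.
  move=> p4; exists (p %/ 2)%Z; rewrite mulrC.
  have : p = 2 \/ p = -2 \/ p = 4 \/ p = -4.
    by case: p ep pq np1 npN1 pqN p4 => [] [|[|[|[|[|?]]]]] //=; nia.
  by case=> [->|[->|[->|->]]].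
exists z => v; rewrite e mulrA (_ : z%:~R = c) ?(mulrC c) ?mc ?mul1r //.
by move: ep; rewrite ez intrM; lra.
Qed.

(** * Irreducibility and the highest coroot *)

Hypothesis hirr : irreducible_roots D.

(** Dominance forces the simple roots in the support of [b] to be orthogonal to all others. Simple
    reflections then never mix the two classes, so every root is supported in one of them, and
    irreducibility leaves only the class of [b]. *)
Lemma root_full_support b i : roots D b -> (forall j, 0 <= h b (alpha j)) ->
  pos b -> 0 < h b (omega i).
Proof.
move=> rb dom pb.
pose S j := h b (omega j) != 0.
have orth j k : S j -> ~~ S k -> h (alpha j) (alpha k) = 0.
  move=> Sj Sk.
  have le0 l : S l -> h (alpha l) (alpha k) <= 0.
    move=> Sl; rewrite leNgt; apply/negP => gt0.
    have lk : l != k by apply: contraNneq Sk => <-.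
    have pl : pos (alpha l).
      by move=> x; rewrite homega.
    have nk : ~ par (alpha k) l.
      move=> /(_ k); rewrite eq_sym lk homega eqxx => /(_ isT) /eqP.
      by rewrite oner_eq0.
    have pk : pos (alpha k) by move=> x; rewrite homega.
    have := sref_pos (alpha_root k) pk nk.
    move=> /(_ l); rewrite h_sref_omega ?eqxx ?homega //; last exact: alpha_root.
    rewrite (negPf lk) sub0r mul1r oppr_ge0 => le0.
    have := ip_h (alpha l) (alpha_root k); have := ip_h (alpha k) (alpha_root l).
    rewrite (ipC (alpha k)); have := alpha_sq_gt0 k; have := alpha_sq_gt0 l.
    nra.
  (* For [k] outside the support, this nonnegative number is a sum of nonpositive terms, so the term
     at [j] vanishes. *)
  have := dom k; rewrite (h_omega b) (bigD1 j) //= => ge0.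
  have : \sum_(x | x != j) h b (omega x) * h (alpha x) (alpha k) <= 0.
    apply: sumr_le0 => x _; have [Sx|/negPn/eqP ->] := boolP (S x).
      by apply: mulr_ge0_le0; rewrite ?le0.
    by rewrite mul0r.
  have := le0 _ Sj; have : 0 < h b (omega j) by rewrite lt_neqAle pb eq_sym andbT.
  nra.
have orthC j k : S j -> ~~ S k -> h (alpha k) (alpha j) = 0.
  move=> Sj Sk; have := ip_h (alpha j) (alpha_root k).
  have := ip_h (alpha k) (alpha_root j); rewrite (orth j k) // (ipC (alpha j)).
  move=> -> ; rewrite mul0r => /esym/eqP; rewrite mulf_eq0 => /orP [/eqP //|].
  by rewrite gt_eqF // alpha_sq_gt0.
have supp a : roots D a ->
  (forall j, S j -> h a (omega j) = 0) \/ (forall j, ~~ S j -> h a (omega j) = 0).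
  move: a; apply: root_ind => [j a ra pa|j a ra IH].
    have [Sj|Sj] := boolP (S j); [right|left] => k Sk; apply: pa.
      by apply: contraNneq Sk => ->.
    by apply: contraTneq Sk => ->.
  have [Sj|Sj] := boolP (S j); case: IH => IH.
  - left => k Sk; rewrite h_sref_omega // IH // h_omega big1 ?mulr0 ?subr0 // => l _.
    by have [/IH ->|Sl] := boolP (S l); rewrite ?mul0r // (orthC j) ?mulr0.
  - right => k Sk; rewrite h_sref_omega // IH // (_ :
    (k == j) = false) ?mul0r ?subr0 //.
    by apply/negP => /eqP e; rewrite e Sj in Sk.
  - left => k Sk; rewrite h_sref_omega // IH // (_ : (k == j) = false) ?mul0r ?subr0 //.
    by apply/negP => /eqP e; rewrite e (negPf Sj) in Sk.
  - right => k Sk; rewrite h_sref_omega // IH // h_omega big1 ?mulr0 ?subr0 // => l _.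
    by have [Sl|/IH ->] := boolP (S l); rewrite ?mul0r // orth ?mulr0.
pose P := [set a | roots D a /\ forall j, S j -> h a (omega j) = 0].
pose Q := [set a | roots D a /\ forall j, ~~ S j -> h a (omega j) = 0].
have PUQ : P `|` Q = roots D.
  apply/seteqP; split => [a [] []//|a ra].
  by case: (supp a ra) => H; [left|right].
have PIQ : P `&` Q = set0.
  apply/seteqP; split => // a [[ra a1] [_ a2]].
  by have [k] := root_omega_neq0 ra; have [/a1 ->|/a2 ->] := boolP (S k); rewrite eqxx.
have PQ0 a a' : P a -> Q a' -> h a a' = 0.
  move=> [ra a1] [ra' a2]; rewrite h_omega big1 // => k _.
  have [/a1 ->|Sk] := boolP (S k); first by rewrite mul0r.
  rewrite (coefE a') h_sum big1 ?mulr0 // => l _; rewrite hZ.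
  have [Sl|Sl] := boolP (S l); first by rewrite orthC // mulr0.
  by have /eqP := a2 l Sl; rewrite -coef_eq0 // => /eqP ->; rewrite mul0r.
case: (hirr.2 P Q PUQ PIQ PQ0).
- move=> P0; have [Si|Si] := boolP (S i); first by rewrite lt_neqAle pb eq_sym andbT.
  suff : P (alpha i) by rewrite P0.
  split; first exact: alpha_root.
  by move=> j Sj; rewrite homega; case: eqP => // e; rewrite -e Sj in Si.
- move=> Q0; suff : Q b by rewrite Q0.
  by split=> // j /negPn/eqP.
Qed.

Lemma seq_argmax (T : eqType) (s : seq T) (F : T -> R) : s != [::] ->
  exists2 a, a \in s & forall b, b \in s -> F b <= F a.
Proof.
elim: s => [//|x [|y s] IH] _.
  by exists x; rewrite ?mem_head // => b; rewrite inE => /eqP ->.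
have [a sa ha] := IH isT; have [le|lt] := leP (F x) (F a).
  exists a; first by rewrite inE sa orbT.
  by move=> b; rewrite inE => /orP [/eqP ->//|]; apply: ha.
exists x; first by rewrite mem_head.
move=> b; rewrite inE => /orP [/eqP -> //|/ha le].
exact: le_trans le (ltW lt).
Qed.

Lemma root_argmax (F : V -> R) :
  exists2 a, roots D a & forall b, roots D b -> F b <= F a.
Proof.
have [s es] := (finite_seqP (roots D)).1 (roots_finite D).
have [[a ra] _] := hirr.
have [|b sb hb] := @seq_argmax _ s F.
  by apply/eqP => s0; move: ra; rewrite es s0.
by exists b; [rewrite es|move=> c; rewrite es; apply: hb].
Qed.

(** Reflecting a maximiser in [alpha j] changes the weighted sum by [- w j * h a (alpha j)], which
    cannot be positive. *)
Lemma dominant_argmax (w : I -> R) : (forall i, 0 < w i) ->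
  exists a, [/\ roots D a, forall j, 0 <= h a (alpha j)
    & forall b, roots D b -> \sum_i w i * h b (omega i) <= \sum_i w i * h a (omega i)].
Proof.
move=> w_gt0; have [a ra ha] := root_argmax (fun b => \sum_i w i * h b (omega i)).
exists a; split => // j; have := ha _ (sref_root (alpha_root j) ra).
rewrite -subr_ge0 -sumrB (bigD1 j) //= big1 => [|k kj].
  rewrite h_sref_omega // eqxx mul1r addr0 -mulrBr opprB addrC subrK.
  by rewrite pmulr_rge0.
by rewrite h_sref_omega // (negPf kj) mul0r subr0 subrr.
Qed.

Lemma h_coef a v : h a v = \sum_i coef v i * h a (alpha i).
Proof. by rewrite {1}(coefE v) h_sum; apply: eq_bigr => i _; rewrite hZ. Qed.

Lemma dominant_pos a : roots D a -> (forall j, 0 <= h a (alpha j)) -> pos a.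
Proof.
move=> ra dom; case: (root_pos_neg ra) => // pNa.
have : h a a <= 0.
  rewrite h_coef; apply: sumr_le0 => i _; apply: mulr_le0_ge0 => //.
  by have := pNa i; rewrite -coef_ge0 ?coefN ?oppr_ge0 //; apply: rootN.
by rewrite coroot_diag // leNgt ltr0n.
Qed.

(** The coefficients of [a] are all positive by full support; the pairings of the coroot of [b] with
    the simple roots are nonnegative and, as [h b b = 2], not all zero. *)
Lemma dominant_pairing a b : roots D a -> roots D b ->
  (forall j, 0 <= h a (alpha j)) -> (forall j, 0 <= h b (alpha j)) -> 0 < h b a.
Proof.
move=> ra rb da db; have pa := dominant_pos ra da.
have ca i : 0 < coef a i.
  by rewrite lt_neqAle coef_ge0 // eq_sym coef_eq0 // pa andbT gt_eqF //
    root_full_support.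
rewrite lt_neqAle h_coef sumr_ge0 ?andbT => [|i _]; last by rewrite mulr_ge0 // ltW.
apply/negP => /eqP/esym/eqP; rewrite psumr_eq0 => [/allP H|i _];
  last by rewrite mulr_ge0 // ltW.
have := coroot_diag rb; rewrite h_coef big1 => [/eqP|i _];
  first by rewrite eq_sym pnatr_eq0.
have := H i (mem_index_enum i); rewrite mulf_eq0 gt_eqF //= => /eqP ->.
by rewrite mulr0.
Qed.

(** If one of the pairings is 1, a reflection produces the difference of the coroots. If both are at
    least 2, the equality case of Cauchy-Schwarz makes the roots proportional, and then both
    pairings are 2. *)
Lemma acute_coroots a b : roots D a -> roots D b -> 0 < h a b -> 0 < h b a ->
  [\/ forall v, h a v = h b v,
      exists2 c, roots D c & forall v, h c v = h a v - h b v
    | exists2 c, roots D c & forall v, h c v = h b v - h a v].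
Proof.
move=> ra rb; have /intrP [p ep] := coroot_int ra rb.
have /intrP [q eq_q] := coroot_int rb ra; rewrite ep eq_q !ltr0z => p_gt0 q_gt0.
have [p1|p1] := eqVneq p 1.
  apply: Or32; exists (sref b a); first exact: sref_root.
  by move=> v; rewrite h_sref // srefE hB hZ ep p1 mulr1.
have [q1|q1] := eqVneq q 1.
  apply: Or33; exists (sref a b); first exact: sref_root.
  by move=> v; rewrite h_sref // srefE hB hZ eq_q q1 mulr1.
apply: Or31.
have p2 : 2 <= p%:~R :> R by rewrite -[2]/(2%:~R) ler_int; lia.
have q2 : 2 <= q%:~R :> R by rewrite -[2]/(2%:~R) ler_int; lia.
have ga := root_sq_gt0 ra; have gb := root_sq_gt0 rb.
have e1 := ip_h b ra; have e2 := ip_h a rb.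
rewrite ep in e1; rewrite eq_q (ipC b a) in e2.
have eb : b = (p%:~R / 2) *: a.
  apply/eqP; rewrite -subr_eq0; apply/eqP; apply: ip_eq0.
  apply/eqP; rewrite eq_le ip_ge0 andbT ipBl !ipBr !ipZl !ipZr (ipC b a).
  have -> : ip a b = p%:~R * ip a a / 2 by lra.
  suff : ip b b * 2 <= p%:~R * ip a a by nra.
  nra.
have p2' : p%:~R = 2 :> R.
  have := coroot_diag rb; rewrite {2}eb hZ eq_q => e3; nra.
by move=> v; rewrite eb p2' divff // scale1r.
Qed.

(* By [acute_coroots] the maximiser for the unit weights is a maximiser for all
   positive weights; a large weight at [i] isolates the coefficient at [i]. *)
Lemma highest_coroot : exists t, [/\ roots D t, forall i, 0 < h t (omega i)
  & forall b i, roots D b -> h b (omega i) <= h t (omega i)].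
Proof.
have [t [rt dt mt]] := dominant_argmax (fun=> ltr01).
exists t; split => // [i|b i rb].
  by apply: root_full_support => //; apply: dominant_pos.
have maxw (w : I -> R) : (forall i, 0 < w i) ->
    \sum_i w i * h b (omega i) <= \sum_i w i * h t (omega i).
  move=> w_gt0; have [a [ra da ma]] := dominant_argmax w_gt0.
  apply: (le_trans (ma b rb)).
  have eq_sums c (F : I -> R) : (forall i, 0 < F i) -> roots D c ->
      (forall j, 0 <= h c (omega j)) -> \sum_j F j * h c (omega j) <= 0 -> False.
    move=> F_gt0 rc pc le0; have [j hj] := root_omega_neq0 rc.
    have : 0 < h c (omega j) by rewrite lt_neqAle eq_sym hj pc.
    move=> hj0; move: le0; rewrite (bigD1 j) //= leNgt => /negP; apply.
    by apply: ltr_wpDr; [apply: sumr_ge0 => x _; apply: mulr_ge0 => //;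
      apply: ltW|apply: mulr_gt0].
  case: (acute_coroots rt ra) => [||e|[c rc ec]|[c rc ec]].
  - exact: dominant_pairing.
  - exact: dominant_pairing.
  - by apply: ler_sum => j _; rewrite e.
  - case: (root_pos_neg rc) => pc.
      apply: ler_sum => j _; apply: ler_wpM2l; first exact: ltW.
      by have := pc j; rewrite ec subr_ge0.
    have [] := eq_sums (- c) (fun=> 1) (fun=> ltr01) (rootN rc) pc.
    have := mt a ra; rewrite -subr_le0 -sumrB; congr (_ <= _).
    by apply: eq_bigr => j _; rewrite hN_root // ec; ring.
  - case: (root_pos_neg rc) => pc.
      have [] := eq_sums c (fun=> 1) (fun=> ltr01) rc pc.
      have := mt a ra; rewrite -subr_le0 -sumrB; congr (_ <= _).
      by apply: eq_bigr => j _; rewrite ec; ring.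
    apply: ler_sum => j _; apply: ler_wpM2l; first exact: ltW.
    by have := pc j; rewrite hN_root // ec opprB subr_ge0.
rewrite leNgt; apply/negP; rewrite -subr_gt0; set e := _ - _ => e_gt0.
(* The extra weight at [i] will add [|s| + 1] to the difference [s] under unit weights, so that the
   total is positive, against [maxw]. *)
pose s := \sum_j (h b (omega j) - h t (omega j)).
have wsum x : \sum_j (1 + (j == i)%:R * ((`|s| + 1) / e)) * h x (omega j)
    = \sum_j h x (omega j) + (`|s| + 1) / e * h x (omega i).
  rewrite (eq_bigr (fun j => h x (omega j) + (j == i)%:R * ((`|s| + 1) / e * h x
    (omega j)))).
    rewrite big_split /=; congr (_ + _); rewrite (bigD1 i) //= big1 ?eqxx ?mul1r
      ?addr0 //.
    by move=> j /negPf ->; rewrite mul0r.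
  by move=> j _; ring.
have := maxw (fun j => 1 + (j == i)%:R * ((`|s| + 1) / e)) _.
have pos_w j : 0 < 1 + (j == i)%:R * ((`|s| + 1) / e).
  apply: ltr_pwDl => //; apply: mulr_ge0 => //; apply: divr_ge0; last exact: ltW.
  by rewrite addr_ge0.
move=> /(_ pos_w); rewrite !wsum -subr_ge0.
have -> : \sum_j h t (omega j) + (`|s| + 1) / e * h t (omega i) -
   (\sum_j h b (omega j) + (`|s| + 1) / e * h b (omega i)) = - s - (`|s| + 1).
  by rewrite /s sumrB /e; field; rewrite gt_eqF.
by have := ler_norm (- s); rewrite normrN; lra.
Qed.

(** * The fundamental alcove *)

Variable theta : V.
Hypothesis theta_root : roots D theta.
Hypothesis theta_gt0 : forall i, 0 < h theta (omega i).
Hypothesis theta_max : forall b i, roots D b -> h b (omega i) <= h theta (omega i).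

(* The walls of the fundamental alcove are indexed by [option I]; [None] stands
   for the affine wall [H_(theta,1)], which is opposite to the vertex 0. *)
Definition wall_root (j : option I) := if j is Some i then alpha i else theta.
Definition wall_level (j : option I) : int := if j is Some _ then 0 else 1.
Definition wall_scale (j : option I) : R :=
  if j is Some i then h theta (omega i) else -1.
Definition wall_refl j := refl (wall_root j) (wall_level j).
Definition vtx (j : option I) : V :=
  if j is Some i then (h theta (omega i))^-1 *: omega i else 0.

(* Barycentric coordinates with respect to the vertices [vtx j]. *)
Definition bary j v := wall_scale j * (h (wall_root j) v - (wall_level j)%:~R).
Definition fund_alcove : set V := [set v | forall j, 0 <= bary j v].

Lemma wall_rootP j : roots D (wall_root j).
Proof. by case: j => [i|] //=; apply: alpha_root. Qed.

Lemma wall_scale_neq0 j : wall_scale j != 0.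
Proof. by case: j => [i|] /=; rewrite ?oppr_eq0 ?oner_eq0 ?gt_eqF. Qed.

Lemma baryN v : bary None v = 1 - h theta v.
Proof. by rewrite /bary /=; ring. Qed.

Lemma baryS i v : bary (Some i) v = h theta (omega i) * h (alpha i) v.
Proof. by rewrite /bary /= subr0. Qed.

Lemma bary_vtx j k : bary j (vtx k) = (j == k)%:R.
Proof.
case: j => [i|]; rewrite ?baryS ?baryN; case: k => [k|] /=; rewrite ?h0 ?hZ.
- rewrite homega; change ((Some i == Some k) : bool) with (i == k).
  rewrite eq_sym; case: eqP => [->|_]; last by rewrite !mulr0.
  by rewrite mulr1 divff // gt_eqF.
- by rewrite mulr0.
- by rewrite mulVf ?subrr // gt_eqF.
- by rewrite subr0.
Qed.

Lemma big_option (F : option I -> R) : \sum_j F j = F None + \sum_i F (Some i).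
Proof.
rewrite (bigD1 None) //=; congr (_ + _).
rewrite (reindex_omap Some id) /=; first by apply: eq_bigl => i; rewrite eqxx.
by case.
Qed.

Lemma bary_sum v : \sum_j bary j v = 1.
Proof.
rewrite big_option baryN (h_omega theta) (eq_bigr _ (fun i _ => baryS i v)).
by rewrite subrK.
Qed.

Lemma h_bary b c v : h b v - c = \sum_j bary j v * (h b (vtx j) - c).
Proof.
rewrite (eq_bigr (fun j => bary j v * h b (vtx j) - bary j v * c));
  last by move=> j _; ring.
rewrite sumrB -mulr_suml bary_sum mul1r; congr (_ - _).
rewrite big_option /= h0 mulr0 add0r h_omega; apply: eq_bigr => i _.
by rewrite hZ baryS [RHS]mulrACA divff ?mul1r 1?[LHS]mulrC // gt_eqF.
Qed.

Lemma bary_comb (c : option I -> R) j : \sum_k c k = 1 ->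
  bary j (\sum_k c k *: vtx k) = c j.
Proof.
move=> c1; transitivity (\sum_k c k * bary j (vtx k)); last first.
  rewrite (bigD1 j) //= big1 => [|k kj]; rewrite bary_vtx ?eqxx ?mulr1 ?addr0 //.
  by rewrite eq_sym (negPf kj) mulr0.
rewrite /bary h_sum -[X in _ - X]mul1r -c1 mulr_suml -sumrB mulr_sumr.
by apply: eq_bigr => k _; rewrite hZ; ring.
Qed.

Lemma bary_eq0_refl j v : bary j v = 0 -> wall_refl j v = v.
Proof.
move=> /eqP; rewrite mulf_eq0 (negPf (wall_scale_neq0 j)) /= subr_eq0 => /eqP.
exact: refl_fix.
Qed.

Lemma wall_refl_vtx j k : k != j -> wall_refl j (vtx k) = vtx k.
Proof. by move=> kj; apply: bary_eq0_refl; rewrite bary_vtx eq_sym (negPf kj). Qed.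

Lemma wall_reflK j : involutive (wall_refl j).
Proof. by move=> v; apply: reflK; apply: wall_rootP. Qed.

Lemma wall_refl_aw j : affine_weyl D (wall_refl j).
Proof. by apply: sref_aw; apply: wall_rootP. Qed.

Lemma bary_wall_refl j v : bary j (wall_refl j v) = - bary j v.
Proof.
by rewrite /bary h_refl_self; [ring|apply: wall_rootP].
Qed.

Lemma fund_alcove_vtx k : fund_alcove (vtx k).
Proof. by move=> j; rewrite bary_vtx. Qed.

(** Pulled back by [w], the level function vanishes at every vertex of the fundamental alcove but
    [vtx j], so it is a multiple of [bary j]. This turns a reflection acting on the left into a wall
    reflection on the right. *)
Lemma panel_refl w b k j : affine_weyl D w -> roots D b ->
  (forall i, i != j -> h b (w (vtx i)) = k%:~R) ->
  forall v, refl b k (w v) = w (wall_refl j v).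
Proof.
move=> aw rb hk v; have [b' [k' [rb' e1 e2]]] := aw_pull aw rb.
rewrite e2; congr w.
rewrite (level_refl_eq (k := wall_level j) (m :=
  (h b' (vtx j) - (k - k')%:~R) * wall_scale j) (wall_rootP j) rb') // => u.
rewrite h_bary (bigD1 j) //= big1 ?addr0 => [|i ij]; first by rewrite /bary; ring.
by have := hk i ij; rewrite e1 intrB => <-; rewrite addrK subrr mulr0.
Qed.

Lemma fund_alcove_pos b v : roots D b -> pos b -> fund_alcove v ->
  0 <= h b v <= 1.
Proof.
move=> rb pb Cv.
have hi i : 0 <= h (alpha i) v.
  by have := Cv (Some i); rewrite baryS pmulr_rge0.
have := Cv None; rewrite baryN subr_ge0 => le1.
rewrite h_omega sumr_ge0 /=; last by move=> i _; apply: mulr_ge0.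
apply: le_trans le1; rewrite (h_omega theta); apply: ler_sum => i _.
by apply: ler_wpM2r => //; apply: theta_max.
Qed.

(** No hyperplane cuts through an alcove: by maximality of [theta] positive coroots take values
    between 0 and 1 on the fundamental alcove, and [aw_pull] shifts this by an integer. *)
Lemma strip w b : affine_weyl D w -> roots D b ->
  exists k : int, forall v, fund_alcove v -> k%:~R <= h b (w v) <= k%:~R + 1.
Proof.
move=> aw rb; have [b' [k' [rb' e1 _]]] := aw_pull aw rb.
case: (root_pos_neg rb') => pb.
  exists k' => v Cv; rewrite e1; have := fund_alcove_pos rb' pb Cv.
  by move=> /andP [? ?]; apply/andP; split; lra.
exists (k' - 1) => v Cv; rewrite e1 intrB.
have := fund_alcove_pos (rootN rb') pb Cv; rewrite hN_root //.
by move=> /andP [? ?]; apply/andP; split; lra.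
Qed.

Lemma strip_lt w b c d v : affine_weyl D w -> roots D b -> fund_alcove v ->
  h b (w v) - c < d -> exists i, h b (w (vtx i)) - c < d.
Proof.
move=> aw rb Cv lt_d; apply: contrapT => H.
have [b' [k' [rb' e1 _]]] := aw_pull aw rb.
move: lt_d; rewrite ltNge => /negP; apply; rewrite -subr_ge0.
rewrite e1 (_ : _ - d = h b' v - (c + d - k'%:~R)); last by ring.
rewrite h_bary; apply: sumr_ge0 => i _; apply: mulr_ge0; first exact: Cv.
have : ~ h b (w (vtx i)) - c < d by move=> lt; apply: H; exists i.
by rewrite e1 => /negP; rewrite -leNgt; lra.
Qed.

(** * Words in the wall reflections and the exchange property *)

Definition word_act (l : seq (option I)) : V -> V :=
  foldr (fun j f => wall_refl j \o f) id l.

Lemma word_act_aw l : affine_weyl D (word_act l).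
Proof.
by elim: l => [|j l IH]; [constructor|apply: aw_comp => //; apply: wall_refl_aw].
Qed.

Lemma word_act_cat l l' v : word_act (l ++ l') v = word_act l (word_act l' v).
Proof. by elim: l => //= j l ->. Qed.

Lemma word_act_revK l : cancel (word_act l) (word_act (rev l)).
Proof.
elim: l => // j l IH v; rewrite rev_cons -cats1 word_act_cat /= wall_reflK.
exact: IH.
Qed.

Lemma dist_refl a k q p : roots D a ->
  ip (refl a k q - p) (refl a k q - p) =
  ip (q - p) (q - p) - ip a a * (h a q - k%:~R) * (k%:~R - h a p).
Proof.
move=> ra; rewrite (_ : refl a k q - p = (q - p) - (h a q - k%:~R) *: a).
  set t := h a q - k%:~R; rewrite (ipBl (q - p)) !(ipBr _ (t *:
    a)) !ipZl !ipZr (ipC (q - p) a).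
  have := ip_h (q - p) ra; rewrite hB => e.
  have -> : ip a (q - p) = (h a q - h a p) * ip a a / 2 by lra.
  by rewrite /t; field.
by rewrite /affine_reflection addrAC.
Qed.

Lemma fin_pos_min (J : finType) (F : J -> R) : (forall j, 0 < F j) ->
  exists2 d, 0 < d & forall j, d <= F j.
Proof.
move=> F_gt0; have pS : 0 < 1 + \sum_j (F j)^-1.
  by apply: ltr_pwDl => //; apply: sumr_ge0 => j _; rewrite invr_ge0 ltW.
exists (1 + \sum_j (F j)^-1)^-1 => [|j]; first by rewrite invr_gt0.
rewrite -[leRHS]invrK lef_pV2 ?posrE ?invr_gt0 // (bigD1 j) //= addrCA lerDl.
by apply: addr_ge0 => //; apply: sumr_ge0 => k _; rewrite invr_ge0 ltW.
Qed.

Definition generic p := forall a (k : int), roots D a -> h a p != k%:~R.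

(** A uniform gap to the hyperplanes that do not contain [q]; the same [d] serves its whole orbit
    under the affine Weyl group. *)
Definition gapped (d : R) q := forall b (k : int), roots D b ->
  h b q != k%:~R -> d <= `|h b q - k%:~R|.

Lemma gappedP p : exists2 d, 0 < d & gapped d p.
Proof.
pose t b : R := h b p - (Num.floor (h b p))%:~R.
pose F b : R := if t b == 0 then 1 else Num.min (t b) (1 - t b).
have t_ge0 b : 0 <= t b by rewrite subr_ge0 floor_le.
have t_lt1 b : t b < 1.
  by rewrite ltrBlDl -[X in _ + X]/(1%:~R) -intrD floorD1_gt.
have [a ra ma] := root_argmax (fun b => - F b).
have F_gt0 b : 0 < F b.
  rewrite /F; case: ifPn => [//|t0].
  rewrite lt_min; apply/andP; split; first by rewrite lt_neqAle eq_sym t0 t_ge0.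
  by have := t_lt1 b; rewrite -subr_gt0.
exists (F a) => // b k rb hk; apply: (@le_trans _ _ (F b)).
  by rewrite -lerN2 ma.
rewrite /F; case: ifPn => [t0|_].
  have e : h b p = (Num.floor (h b p))%:~R by apply/eqP; rewrite -subr_eq0.
  rewrite e eqr_int in hk; rewrite e -intrB -intr_norm -[1]/(1%:~R) ler_int.
  by rewrite -gtz0_ge1 normr_gt0 subr_eq0.
rewrite ge_min; have [le|lt] := leP k%:~R (h b p).
  rewrite ger0_norm ?subr_ge0 //; apply/orP; left; apply: lerB => //.
  by rewrite ler_int floor_ge_int.
rewrite ltr0_norm ?subr_lt0 // opprB; apply/orP; right.
rewrite (_ : 1 - t b = (Num.floor (h b p))%:~R + 1 - h b p); last by rewrite /t; ring.
apply: lerB => //; rewrite -[X in _ + X]/(1%:~R) -intrD ler_int lezD1 -(ltr_int R).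
by apply: le_lt_trans lt; apply: floor_le.
Qed.

Definition barycenter : V := \sum_k (#|{: option I}|%:R^-1) *: vtx k.

Lemma card_option_gt0 : 0 < #|{: option I}|%:R^-1 :> R.
Proof. by rewrite invr_gt0 ltr0n card_option. Qed.

Lemma bary_center j : bary j barycenter = #|{: option I}|%:R^-1.
Proof.
rewrite bary_comb // sumr_const -[LHS]mulr_natl divff //.
by rewrite pnatr_eq0 card_option.
Qed.

Lemma fund_alcove_center : fund_alcove barycenter.
Proof. by move=> j; rewrite bary_center ltW // card_option_gt0. Qed.

Lemma wall_refl_closer (d : R) : 0 < d -> exists2 e, 0 < e & forall j q,
  bary j q < 0 -> d <= `|h (wall_root j) q - (wall_level j)%:~R| ->
  ip (wall_refl j q - barycenter) (wall_refl j q - barycenter) <=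
    ip (q - barycenter) (q - barycenter) - e.
Proof.
move=> d_gt0; pose s := #|{: option I}|%:R^-1 : R.
have s_gt0 : 0 < s := card_option_gt0.
(* Lower bound for the decrease in [dist_refl]: measured by the coroot, [q] is at least [d] away
   from the wall, and the barycenter is [s / |wall_scale j|] away. *)
pose F j := ip (wall_root j) (wall_root j) * (d * (s / `|wall_scale j|)).
have F_gt0 j : 0 < F j.
  rewrite mulr_gt0 ?(root_sq_gt0 (wall_rootP j)) // mulr_gt0 // divr_gt0 //.
  by rewrite normr_gt0 wall_scale_neq0.
have [e e_gt0 he] := fin_pos_min F_gt0; exists e => // j q.
have := bary_center j; rewrite -/s /bary => es neg ge_d.
rewrite dist_refl; last exact: wall_rootP.
rewrite -mulrA lerD2l lerN2; apply: le_trans (he j) _.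
rewrite /F ler_pM2l; last by apply: root_sq_gt0; apply: wall_rootP.
set t := h _ q - _ in neg ge_d *; rewrite -[_ - h _ _]opprB.
have ge0 : 0 <= s / `|wall_scale j| by rewrite divr_ge0 // ltW.
apply: (le_trans (ler_wpM2r ge0 ge_d)); rewrite -es.
set u := h _ barycenter - _; have := wall_scale_neq0 j.
rewrite real_neqr_lt ?num_real // => /orP [c|c].
  have t_gt0 : 0 < t by move: neg; rewrite nmulr_rlt0.
  rewrite (gtr0_norm t_gt0) (ltr0_norm c) le_eqVlt; apply/orP; left; apply/eqP.
  by field; rewrite lt_eqF.
have t_lt0 : t < 0 by move: neg; rewrite pmulr_rlt0.
rewrite (ltr0_norm t_lt0) (gtr0_norm c) le_eqVlt; apply/orP; left; apply/eqP.
by field; rewrite gt_eqF.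
Qed.

Lemma gapped_aw w d q : affine_weyl D w -> gapped d q -> gapped d (w q).
Proof.
move=> aw gq b k rb hk; have [b' [k' [rb' e1 _]]] := aw_pull aw rb.
have e : h b (w q) - k%:~R = h b' q - (k - k')%:~R by rewrite e1 intrB; ring.
rewrite e; apply: gq => //; rewrite -subr_eq0 -e subr_eq0 //.
Qed.

(* Folding towards the barycenter decreases the distance by a fixed amount. *)
Lemma fund_alcove_word p : exists l, fund_alcove (word_act l p).
Proof.
have [d d_gt0 gap] := gappedP p; have [e e_gt0 closer] := wall_refl_closer d_gt0.
pose dist q := ip (q - barycenter) (q - barycenter).
suff key N : forall q, gapped d q -> dist q < N%:R * e ->
  exists l, fund_alcove (word_act l q).
  apply: (key (Num.trunc (dist p / e)).+1) => //.
  by rewrite -ltr_pdivrMr //; apply: truncnS_gt.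
elim: N => [|N IH] q gq; first by rewrite mul0r ltNge ip_ge0.
move=> lt; case: (pselect (fund_alcove q)) => [Cq|nCq]; first by exists [::].
have [j jneg] : exists j, bary j q < 0.
  apply: contrapT => H; apply: nCq => j; rewrite leNgt; apply/negP => neg.
  by apply: H; exists j.
have [||l Cl] := IH (wall_refl j q).
- exact: gapped_aw (wall_refl_aw j) gq.
- have ge_d : d <= `|h (wall_root j) q - (wall_level j)%:~R|.
    apply: gq; first exact: wall_rootP.
    by apply: contraTneq jneg => e0; rewrite /bary e0 subrr mulr0 ltxx.
  apply: le_lt_trans (closer j q jneg ge_d) _.
  by move: lt; rewrite -natr1 mulrDl mul1r /dist; lra.
by exists (l ++ [:: j]); rewrite word_act_cat.
Qed.

(** The walk along [l] starts above the hyperplane and ends at a vertex strictly below it, so some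
    letter crosses it. There [panel_refl] identifies the reflection with this letter, which is
    deleted. *)
Lemma exchange u a k l i : affine_weyl D u -> roots D a ->
  (forall j, k%:~R <= h a (u (vtx j))) ->
  h a (u (word_act l (vtx i))) < k%:~R ->
  exists2 l', size l = (size l').+1 &
    forall v, refl a k (u (word_act l v)) = u (word_act l' v).
Proof.
move=> au ra; elim: l u au => [|j l IH] u au ge_k lt_k.
  by move: lt_k => /=; rewrite ltNge ge_k.
have auj := aw_comp au (wall_refl_aw j).
have [k' hk'] := strip auj ra.
have [le|lt] := leP k k'.
  have [j'|//|l' sl e] := IH _ auj.
    have /andP [ge _] := hk' _ (fund_alcove_vtx j').
    by apply: le_trans ge; rewrite ler_int.
  by exists (j :: l') => //=; rewrite sl.
(* The present alcove is above the hyperplane and the next one below, so their common panel lies in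
   it. *)
have uk m : m != j -> h a (u (vtx m)) = k%:~R.
  move=> mj; apply/eqP; rewrite eq_le ge_k andbT.
  have /andP [_] := hk' _ (fund_alcove_vtx m).
  rewrite /= wall_refl_vtx // => le; apply: (le_trans le).
  by rewrite -[1]/(1%:~R) -intrD ler_int lezD1.
exists l => // v /=.
by rewrite (panel_refl au ra uk) wall_reflK.
Qed.

Lemma barycenter_strip b : roots D b -> pos b -> 0 < h b barycenter < 1.
Proof.
move=> rb pb; have s_gt0 := card_option_gt0.
have hi i : 0 < h (alpha i) barycenter.
  by have := bary_center (Some i); rewrite baryS => e;
    rewrite -(pmulr_rgt0 _ (theta_gt0 i)) e.
have [i hbi] := root_omega_neq0 rb.
apply/andP; split.
  rewrite h_omega (bigD1 i) //=; apply: ltr_pwDl.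
    by rewrite mulr_gt0 // lt_neqAle eq_sym hbi pb.
  by apply: sumr_ge0 => j _; rewrite mulr_ge0 // ltW.
have := bary_center None; rewrite baryN => e.
have : h theta barycenter < 1 by rewrite -subr_gt0 e.
apply: le_lt_trans; rewrite h_omega (h_omega theta); apply: ler_sum => j _.
by apply: ler_wpM2r; [apply: ltW|apply: theta_max].
Qed.

Lemma generic_barycenter : generic barycenter.
Proof.
move=> b k rb; have key c l : roots D c -> pos c -> h c barycenter != l%:~R.
  move=> rc pc; have := barycenter_strip rc pc; apply: contraTneq => ->.
  by rewrite ltr0z -[1]/(1%:~R) ltr_int; lia.
case: (root_pos_neg rb) => [|/(key _ (- k) (rootN rb))]; first exact: key.
by rewrite hN_root // intrN eqr_opp.
Qed.

Lemma generic_aw w p : affine_weyl D w -> generic p -> generic (w p).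
Proof.
move=> aw gp b k rb; have [b' [k' [rb' e1 _]]] := aw_pull aw rb.
by rewrite e1 eq_sym -subr_eq -intrB eq_sym; apply: gp.
Qed.

Lemma refl_opp a k : roots D a -> refl (- a) (- k) = refl a k.
Proof.
move=> ra; apply: (level_refl_eq (m := -1)) => // [|v]; first exact: rootN.
by rewrite hN_root // intrN; ring.
Qed.

(** The reflected alcove lies across the hyperplane, so a word leading to it makes a crossing;
    [exchange] writes the reflection times this word as a word again. *)
Lemma refl_word a k : roots D a -> exists l, refl a k = word_act l.
Proof.
move=> ra.
wlog ge_k : a k ra / forall v, fund_alcove v -> k%:~R <= h a v.
  move=> H; have [k' hk'] := strip (affine_weyl_id D) ra.
  have [le|lt] := leP k k'.
    by apply: H => // v /hk' /andP [ge _]; apply: le_trans ge; rewrite ler_int.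
  rewrite -refl_opp //; apply: H; first exact: rootN.
  move=> v /hk' /andP [_ le]; rewrite hN_root // intrN lerN2.
  by apply: (le_trans le); rewrite -[1]/(1%:~R) -intrD ler_int lezD1.
have ak := sref_aw k ra.
have [l Cl] := fund_alcove_word (refl a k barycenter).
have [|i lt_k] := @strip_lt (word_act (rev l)) a k%:~R 0 _ (word_act_aw _) ra Cl.
  rewrite word_act_revK h_refl_self // subr_lt0.
  have := ge_k _ fund_alcove_center; rewrite le_eqVlt eq_sym (negPf
    (generic_barycenter _ ra)) /=.
  by lra.
rewrite subr_lt0 in lt_k.
have [|l' _ e] := exchange (u := id) (l := rev l) (k := k) (affine_weyl_id D) ra _ lt_k.
  by move=> j; apply: ge_k; apply: fund_alcove_vtx.
exists (l' ++ l); apply/funext => v.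
by rewrite word_act_cat -e word_act_revK.
Qed.

Lemma aw_word w : affine_weyl D w -> exists l, w = word_act l.
Proof.
elim=> [|a k u ra _ [l ->]]; first by exists [::].
have [l' ->] := refl_word k ra; exists (l' ++ l); apply/funext => v.
by rewrite word_act_cat.
Qed.

(** For generic [p] this describes the closed alcove containing [p]; the upper bounds come from the
    conditions at [- a]. *)
Definition same_side p v :=
  forall a (k : int), roots D a -> k%:~R < h a p -> k%:~R <= h a v.

Lemma same_side_fund p v : generic p -> fund_alcove p ->
  (same_side p v <-> fund_alcove v).
Proof.
move=> gp Cp; split=> [ss j|Cv a k ra lt].
  have lt0 i : 0 < h (alpha i) p.
    rewrite lt_neqAle eq_sym -[0]/(0%:~R) gp /=; last exact: alpha_root.
    by have := Cp (Some i); rewrite baryS pmulr_rge0.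
  case: j => [i|]; first by rewrite baryS pmulr_rge0 // (ss _ 0 (alpha_root i)).
  have := ss (- theta) (-1) (rootN theta_root); rewrite !hN_root // intrN.
  rewrite baryN subr_ge0 ltrN2 lerN2; apply.
  by rewrite lt_neqAle gp //= -subr_ge0 -baryN; apply: Cp.
have [k' hk'] := strip (affine_weyl_id D) ra.
have /andP [_ le] := hk' _ Cp; have /andP [ge _] := hk' _ Cv.
apply: le_trans ge; rewrite ler_int -ltzD1 -(ltr_int R) intrD.
exact: lt_le_trans lt le.
Qed.

Lemma same_side_aw w p v : affine_weyl D w -> same_side p v -> same_side (w p) (w v).
Proof.
move=> aw ss a k ra; have [a' [k' [ra' e1 _]]] := aw_pull aw ra.
by rewrite !e1 -lterBDr -intrB -lerBlDr -intrB; apply: ss.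
Qed.

Lemma same_side_alcove p : generic p -> exists2 w, affine_weyl D w &
  forall v, same_side p v <-> (w @` fund_alcove) v.
Proof.
move=> gp; have [l Cl] := fund_alcove_word p; exists (word_act (rev l)).
  exact: word_act_aw.
have gl := generic_aw (word_act_aw l) gp => v; split.
  move/(same_side_aw (word_act_aw l))/(same_side_fund _ gl Cl) => Cv.
  by exists (word_act l v) => //; rewrite word_act_revK.
case=> u Cu <-; rewrite -(word_act_revK l p).
by apply: same_side_aw; [apply: word_act_aw|apply/same_side_fund].
Qed.

Lemma coroot_continuous a : continuous (h a : V -> R).
Proof.
have -> : (h a : V -> R) = fun v => \sum_i v 0 i * h a (delta_mx 0 i).
  apply/funext => v; rewrite {1}(row_sum_delta v) h_sum.
  by apply: eq_bigr => i _; rewrite hZ.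
apply: continuous_big => [|i _ v]; first exact: add_continuous.
have c1 : (fun x : V => x 0 i) x @[x --> v] --> v 0 i := @coord_continuous R 1 n 0 i v.
exact: (cvgM c1 (cvg_cst _)).
Qed.

Lemma level_continuous a (c : R) : continuous (fun v : V => h a v - c).
Proof.
move=> v; have c1 : h a x @[x --> v] --> h a v := @coroot_continuous a v.
exact: (cvgB c1 (cvg_cst _)).
Qed.

Lemma level_affine a (c : R) u v t :
  h a (u + t *: (v - u)) - c = h a u - c + t * (h a v - c - (h a u - c)).
Proof. by rewrite hD hZ hB; ring. Qed.

Lemma closure_alcove p : generic p ->
  closure (connected_component
    [set v | forall a k, roots D a -> ~ hyperplane D a k v] p) =
  [set v | same_side p v].
Proof.
move=> gp.
pose L := [set f | exists a (k : int), roots D a /\ f = fun v : V => h a v - k%:~R].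
have -> : [set v | forall a k, roots D a -> ~ hyperplane D a k v] =
  arrangement_complement L.
  apply/seteqP; split => v Hv.
    by move=> _ [a [k [ra ->]]] /eqP; rewrite subr_eq0 => /eqP; apply: Hv.
  by move=> a k ra e; apply: (Hv (fun v => h a v - k%:~R));
    [exists a, k|rewrite e subrr].
rewrite closure_component.
- apply/seteqP; split => v.
    move=> ge0 a k ra lt.
    have /= := ge0 _ (ex_intro _ a (ex_intro _ k (conj ra erefl))).
    by rewrite pmulr_rge0 ?subr_gt0 // subr_ge0.
  move=> ss _ [a [k [ra ->]]]; have := gp a k ra.
  rewrite real_neqr_lt ?num_real // => /orP [lt|lt]; last first.
    by apply: mulr_ge0; rewrite subr_ge0; [apply: ltW|apply: ss].
  apply: mulr_le0; rewrite subr_le0; first exact: ltW.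
  by have := ss (- a) (- k) (rootN ra); rewrite !hN_root // intrN ltrN2 lerN2; apply.
- by move=> _ [a [k [ra ->]]]; apply: level_continuous.
- by move=> _ [a [k [ra ->]]] u v t; apply: level_affine.
- by move=> _ [a [k [ra ->]]] /eqP; rewrite subr_eq0; apply/negP; apply: gp.
Qed.

Lemma alcoveP c : alcove D c <->
  exists2 w, affine_weyl D w & c = w @` fund_alcove.
Proof.
split=> [[p Up ->]|[w aw ->]].
  have gp : generic p by move=> a k ra; apply/eqP; apply: Up.
  have [w aw ww] := same_side_alcove gp; exists w => //.
  by rewrite closure_alcove //; apply/seteqP; split => v /ww.
have gp := generic_aw aw generic_barycenter.
exists (w barycenter); first by move=> a k ra; apply/eqP; apply: gp.
rewrite closure_alcove //; apply/seteqP; split => v.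
  case=> u Cu <-; apply: same_side_aw => //.
  by apply/same_side_fund => //; [apply: generic_barycenter|apply: fund_alcove_center].
have [w' [aw' c1 c2]] := aw_inv aw.
move=> /(same_side_aw aw'); rewrite c1 => /(same_side_fund _ generic_barycenter
  fund_alcove_center) Cv.
by exists (w' v).
Qed.

(** * The Coxeter complex *)

Local Notation K := (coxeter_complex D).

Lemma bary_inj u v : (forall j, bary j u = bary j v) -> u = v.
Proof.
move=> e; rewrite (coweight_sum u) (coweight_sum v); apply: eq_bigr => i _.
congr (_ *: _); apply: (mulfI (lt0r_neq0 (theta_gt0 i))).
by rewrite -!baryS.
Qed.

Lemma vtx_inj : injective vtx.
Proof.
move=> j k e; have := bary_vtx j j; rewrite e bary_vtx eqxx => /eqP.
by rewrite pnatr_eq1 eqb1 => /eqP.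
Qed.

Lemma bary_vtxE v j : (forall i, i != j -> bary i v = 0) -> v = vtx j.
Proof.
move=> e; apply: bary_inj => i; rewrite bary_vtx.
have [->|ij] := eqVneq i j; last by rewrite e.
by have := bary_sum v; rewrite (bigD1 j) //= big1 ?addr0.
Qed.

(** The level function has constant sign on the alcove by [strip], and its value 0 at [v] is a
    weighted mean of its values at the vertices; so it is 0 wherever the weight is not. *)
Lemma supporting_level b (k : int) v : roots D b -> fund_alcove v ->
  h b v = k%:~R -> forall i, bary i v != 0 -> h b (vtx i) = k%:~R.
Proof.
move=> rb Cv hv i bi; have [k' hk'] := strip (affine_weyl_id D) rb.
have e0 : \sum_j bary j v * (h b (vtx j) - k%:~R) = 0 by rewrite -h_bary hv subrr.
have [le|lt] := leP k k'.
  have ge0 j : 0 <= bary j v * (h b (vtx j) - k%:~R).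
    apply: mulr_ge0; first exact: Cv.
    rewrite subr_ge0; have /andP [ge _] := hk' _ (fund_alcove_vtx j).
    by apply: le_trans ge; rewrite ler_int.
  move/eqP: e0; rewrite psumr_eq0 // => /allP /(_ i (mem_index_enum i)) /=.
  by rewrite mulf_eq0 (negPf bi) subr_eq0 => /eqP.
have ge0 j : 0 <= bary j v * (k%:~R - h b (vtx j)).
  apply: mulr_ge0; first exact: Cv.
  rewrite subr_ge0; have /andP [_ le] := hk' _ (fund_alcove_vtx j).
  by apply: (le_trans le); rewrite -[1]/(1%:~R) -intrD ler_int lezD1.
have e1 : \sum_j bary j v * (k%:~R - h b (vtx j)) == 0.
  rewrite -oppr_eq0 -sumrN -[X in _ == X]e0; apply/eqP.
  by apply: eq_bigr => j _; ring.
move: e1; rewrite psumr_eq0 // => /allP /(_ i (mem_index_enum i)) /=.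
by rewrite mulf_eq0 (negPf bi) subr_eq0 => /eqP.
Qed.

Lemma vertex_fund v : fund_alcove v -> vertex D v -> exists j, v = vtx j.
Proof.
move=> Cv vv.
have [j bj] : exists j, bary j v != 0.
  apply: contrapT => H; have := bary_sum v; rewrite big1 => [/eqP|j _].
    by rewrite eq_sym oner_eq0.
  by apply/eqP/negP => /negP bj; apply: H; exists j.
exists j; apply: bary_vtxE => i ij; apply/eqP/negP => /negP bi.
(* With two nonzero barycentric coordinates, [v] could be moved along an edge without leaving any
   hyperplane through it. *)
have : v + (vtx j - vtx i) = v.
  apply: vv => a k ra hv; rewrite /hyperplane /= hD hB.
  by rewrite !(supporting_level ra Cv hv) // subrr addr0.
rewrite -[RHS]addr0 => /addrI /eqP; rewrite subr_eq0 => /eqP /vtx_inj e.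
by rewrite e eqxx in ij.
Qed.

Lemma vertex_vtx j : vertex D (vtx j).
Proof.
move=> v Hv; apply: bary_vtxE => i ij.
have : hyperplane D (wall_root i) (wall_level i) v.
  apply: Hv; first exact: wall_rootP.
  have := bary_vtx i j; rewrite (negPf ij) => /eqP;
    rewrite mulf_eq0 (negPf (wall_scale_neq0 i)).
  by rewrite subr_eq0 => /eqP.
by rewrite /bary => ->; rewrite subrr mulr0.
Qed.

Lemma vertex_aw w v : affine_weyl D w -> vertex D v -> vertex D (w v).
Proof.
move=> aw vv u Hu; have [w' [aw' c1 c2]] := aw_inv aw.
rewrite -(c2 u); congr w; apply: vv => a k ra hv.
have [a' [k' [ra' e1 _]]] := aw_pull aw' ra.
have : hyperplane D a' (k - k') u.
  by apply: Hu => //; have := e1 (w v); rewrite c1 hv /hyperplane /= intrB => ->;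
    rewrite addrK.
by rewrite /hyperplane /= e1 intrB => ->; rewrite subrK.
Qed.

Definition cham (w : V -> V) : set V := [set w (vtx j) | j in setT].
Definition panel (w : V -> V) j : set V := [set w (vtx i) | i in [set i | i != j]].

Lemma aw_inj w : affine_weyl D w -> injective w.
Proof. by move=> /aw_inv [w' [_ c1 _]]; apply: can_inj c1. Qed.

Lemma alcove_vertices w : affine_weyl D w ->
  [set x | (w @` fund_alcove) x /\ vertex D x] = cham w.
Proof.
move=> aw; apply/seteqP; split => [x [[u Cu <-] vx]|_ [j _ <-]]; last first.
  by split; [exists (vtx j) => //; apply: fund_alcove_vtx|apply: vertex_aw => //;
    apply: vertex_vtx].
have [w' [aw' c1 _]] := aw_inv aw.
have [|j ->] := vertex_fund Cu; last by exists j.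
by rewrite -(c1 u); apply: vertex_aw.
Qed.

Lemma complexP s : K s <-> s !=set0 /\ exists2 w, affine_weyl D w & s `<=` cham w.
Proof.
split=> [[s0 [c /alcoveP [w aw ->]]]|[s0 [w aw]]];
  first rewrite alcove_vertices // => sw.
  by split=> //; exists w.
rewrite -alcove_vertices // => sw; split=> //; exists (w @` fund_alcove) => //.
by apply/alcoveP; exists w.
Qed.

Lemma complex_cham w : affine_weyl D w -> K (cham w).
Proof. by move=> aw; apply/complexP; split; [exists (w (vtx None));
  exists None|exists w]. Qed.

Lemma cham_sub w w' : affine_weyl D w -> affine_weyl D w' ->
  cham w `<=` cham w' -> cham w = cham w'.
Proof.
move=> aw aw' sub; apply/seteqP; split => //.
have g j : exists k, w (vtx j) = w' (vtx k).
  by have [|k _ <-] := sub (w (vtx j)); [exists j|exists k].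
pose f j := projT1 (cid (g j)).
have fE j : w (vtx j) = w' (vtx (f j)) by rewrite /f; case: cid.
have f_inj : injective f.
  move=> j k e; apply: vtx_inj; apply: (aw_inj aw).
  by rewrite !fE e.
move=> _ [k _ <-]; exists (invF f_inj k) => //.
by rewrite fE f_invF.
Qed.

Lemma chamberP c : chamber K c <-> exists2 w, affine_weyl D w & c = cham w.
Proof.
split=> [[/complexP [c0 [w aw cw]] cmax]|[w aw ->]].
  by exists w => //; rewrite (cmax (cham w)) //; apply: complex_cham.
split; first exact: complex_cham.
move=> s /complexP [s0 [w' aw' sw']] ws.
have e : cham w = cham w' by apply: cham_sub => //; apply: subset_trans sw'.
by apply/seteqP; split => //; rewrite e.
Qed.

Lemma panelE w j : affine_weyl D w -> cham w `\ w (vtx j) = panel w j.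
Proof.
move=> aw; apply/seteqP; split => [x [[i _ <-] ne]|_ [i ij <-]].
  by exists i => //=; apply/eqP => ij; apply: ne; rewrite ij.
by split; [exists i|move=> /(aw_inj aw) /vtx_inj /eqP; rewrite (negPf ij)].
Qed.

Lemma index_inhabited : exists i : I, True.
Proof. by have [i _] := root_omega_neq0 theta_root; exists i. Qed.

Lemma panel_neq0 w j : panel w j !=set0.
Proof.
have [i0 _] := index_inhabited.
case: j => [i|]; first by exists (w (vtx None)); exists None.
by exists (w (vtx (Some i0))); exists (Some i0).
Qed.

Lemma panel_face w j : affine_weyl D w -> codim1_face K (panel w j) (cham w).
Proof.
move=> aw; split; last by exists (w (vtx j)); [exists j|rewrite panelE].
apply/complexP; split; first exact: panel_neq0.
by exists w => // _ [i _ <-]; exists i.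
Qed.

Lemma faceP w p : affine_weyl D w -> codim1_face K p (cham w) ->
  exists j, p = panel w j.
Proof. by move=> aw [_ [_ [j _ <-] ->]]; exists j; rewrite panelE. Qed.

Lemma panel_wall_refl w j : panel (w \o wall_refl j) j = panel w j.
Proof. by apply: eq_imagel => i /= ij; rewrite wall_refl_vtx. Qed.

Lemma panel_level w j : affine_weyl D w -> exists b (k : int),
  roots D b /\ forall v, bary j v = wall_scale j * (h b (w v) - k%:~R).
Proof.
move=> aw; have [w' [aw' c1 _]] := aw_inv aw.
have [b [k [rb e _]]] := aw_pull aw' (wall_rootP j).
exists b, (wall_level j - k); split => // v.
by rewrite /bary -{1}(c1 v) e intrB; congr (_ * _); ring.
Qed.

Lemma cham_same_side w w' : affine_weyl D w -> affine_weyl D w' ->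
  same_side (w barycenter) (w' barycenter) -> cham w = cham w'.
Proof.
move=> aw aw' ss; have [u [au c1 c2]] := aw_inv aw.
have gb := generic_barycenter; have Cb := fund_alcove_center.
have Cq : fund_alcove (u (w' barycenter)).
  by apply/(same_side_fund _ gb Cb); rewrite -[X in same_side X _]c1;
    apply: same_side_aw.
have auw := aw_comp au aw'.
have gq : generic (u (w' barycenter)) := generic_aw auw gb.
have CE v : fund_alcove v <-> exists2 x, fund_alcove x & v = u (w' x).
  have [y [ay d1 d2]] := aw_inv auw.
  split=> [/(same_side_fund _ gq Cq) ssq|[x Cx ->]].
    exists (y v); last by have := d2 v.
    by apply/(same_side_fund _ gb Cb); rewrite -[X in same_side X _]d1;
      apply: same_side_aw.
  apply/(same_side_fund _ gq Cq); apply: (same_side_aw auw).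
  exact/(same_side_fund _ gb Cb).
rewrite -alcove_vertices // -alcove_vertices //;
  congr (fun A => [set x | A x /\ vertex D x]).
apply/seteqP; split => _ [x Cx <-].
  by have [z Cz e] := (CE x).1 Cx; exists z => //; rewrite e c2.
by exists (u (w' x)); [apply/CE; exists x|rewrite c2].
Qed.

Lemma refl_eq_level a k b l : roots D a -> roots D b -> refl a k = refl b l ->
  exists c, forall v, h a v - k%:~R = c * (h b v - l%:~R).
Proof.
move=> ra rb e; exists (ip b a / ip a a) => v.
have := congr1 (fun f => ip (v - f v) a) e.
rewrite /affine_reflection !subKr !ipZl => e'.
by apply: (mulIf (lt0r_neq0 (root_sq_gt0 ra))); rewrite e'; field;
  rewrite gt_eqF // root_sq_gt0.
Qed.

(** Each side of the wall of the panel has only one alcove at this panel: any other hyperplane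
    misses a vertex of the panel, and this vertex decides the side for both alcoves. *)
Lemma thin w w' j j' : affine_weyl D w -> affine_weyl D w' ->
  panel w j = panel w' j' -> cham w' = cham w \/ cham w' = cham (w \o wall_refl j).
Proof.
move=> aw aw' pE.
have [b [k [rb hb]]] := panel_level j aw.
(* The sign of [s], which will be [wall_scale j] or its negative, selects the side; [x] will be [w]
   or its mirror image. *)
have key x s : affine_weyl D x -> panel x j = panel w j ->
    0 < s * (h b (x barycenter) - k%:~R) ->
    (forall v, refl b k (x v) = x (wall_refl j v)) ->
    0 < s * (h b (w' barycenter) - k%:~R) -> cham x = cham w'.
  move=> ax pxE gt_x rx gt_w'; apply: cham_same_side => // a l ra lt.
  have [ka hka] := strip ax ra; have [ka' hka'] := strip aw' ra.
  have /andP [_ le] := hka _ fund_alcove_center;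
    have /andP [ge' _] := hka' _ fund_alcove_center.
  have le_ka : (l <= ka)%R by rewrite -ltzD1 -(ltr_int R) intrD; apply: lt_le_trans le.
  case: (pselect (forall i, i != j -> h a (x (vtx i)) = l%:~R)) => [onH|].
    have rE : refl a l = refl b k.
      have [y [_ _ c2]] := aw_inv ax; apply/funext => v.
      by rewrite -(c2 v) rx (panel_refl ax ra onH).
    have [c ec] := refl_eq_level ra rb rE.
    rewrite -subr_ge0 ec; rewrite -subr_gt0 ec in lt.
    move: lt gt_x gt_w'; move: (h b (x _) - _) (h b (w' _) - _) => p q lt sp sq.
    rewrite -(pmulr_lge0 _ (exprn_gt0 2 sp)).
    have -> : c * q * (s * p) ^+ 2 = (c * p) * (s * p) * (s * q) by ring.
    by apply: ltW; apply: mulr_gt0 => //; apply: mulr_gt0.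
  move=> nonH; have [i [ij hi]] : exists i, i != j /\ h a (x (vtx i)) != l%:~R.
    apply: contrapT => H; apply: nonH => i ij; apply/eqP/negP => /negP hi.
    by apply: H; exists i.
  have /andP [ge _] := hka _ (fund_alcove_vtx i).
  have lt_i : l%:~R < h a (x (vtx i)).
    rewrite lt_neqAle eq_sym hi /=; apply: le_trans ge; by rewrite ler_int.
  have [i' _ e] : panel w' j' (x (vtx i)) by rewrite -pE -pxE; exists i.
  have /andP [_] := hka' _ (fund_alcove_vtx i'); rewrite e => le'.
  apply: le_trans ge'; rewrite ler_int -ltzD1 -(ltr_int R) intrD.
  exact: lt_le_trans lt_i le'.
have refl_w v : refl b k (w v) = w (wall_refl j v).
  apply: panel_refl => // i ij; have := hb (vtx i).
  rewrite bary_vtx eq_sym (negPf ij) => /esym/eqP.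
  by rewrite mulf_eq0 (negPf (wall_scale_neq0 j)) subr_eq0 => /eqP.
have gt_w : 0 < wall_scale j * (h b (w barycenter) - k%:~R).
  by rewrite -hb bary_center card_option_gt0.
have n0 : wall_scale j * (h b (w' barycenter) - k%:~R) != 0.
  by rewrite mulf_neq0 ?wall_scale_neq0 // subr_eq0;
    apply: generic_aw generic_barycenter _ _ rb.
have [gt0|lt0] := ltP 0 (wall_scale j * (h b (w' barycenter) - k%:~R)).
  by left; apply/esym; apply: (key w (wall_scale j)).
right; apply/esym; apply: (key _ (- wall_scale j)).
- exact: aw_comp aw (wall_refl_aw j).
- exact: panel_wall_refl.
- by rewrite /= -refl_w h_refl_self // (_ : _ * _ = wall_scale j * (h b (w
  barycenter) - k%:~R)) //; ring.
- by move=> v /=; rewrite refl_w.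
- by rewrite mulNr oppr_gt0 lt_neqAle n0.
Qed.

Lemma stepP w p c : affine_weyl D w -> codim1_face K p (cham w) ->
  codim1_face K p c -> chamber K c ->
  exists2 j, p = panel w j & c = cham w \/ c = cham (w \o wall_refl j).
Proof.
move=> aw pw pc /chamberP [w' aw' cE]; rewrite cE in pc *.
have [j pj] := faceP aw pw; have [j' pj'] := faceP aw' pc.
by exists j => //; apply: (@thin w w' j j'); rewrite // -pj -pj'.
Qed.

(** * Weyl chambers and galleries *)

Definition translation_aw t := affine_weyl D (fun v => v + t).

Lemma translation_root b (k : int) : roots D b -> translation_aw (k%:~R *: b).
Proof.
move=> rb; have := aw_comp (sref_aw k rb) (sref_aw 0 rb); congr affine_weyl.
apply/funext => v /=; rewrite [LHS]reflE; congr (_ + _); exact: srefK.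
Qed.

Lemma translationD t u : translation_aw t -> translation_aw u -> translation_aw (t + u).
Proof.
by move=> at_ au; have := aw_comp au at_; congr affine_weyl; apply/funext => v /=;
  rewrite addrA.
Qed.

(** Take the vector with simple coroot values [M - B i] and round its coordinates over the simple
    roots down to integers; this changes the value of [h (alpha i)] by at most [B i]. *)
Lemma deep_translation (M : R) : exists2 t, translation_aw t
  & forall i, h (alpha i) t <= M.
Proof.
pose B i := \sum_j `|h (alpha i) (alpha j)|.
pose v := \sum_i (M - B i) *: omega i.
have hv i : h (alpha i) v = M - B i.
  rewrite h_sum (bigD1 i) //= big1 => [|j ji]; rewrite hZ homega ?eqxx ?mulr1 ?addr0 //.
  by rewrite (negPf ji) mulr0.
exists (\sum_j (Num.floor (coef v j))%:~R *: alpha j).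
  apply: (big_ind translation_aw) => [||j _]; last by apply: translation_root;
    apply: alpha_root.
    by have := affine_weyl_id D; congr affine_weyl; apply/funext => u; rewrite addr0.
  exact: translationD.
move=> i; rewrite (_ : M = h (alpha i) v + B i); last by rewrite hv subrK.
rewrite h_sum {2}(coefE v) h_sum -big_split /=; apply: ler_sum => j _.
rewrite !hZ; set c := coef v j; set x := h _ _.
have : c - 1 < (Num.floor c)%:~R by rewrite ltrBlDr -[X in _ + X]/(1%:~R) -intrD
  floorD1_gt.
have := floor_le c; move: (_%:~R) => f le gt.
have := ler_norm x; have := ler_norm (- x); rewrite normrN => n1 n2.
have : (c - f) * (- x) <= `|x|; last by nra.
apply: le_trans (_ : (c - f) * `|x| <= _); first by apply: ler_wpM2l => //; lra.
by rewrite -[leRHS]mul1r; apply: ler_wpM2r => //; lra.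
Qed.

Lemma opposite_chamberE v :
  opposite_chamber D alpha v <-> forall i, h (alpha i) v <= 0.
Proof.
split=> [[u Cu <-] i|H]; first by rewrite hN oppr_le0; apply: Cu.
by exists (- v); rewrite ?opprK // => i; rewrite hN oppr_ge0.
Qed.

Lemma weyl_chamber_translate t : translation_aw t ->
  weyl_chamber D [set v | opposite_chamber D alpha (v - t)].
Proof.
(* Minus the sum of the fundamental coweights is interior to the opposite chamber, as every positive
   coroot is negative there. *)
move=> at_; exists (fun v => v + t), (- \sum_i omega i).
pose L := [set f | exists2 a, roots D a & f = (h a : V -> R)].
have UE : [set v | forall a, roots D a -> ~ hyperplane D a 0 v] =
  arrangement_complement L.
  apply/seteqP; split => v Hv; first by move=> _ [a ra ->] /= e; apply: (Hv a ra).
  by move=> a ra e; apply: (Hv (h a)); [exists a|].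
have hp a : h a (- \sum_i omega i) = - \sum_i h a (omega i) by rewrite hN h_sum.
have neg a : roots D a -> pos a -> h a (- \sum_i omega i) < 0.
  move=> ra pa; rewrite hp oppr_lt0; have [i hi] := root_omega_neq0 ra.
  rewrite (bigD1 i) //=; apply: ltr_pwDl; last by apply: sumr_ge0 => j _; apply: pa.
  by rewrite lt_neqAle eq_sym hi pa.
have Up : arrangement_complement L (- \sum_i omega i).
  move=> _ [a ra ->]; apply/eqP; case: (root_pos_neg ra) =>
    [/(neg _ ra)|/(neg _ (rootN ra))].
    by move/lt_eqF ->.
  by rewrite hN_root // oppr_lt0 => /gt_eqF ->.
split => //; first by rewrite UE.
rewrite UE closure_component //; last 2 first.
- by move=> _ [a ra ->]; apply: coroot_continuous.
- by move=> _ [a ra ->] u v s; rewrite hD hZ hB.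
apply/seteqP; split => [v /opposite_chamberE ov|_ [u Cu <-]].
  exists (v - t); last by rewrite subrK.
  move=> _ [a ra ->]; have key c : roots D c -> pos c ->
      0 <= h c (- \sum_i omega i) * h c (v - t).
    move=> rc pc; apply: mulr_le0; first exact: ltW (neg c rc pc).
    rewrite h_omega; apply: sumr_le0 => i _.
    by apply: mulr_ge0_le0 => //; apply: pc.
  case: (root_pos_neg ra) => [/(key _ ra)//|/(key _ (rootN ra))].
  by rewrite !hN_root // mulrNN.
apply/opposite_chamberE => i; rewrite addrK.
have := Cu _ (ex_intro2 _ _ _ (alpha_root i) erefl).
rewrite nmulr_rge0 //; apply: neg; first exact: alpha_root.
by move=> j; rewrite homega.
Qed.

(* Only the implication to [positive_fold] is needed: that targets lie in the
   hull holds for galleries with arbitrary folds. *)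
Definition posfold w j := exists b (k : int), [/\ roots D b, pos b,
  forall i, i != j -> h b (w (vtx i)) = k%:~R & k%:~R <= h b (w (vtx j))].

(** As [b] is positive, translating the opposite chamber by a large negative multiple of [b] brings
    it below the hyperplane, while the alcove is above. *)
Lemma posfold_positive w j : posfold w j ->
  positive_fold D alpha (panel w j) (cham w).
Proof.
case=> b [k [rb pb pk ge_k]]; exists b, k; split => //.
  by move=> _ [i ij <-]; apply: pk.
(* On the translated chamber the coroot of [b] is at most [-2 |k|], hence at most [k]. *)
pose N : int := `|k|%Z.
pose t := (- N)%:~R *: b.
have at_ : translation_aw t by apply: translation_root.
exists [set v | opposite_chamber D alpha (v - t)]; split.
- exact: weyl_chamber_translate.
(* [M] is at most 0 and at most each [h (alpha i) t], so the deep translate lies in both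
   chambers. *)
- pose M := - \sum_i `|h (alpha i) t|.
  have [u au hu] := deep_translation M.
  have leM i : M <= - `|h (alpha i) t|.
    rewrite lerN2 (bigD1 i) //= lerDl; apply: sumr_ge0 => j' _; exact: normr_ge0.
  exists [set v | opposite_chamber D alpha (v - u)];
    first exact: weyl_chamber_translate.
  move=> v /opposite_chamberE ov; split; apply/opposite_chamberE => i.
    have := ov i; rewrite hB subr_le0 => /le_trans; apply.
    by apply: (le_trans (hu i)); apply: (le_trans (leM i)); rewrite oppr_le0.
  have := ov i; rewrite !hB !subr_le0 => /le_trans; apply.
  apply: (le_trans (hu i)); apply: (le_trans (leM i)).
  by rewrite lerNl; have := ler_norm (- h (alpha i) t); rewrite normrN.
- right; split.
    move=> v /opposite_chamberE ov; rewrite /half_below /=.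
    have : h b (v - t) <= 0.
      rewrite h_omega; apply: sumr_le0 => i _; apply: mulr_ge0_le0 => //; exact: pb.
    rewrite hB /t hZ coroot_diag // subr_le0 => /le_trans; apply.
    rewrite -[2]/(2%:~R) -intrM ler_int /N; lia.
  move=> _ [i _ <-]; rewrite /half_above /=.
  by have [->|ij] := eqVneq i j; last rewrite pk.
Qed.

(* [reach P w l i y]: a gallery of type [l] that starts at the alcove of [w] ends
   at the vertex [y] of type [i]; at each letter it crosses the wall, or folds at
   it if [P] allows this. *)
Fixpoint reach (P : (V -> V) -> option I -> Prop) w l i y : Prop :=
  if l is j :: l' then reach P (w \o wall_refl j) l' i y \/ (P w j /\ reach P w l' i y)
  else y = w (vtx i).

(** * Vertex types, and galleries as words *)

Section Types.
Variables (J : Type) (ty : V -> J).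
Hypothesis hty : type_function K ty.

Lemma ty_cham w j k : affine_weyl D w -> ty (w (vtx j)) = ty (w (vtx k)) -> j = k.
Proof.
move=> aw e; have /hty [_ inj _] : chamber K (cham w) by apply/chamberP; exists w.
apply: vtx_inj; apply: (aw_inj aw); apply: inj => //; apply: mem_set.
  by exists j.
by exists k.
Qed.

Lemma ty_surj w s : affine_weyl D w -> exists j, ty (w (vtx j)) = s.
Proof.
move=> aw; have /hty [_ _ surj] : chamber K (cham w) by apply/chamberP; exists w.
by have [_ [j _ <-] e] := surj s Logic.I; exists j.
Qed.

(** Adjacent chambers share all vertices but one and carry every type exactly once, so the remaining
    vertex keeps its type; a word reduces the claim to adjacent chambers. *)
Lemma ty_aw w j : affine_weyl D w -> ty (w (vtx j)) = ty (vtx j).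
Proof.
move=> /aw_word [l ->]; elim/last_ind: l j => // l k IH j.
have e x : word_act (rcons l k) x = word_act l (wall_refl k x).
  by rewrite -cats1 word_act_cat.
rewrite e; have [jk|jk] := eqVneq j k; last by rewrite wall_refl_vtx.
rewrite jk; have [m em] := ty_surj (ty (word_act l (wall_refl k (vtx k))))
  (word_act_aw l).
have [mk|mk] := eqVneq m k; first by rewrite -em mk IH.
have : m = k.
  apply: (ty_cham (w := word_act (rcons l k))); first exact: word_act_aw.
  by rewrite !e -em wall_refl_vtx.
by move/eqP; rewrite (negPf mk).
Qed.

Definition panel_type j := ty @` panel id j.

Lemma panel_typeE w j : affine_weyl D w -> ty @` panel w j = panel_type j.
Proof.
by move=> aw; apply/seteqP; split => _ [_ [i ij <-] <-]; [exists (vtx i);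
  rewrite ?ty_aw //|exists (w (vtx i)); rewrite ?ty_aw //]; exists i.
Qed.

Lemma panel_type_inj : injective panel_type.
Proof.
move=> j k e; apply: contrapT => /eqP jk.
have : panel_type k (ty (vtx j)) by exists (vtx j) => //; exists j.
rewrite -e => -[_ [i ij <-] /(ty_cham (affine_weyl_id D)) eij].
by move: ij; rewrite /= eij eqxx.
Qed.

Lemma gallery_reach w s y : affine_weyl D w -> steps_in K (cham w) s ->
  last (cham w) (unzip2 s) y -> exists l i,
  [/\ [seq ty @` z.1 | z <- s] = map panel_type l, ty y = ty (vtx i)
    & reach (fun _ _ => True) w l i y].
Proof.
elim: s w => [|[p c] s IH] w aw /=.
  by move=> _ [i _ <-]; exists [::], i; split; rewrite ?ty_aw.
case=> pw pc cc ss.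
have [j ->] := stepP aw pw pc cc.
case=> ec; rewrite ec in ss * => ly.
  have [l [i [el ei r]]] := IH w aw ss ly; exists (j :: l), i; split => //=;
    last by right.
  by rewrite el panel_typeE.
have awj := aw_comp aw (wall_refl_aw j).
have [l [i [el ei r]]] := IH _ awj ss ly; exists (j :: l), i; split => //=;
  last by left.
by rewrite el panel_typeE.
Qed.

Lemma cham_wall_refl w j : affine_weyl D w -> cham (w \o wall_refl j) <> cham w.
Proof.
move=> aw e; have : cham (w \o wall_refl j) (w (wall_refl j (vtx j))) by exists j.
rewrite e => -[k _ /(aw_inj aw) ek].
have := bary_wall_refl j (vtx j); rewrite -ek !bary_vtx eqxx.
by case: eqP => _ /eqP; rewrite -subr_eq0 opprK ?add0r ?oner_eq0 // -natrD pnatr_eq0.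
Qed.

Lemma reach_gallery w l i y : affine_weyl D w -> reach posfold w l i y -> exists s,
  [/\ steps_in K (cham w) s, last (cham w) (unzip2 s) y,
      folds_positive D alpha (cham w) s,
      [seq ty @` z.1 | z <- s] = map panel_type l & ty y = ty (vtx i)].
Proof.
elim: l w => [|j l IH] w aw /=.
  by move=> ->; exists [::]; split; rewrite ?ty_aw //; exists i.
have awj := aw_comp aw (wall_refl_aw j).
have cE u : affine_weyl D u -> chamber K (cham u) by move=> au; apply/chamberP;
  exists u.
case=> [r|[pf r]].
  have [s [s1 s2 s3 s4 s5]] := IH _ awj r.
  exists ((panel w j, cham (w \o wall_refl j)) :: s); split => //=.
  - split => //; [exact: panel_face| |exact: cE].
    by rewrite -panel_wall_refl; apply: panel_face.
  - by split=> // /(cham_wall_refl aw).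
  - by rewrite s4 panel_typeE.
have [s [s1 s2 s3 s4 s5]] := IH _ aw r.
exists ((panel w j, cham w) :: s); split => //=.
- by split => //; [exact: panel_face|exact: panel_face|exact: cE].
- by split=> // _; apply: posfold_positive.
- by rewrite s4 panel_typeE.
Qed.

End Types.

(** Translation by a root shifts each hyperplane level by the integer [h b a] and keeps the root
    [b], so positive folds remain positive. *)
Lemma reach_translate a w l m y : roots D a -> reach posfold w l m y ->
  reach posfold (fun v => w v + a) l m (y + a).
Proof.
move=> ra; elim: l w => [|j l IH] w /=; first by move=> ->.
case=> [/IH r|[[b [k [rb pb pk ge_k]]] /IH r]]; [by left|right; split => //].
have /intrP [z ez] := coroot_int rb ra.
exists b, (k + z); split => // [i ij|]; rewrite hD ez intrD; first by rewrite pk.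
by rewrite lerD2r.
Qed.

Lemma reach_orbit P w l m y : affine_weyl D w -> reach P w l m y ->
  exists2 x, affine_weyl D x & y = x (vtx m).
Proof.
elim: l w => [|j l IH] w aw /=; first by move=> ->; exists w.
by case=> [/IH|[_ /IH]]; apply => //; apply: aw_comp => //; apply: wall_refl_aw.
Qed.

(** * Root operators in the direction of one simple root *)

Section SimpleString.
Variable i : I.
Local Notation al := (alpha i).
Local Notation hi := (h (alpha i)).
Local Notation s a := (refl (alpha i) a).

Lemma simple_reflE a v : s a v = v - (hi v - a%:~R) *: al.
Proof. by []. Qed.

Lemma h_simple_refl a v : hi (s a v) = 2 * a%:~R - hi v.
Proof. by apply: h_refl_self; apply: alpha_root. Qed.

Lemma simple_reflK a v : s a (s a v) = v.
Proof. by apply: reflK; apply: alpha_root. Qed.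

Lemma simple_refl_aw a w : affine_weyl D w -> affine_weyl D (s a \o w).
Proof. by move=> aw; apply: affine_weyl_refl => //; apply: alpha_root. Qed.

Lemma h_simple_self : hi al = 2.
Proof. by rewrite coroot_diag //; apply: alpha_root. Qed.

Lemma simple_reflD a v : s a (v + al) = s a v - al.
Proof.
rewrite /affine_reflection hD h_simple_self.
by apply/rowP => x; rewrite !mxE; ring.
Qed.

Lemma simple_reflB a v : s a (v - al) = s a v + al.
Proof. by rewrite -[in RHS](subrK al v) simple_reflD subrK. Qed.

Lemma simple_refl_succ a v : s (a + 1) v = s a v + al.
Proof.
by rewrite /affine_reflection intrD; apply/rowP => x; rewrite !mxE; ring.
Qed.

Lemma simple_refl_pred a v : s (a - 1) v = s a v - al.
Proof. by rewrite -[in RHS](subrK 1 a) simple_refl_succ addrK. Qed.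

Definition in_strip w (a : int) :=
  forall v, fund_alcove v -> a%:~R <= hi (w v) <= a%:~R + 1.

Definition in_level w j (c : int) := forall k, k != j -> hi (w (vtx k)) = c%:~R.

Lemma panel_vertex j : exists k : option I, k != j.
Proof. by have [_ [k kj _]] := panel_neq0 id j; exists k. Qed.

Lemma strip_level w a j c : in_strip w a -> in_level w j c -> c = a \/ c = a + 1.
Proof.
move=> ws wl; have [k kj] := panel_vertex j.
have := ws _ (fund_alcove_vtx k); rewrite wl // -[1]/(1%:~R) -intrD !ler_int =>
  /andP [? ?].
by have [->|] := eqVneq c a; [left|right; lia].
Qed.

(** If crossing the panel changed the strip, the panel would lie in two strips, hence in a common
    boundary hyperplane. *)
Lemma strip_wall_refl w a j : affine_weyl D w -> in_strip w a ->
  (forall c, ~ in_level w j c) -> in_strip (w \o wall_refl j) a.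
Proof.
move=> aw ws nl; have [k hk] := strip (aw_comp aw (wall_refl_aw j)) (alpha_root i).
have hp m : m != j -> [/\ a%:~R <= hi (w (vtx m)), hi (w (vtx m)) <= (a + 1)%:~R,
    k%:~R <= hi (w (vtx m)) & hi (w (vtx m)) <= (k + 1)%:~R].
  move=> mj; have /andP [? ?] := ws _ (fund_alcove_vtx m).
  have /andP := hk _ (fund_alcove_vtx m); rewrite /= wall_refl_vtx // => -[? ?].
  by split => //; rewrite intrD.
suff -> : a = k by [].
have [//|ak] := eqVneq a k; have [lt|le] := ltP k a.
  case: (nl a) => m /hp [ge1 _ _ le2]; apply/eqP; rewrite eq_le ge1 andbT.
  by apply: (le_trans le2); rewrite ler_int lezD1.
case: (nl (a + 1)) => m /hp [_ le1 ge2 _]; apply/eqP; rewrite eq_le le1 /=.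
by apply: le_trans ge2; rewrite ler_int; lia.
Qed.

(* [s_alpha] permutes the positive roots that are not multiples of [alpha]. *)
Lemma posfold_refl w j a : (forall c, ~ in_level w j c) ->
  posfold w j -> posfold (s a \o w) j.
Proof.
move=> nl [b [k [rb pb pk ge_k]]].
have npar : ~ par b i.
  move=> /par_h hb; have [z hz] := indivisible_int (alpha_root i) rb
    (@simple_indivisible i) (fun v => hb v).
  by apply: (nl (z * k)) => m mj; rewrite hz pk // intrM.
have /intrP [z ez] := coroot_int rb (alpha_root i).
have e v : h (sref al b) (s a v) = h b v + (- (a * z))%:~R.
  rewrite h_sref //; last exact: alpha_root.
  have -> : sref al (s a v) = v - a%:~R *: al.
    rewrite srefE h_simple_refl /affine_reflection.
    by apply/rowP => x; rewrite !mxE; ring.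
  by rewrite hB hZ ez intrN intrM.
exists (sref al b), (k - a * z); split => [||m mj|] /=.
- by apply: sref_root => //; apply: alpha_root.
- exact: sref_pos.
- by rewrite e pk // intrD.
- by rewrite e intrD lerD2r.
Qed.

Lemma posfold_reflE w j a : (forall c, ~ in_level w j c) ->
  posfold (s a \o w) j <-> posfold w j.
Proof.
move=> nl; split; last exact: posfold_refl.
have -> : w = s a \o (s a \o w) by apply/funext => v /=; rewrite simple_reflK.
move=> pf; apply: posfold_refl => [c lc|].
  apply: (nl (2 * a - c)) => m mj; have := lc m mj; rewrite /= h_simple_refl => e.
  by rewrite intrB intrM -e; ring.
by move: pf; congr posfold; apply/funext => v /=; rewrite simple_reflK.
Qed.

Lemma alpha_pos : pos al.
Proof. by move=> m; rewrite homega. Qed.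

Lemma bottom_posfold w a j : in_strip w a -> in_level w j a -> posfold w j.
Proof.
move=> ws wl; exists al, a; split => //; [exact: alpha_root|exact: alpha_pos|].
by have /andP [] := ws _ (fund_alcove_vtx j).
Qed.

(** The coroot of a positive root defining this hyperplane is a positive multiple of that of
    [alpha i], so the alcove, below the top of its strip, is on the wrong side. *)
Lemma top_not_posfold w a j : affine_weyl D w -> in_strip w a ->
  in_level w j (a + 1) -> ~ posfold w j.
Proof.
move=> aw ws wl [b [k [rb pb pk ge_k]]].
have rE : refl b k = s (a + 1).
  have [y [_ _ c2]] := aw_inv aw; apply/funext => v.
  by rewrite -(c2 v) (panel_refl aw rb pk) (panel_refl aw (alpha_root i) wl).
have [c ec] := refl_eq_level rb (alpha_root i) rE.
have hb v : h b v = c * hi v.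
  by have := ec v; have := ec 0; rewrite !h0; lra.
have c_ge0 : 0 <= c by have := pb i; rewrite hb homega eqxx mulr1.
have c_gt0 : 0 < c.
  rewrite lt_neqAle c_ge0 andbT eq_sym; apply/eqP => c0.
  by have := coroot_diag rb; rewrite hb c0 mul0r => /eqP; rewrite eq_sym pnatr_eq0.
have /andP [_ le] := ws _ (fund_alcove_vtx j).
have e : hi (w (vtx j)) = (a + 1)%:~R.
  apply/eqP; rewrite eq_le intrD le /=.
  by move: ge_k; rewrite -subr_ge0 ec pmulr_rge0 // subr_ge0 intrD.
have := panel_refl aw (alpha_root i) wl (vtx j); rewrite refl_fix // => /(aw_inj aw) ej.
have := bary_wall_refl j (vtx j); rewrite -ej !bary_vtx eqxx => /eqP.
by rewrite -subr_eq0 opprK -natrD pnatr_eq0.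
Qed.

Variable m : option I.
Hypothesis h_int : forall w, affine_weyl D w -> exists z : int, hi (w (vtx m)) = z%:~R.

Local Notation rch w l := (reach posfold w l m).

Definition pair_reach w (a : int) l z := rch w l z \/ rch (s a \o w) l z.

(* Root operators for [alpha]: the targets of the galleries that start at one of
   two alcoves adjacent along [H_(alpha,a)] form unions of [alpha]-strings that
   are symmetric about this wall.  The third clause, a raising operator, is what
   the induction needs when the first wall that is met is [H_(alpha,a+1)]. *)
Lemma pair_reach_string w a l : affine_weyl D w -> in_strip w a ->
  [/\ forall z, pair_reach w a l z -> pair_reach w a l (s a z),
      forall z, pair_reach w a l z -> a%:~R + 1 <= hi z -> pair_reach w a l (z - al)
    & forall z, rch (s a \o w) l z -> a%:~R <= hi z ->
        rch w l z \/ pair_reach w a l (z + al)].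
Proof.
elim: l w a => [|j l IH] w a aw ws.
  (* Integrality puts the end vertex on one of the two boundary hyperplanes of the strip. *)
  have [z0 ez0] := h_int aw.
  have : z0 = a \/ z0 = a + 1.
    have := ws _ (fund_alcove_vtx m); rewrite ez0 -[1]/(1%:~R) -intrD !ler_int =>
      /andP [? ?].
    by have [->|] := eqVneq z0 a; [left|right; lia].
  move=> z0E; split => z.
  - by case=> /= ->; [right|left; rewrite simple_reflK].
  - case=> /= ->.
      rewrite ez0 => le; right; rewrite /= simple_reflE ez0.
      have -> : z0 = a + 1 by case: z0E => // e; move: le; rewrite e gerDl ler10.
      by rewrite intrD addrAC subrr add0r scale1r.
    rewrite h_simple_refl ez0; case: z0E => ->; rewrite ?intrD; lra.
  - move=> /= ->; rewrite h_simple_refl ez0 => le; left.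
    have z0a : z0 = a by case: z0E => // e; exfalso; move: le; rewrite e intrD; lra.
    by rewrite refl_fix // ez0 z0a.
have awj := aw_comp aw (wall_refl_aw j).
case: (pselect (exists c, in_level w j c)) => [[c wc]|/forallNP nl]; last first.
  (* The panel lies in no hyperplane parallel to the mirror: both galleries can cross or fold alike
     and remain mirror images in the same strips. *)
  have [S1 S2 Y] := IH w a aw ws.
  have [S1' S2' Y'] := IH _ a awj (strip_wall_refl aw ws nl).
  have pfE := posfold_reflE a nl.
  split => z.
  - case=> /= [] [r|[pf r]].
    + by have [?|?] := S1' z (or_introl r); [left; left|right; left].
    + by have [?|?] := S1 z (or_introl r); [left; right|right; right; split => //;
      apply/pfE].
    + by have [?|?] := S1' z (or_intror r); [left; left|right; left].
    + have pw := pfE.1 pf; by have [?|?] := S1 z (or_intror r); [left; right|right;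
      right].
  - case=> /= [] [r|[pf r]] le.
    + by have [?|?] := S2' z (or_introl r) le; [left; left|right; left].
    + by have [?|?] := S2 z (or_introl r) le; [left; right|right; right;
      split => //; apply/pfE].
    + by have [?|?] := S2' z (or_intror r) le; [left; left|right; left].
    + have pw := pfE.1 pf; by have [?|?] := S2 z (or_intror r) le; [left;
      right|right; right].
  - case=> /= [r|[pf r]] le.
      by have [?|[?|?]] := Y' z r le; [left; left|right; left; left|right; right; left].
    have pw := pfE.1 pf.
    by have [?|[?|?]] := Y z r le; [left; right|right; left; right|right; right; right].
have wE : w \o wall_refl j = s c \o w.
  by apply/funext => v /=; rewrite -(panel_refl aw (alpha_root i) wc).
have dE b : (s b \o w) \o wall_refl j = s b \o (s c \o w) by rewrite -wE.
have [ca|ca] := strip_level ws wc; rewrite ca in wc wE dE.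
  (* The panel lies on the mirror: crossing exchanges the two alcoves, and [w] may fold, so [w]
     alone reaches all targets of the pair. *)
  have [S1 S2 Y] := IH w a aw ws.
  have pf := bottom_posfold ws wc.
  have dE' : (s a \o w) \o wall_refl j = w by rewrite dE; apply/funext => v /=;
    rewrite simple_reflK.
  have T'T z : pair_reach w a l z -> rch w (j :: l) z.
    by case=> r; [right|left; rewrite wE].
  have TT' z : pair_reach w a (j :: l) z -> pair_reach w a l z.
    case=> /= [] [|[_]]; rewrite ?wE ?dE' => r; by [left|right].
  split => z.
  - by move=> /TT' /S1 /T'T ?; left.
  - by move=> /TT' /S2 H /H /T'T ?; left.
  - by move=> r _; left; apply: T'T; apply: TT'; right.
(* The panel is at the top of the strip of [w]: crossing leads to the translate by [alpha i] of the
   mirror image [d], and folding is not positive. The panel of [d] is at the bottom of its own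
   strip, so the induction hypothesis is used for [d], one level lower. *)
pose d := s a \o w.
have ad : affine_weyl D d := simple_refl_aw a aw.
have ds : in_strip d (a - 1).
  move=> v /ws /andP [? ?]; rewrite /d /= h_simple_refl intrB.
  by apply/andP; split; lra.
have [S1 S2 Y] := IH d (a - 1) ad ds.
have dl : in_level d j (a - 1).
  by move=> k kj; rewrite /d /= h_simple_refl wc // intrB intrD; ring.
have pfd : posfold d j := bottom_posfold ds dl.
have npf := top_not_posfold aw ws wc.
have wE' : w \o wall_refl j = fun v => d v + al.
  by rewrite wE; apply/funext => v /=; rewrite simple_refl_succ.
have dE' : d \o wall_refl j = s (a - 1) \o d.
  rewrite dE; apply/funext => v /=.
  by rewrite simple_refl_succ simple_reflD simple_reflK simple_refl_pred simple_reflK.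
have up z : rch d l z -> rch w (j :: l) (z + al).
  by move=> r; left; rewrite wE'; apply: reach_translate => //; apply: alpha_root.
have upP z : rch w (j :: l) z -> rch d l (z - al).
  case=> [|[/npf//]]; rewrite wE' => r.
  have := reach_translate (rootN (alpha_root i)) r; congr (reach _ _ _ _ _).
  by apply/funext => v; rewrite addrK.
have low z : pair_reach d (a - 1) l z -> rch d (j :: l) z.
  by case=> r; [right|left; rewrite dE'].
have lowP z : rch d (j :: l) z -> pair_reach d (a - 1) l z.
  by case=> [|[_ r]]; [rewrite dE' => r; right|left].
split => z.
- case=> [/upP r|/lowP r].
    right; apply: low; have := S1 _ (or_introl r).
    by rewrite simple_refl_pred simple_reflB addrK.
  have -> : s a z = s (a - 1) z + al by rewrite simple_refl_pred subrK.
  have [u|u] := S1 z r; first by left; apply: up.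
  (* The reflected target is known only from the mirror image of [d]. From level [a - 1] upwards the
     raising clause applies; below it, [z] is first lowered and then reflected. *)
  have [lt|ge] := ltP (hi (s (a - 1) z)) (a - 1)%:~R; last first.
    by have [v|v] := Y _ u ge; [left; apply: up|right; apply: low].
  right; apply: low.
  have [zn ezn] : exists zn : int, hi z = zn%:~R.
    by case: r => /reach_orbit [|x ax ->]; rewrite ?h_int //;
      [apply: h_int|apply: simple_refl_aw|apply: h_int].
  have ge : (a - 1)%:~R + 1 <= hi z.
    have lt' : (a - 1)%:~R < zn%:~R :> R by move: lt; rewrite h_simple_refl ezn; lra.
    by rewrite ezn -[X in _ + X]/(1%:~R) -intrD ler_int lezD1 -(ltr_int R).
  by have := S1 _ (S2 z r ge); rewrite simple_reflB.
- case=> [/upP r|/lowP r] le; right; apply: low; first by left.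
  by apply: S2 => //; rewrite intrB; lra.
- move=> /lowP [r|r] le; right; first by left; apply: up.
  have [|u|u] := Y z r; first by rewrite intrB; lra.
    by left; apply: up.
  by right; apply: low.
Qed.

Definition target_reachable l y := exists2 w, affine_weyl D w & w 0 = 0 /\ rch w l y.

(** A starting alcove at 0 lies in strip 0 or strip -1; in the second case its mirror image in the
    hyperplane through 0 is taken. *)
Lemma target_strip l y : target_reachable l y -> exists w,
  [/\ affine_weyl D w, w 0 = 0, in_strip w 0 & pair_reach w 0 l y].
Proof.
case=> w aw [w0 r]; have [k hk] := strip aw (alpha_root i).
have := hk _ (fund_alcove_vtx None); rewrite /= w0 h0 -[1]/(1%:~R) -intrD.
rewrite -[0]/(0%:~R) !ler_int => /andP [? ?].
have [k0|k0] := eqVneq k 0; first by exists w; split => //; [rewrite -k0|left].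
have kN : k = -1 by lia.
exists (s 0 \o w); split.
- exact: simple_refl_aw.
- by rewrite /= w0 refl_fix // h0.
- move=> v /hk; rewrite kN intrN /= h_simple_refl => /andP [? ?].
  by apply/andP; split; lra.
- by right; move: r; congr (reach _ _ _ _ _); apply/funext => v /=;
  rewrite simple_reflK.
Qed.

Lemma pair_reach_target w l y : affine_weyl D w -> w 0 = 0 ->
  pair_reach w 0 l y -> target_reachable l y.
Proof.
move=> aw w0 [r|r]; first by exists w.
exists (s 0 \o w); first exact: simple_refl_aw.
by split => //=; rewrite w0 refl_fix // h0.
Qed.

Lemma target_reachable_sref l y : target_reachable l y ->
  target_reachable l (sref al y).
Proof.
case/target_strip => w [aw w0 ws r]; apply: (pair_reach_target aw w0).
by have [S1 _ _] := pair_reach_string l aw ws; apply: S1.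
Qed.

Lemma target_reachable_sub l y : target_reachable l y -> 1 <= hi y ->
  target_reachable l (y - al).
Proof.
case/target_strip => w [aw w0 ws r] le; apply: (pair_reach_target aw w0).
by have [_ S2 _] := pair_reach_string l aw ws; apply: S2 => //; rewrite add0r.
Qed.

End SimpleString.

(** * Special vertices, dominance and the dual convex hull *)

(* In a nonreduced root system [h a z] may be a half-integer for a divisible [a]. *)
Definition special_int z := forall a, roots D a -> exists b m,
  [/\ roots D b, forall v, h b v = m * h a v & exists k : int, h b z = k%:~R].

Lemma special_vertex_int x : special_vertex D x -> special_int x.
Proof.
case=> _ sx a ra; have [b [l [rb hb [u eu]]]] := sx a 0 ra.
exists b, (h b a / 2); split => //; last by exists l.
(* The projection of [v] to the kernel of [h a]; parallelism makes [h b] vanish there, so [h b] is a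
   multiple of [h a]. *)
move=> v; pose p := v - (h a v / 2) *: a.
have hp : h a p = 0 by rewrite hB hZ coroot_diag //; field.
have on q : h a q = 0 -> h b (q + u) = l%:~R.
  move=> hq; have : hyperplane D b l (q + u) by rewrite eu; exists q.
  by [].
have : h b p = 0.
  have := on _ hp; have := on _ (h0 a); rewrite add0r hD => ->.
  lra.
by rewrite hB hZ => e; lra.
Qed.

Lemma special_int_aw w z : affine_weyl D w -> special_int z -> special_int (w z).
Proof.
move=> aw sz a ra; have [w' [aw' c1 c2]] := aw_inv aw.
have [a' [k [ra' e1 _]]] := aw_pull aw ra.
have [b' [m [rb' hb' [z0 ez0]]]] := sz a' ra'.
have [b [k2 [rb e2 _]]] := aw_pull aw' rb'.
exists b, m; split => //.
  have hv v : h b v = m * (h a v - k%:~R) - k2%:~R.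
    by have := e2 v; rewrite hb'; have := e1 (w' v); rewrite c2 => ->; lra.
  by move=> v; have := hv 0; rewrite !h0 hv; lra.
by exists (z0 - k2); have := e2 (w z); rewrite c1 ez0 intrB => ->; rewrite addrK.
Qed.

Lemma special_int_indivisible z a : special_int z -> roots D a ->
  indivisible a -> exists k : int, h a z = k%:~R.
Proof.
move=> sz ra na; have [b [m [rb hb [k ek]]]] := sz a ra.
have [l hl] := indivisible_int ra rb na hb.
by exists (l * k); rewrite hl ek intrM.
Qed.

(** Half of [theta] would have twice its coroot, against maximality. *)
Lemma wall_root_indivisible j : indivisible (wall_root j).
Proof.
case: j => [i|] /=; first exact: simple_indivisible.
move=> r; have [i _] := index_inhabited.
have := theta_max i r; rewrite hE // ipZl ipZl ipZr.
have := theta_gt0 i; rewrite (hE _ theta_root).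
have := root_sq_gt0 theta_root.
set p := ip theta theta; set q := ip theta (omega i) => p_gt0.
have -> : 2 * (2^-1 * q) / (2^-1 * (2^-1 * p)) = 2 * (2 * q / p).
  by field; rewrite gt_eqF.
lra.
Qed.

Lemma root_lattice0 : root_lattice D 0.
Proof. by exists [::] => //; rewrite big_nil. Qed.

Lemma root_latticeD q r : root_lattice D q -> root_lattice D r ->
  root_lattice D (q + r).
Proof.
move=> [s rs ->] [t rt ->]; exists (s ++ t); last by rewrite big_cat.
by move=> z; rewrite mem_cat => /orP [/rs|/rt].
Qed.

Lemma root_lattice_mul b (k : int) : roots D b -> root_lattice D (k%:~R *: b).
Proof.
move=> rb; exists [:: (k, b)]; last by rewrite big_seq1 scaler_int.
by move=> z; rewrite inE => /eqP ->.
Qed.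

Lemma root_latticeN q : root_lattice D q -> root_lattice D (- q).
Proof.
move=> [s rs ->]; exists [seq (- z.1, z.2) | z <- s].
  by move=> _ /mapP [z sz ->]; apply: (rs z sz).
by rewrite big_map -sumrN; apply: eq_bigr => z _; rewrite mulrNz.
Qed.

Lemma root_lattice_ind (P : V -> Prop) : P 0 ->
  (forall q r, P q -> P r -> P (q + r)) -> (forall b (k : int), roots D b ->
    P (k%:~R *: b)) ->
  forall q, root_lattice D q -> P q.
Proof.
move=> P0 PD PM _ [s rs ->]; rewrite big_seq.
by apply: (big_ind P) => // z sz; rewrite -scaler_int; apply: PM; apply: rs.
Qed.

Lemma root_lattice_coef q i : root_lattice D q -> exists k : int, coef q i = k%:~R.
Proof.
move: q; apply: root_lattice_ind => [|q r [k ek] [l el]|b k rb].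
- by exists 0; rewrite /coef ip0l mulr0 mul0r.
- by exists (k + l); rewrite coefD ek el intrD.
- have [c [[_ ec]|[_ ec]]] := root_nat rb.
    by exists (k * c i); rewrite coefZ ec intrM.
  by exists (- (k * c i)); rewrite coefZ ec intrN intrM mulrN.
Qed.

Lemma root_lattice_h q a : roots D a -> root_lattice D q ->
  exists k : int, h a q = k%:~R.
Proof.
move=> ra; move: q; apply: root_lattice_ind => [|q r [k ek] [l el]|b k rb].
- by exists 0; rewrite h0.
- by exists (k + l); rewrite hD ek el intrD.
- by have /intrP [l el] := coroot_int ra rb; exists (k * l); rewrite hZ el intrM.
Qed.

(** A wall reflection moves a special point by an integral multiple of the wall root, because wall
    roots are indivisible. *)
Lemma special_aw_lattice w z : affine_weyl D w -> special_int z ->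
  root_lattice D (w z - z).
Proof.
move=> /aw_word [l ->] sz; elim: l => [|j l IH] /=; first by rewrite subrr;
  apply: root_lattice0.
have -> : wall_refl j (word_act l z) - z =
    (wall_refl j (word_act l z) - word_act l z) + (word_act l z - z) by rewrite
      addrA subrK.
apply: root_latticeD => //.
have [k ek] := special_int_indivisible (special_int_aw (word_act_aw l) sz)
  (wall_rootP j)
  (@wall_root_indivisible j).
rewrite /wall_refl /affine_reflection ek addrAC subrr add0r -scaleNr -intrB -intrN.
by apply: root_lattice_mul; apply: wall_rootP.
Qed.

(** * The dominance order on a Weyl group orbit *)

Section Dominance.
Variable p : V.
Hypothesis p_dom : forall i, 0 <= h (alpha i) p.

(** Each step subtracts a nonnegative multiple of a positive root. Closure under all reflections
    puts the whole orbit of [p] in this set, which bounds the orbit by [p]. *)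
Inductive below : V -> Prop :=
| below_refl : below p
| below_step q b : below q -> roots D b -> pos b -> 0 <= h b q -> below (sref b q).

Lemma sref_sub a b c v : sref a (v - c *: b) = sref a v - c *: sref a b.
Proof. by rewrite !srefE hB hZ; apply/rowP => i; rewrite !mxE; ring. Qed.

Lemma sref_conj a b v : roots D a -> roots D b ->
  sref (sref a b) v = sref a (sref b (sref a v)).
Proof.
move=> ra rb; by rewrite [LHS]srefE h_sref // (srefE b (sref a v)) sref_sub srefK.
Qed.

Lemma par_sref_eq b i : roots D b -> par b i -> sref b = sref (alpha i).
Proof.
move=> rb pb; apply: (level_refl_eq (m := h b (omega i))) => // [|v];
  first exact: alpha_root.
by rewrite !subr0; apply: par_h.
Qed.

(* The argument of the lifting property of the Bruhat order. *)
Lemma below_simple i q : below q -> below (sref (alpha i) q).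
Proof.
elim=> {q} [|q b bq IH rb pb hb].
  by apply: below_step => //; [constructor|exact: alpha_root|move=> j; rewrite homega].
case: (pselect (par b i)) => [/(par_sref_eq rb) ->|npar].
  by rewrite srefK //; apply: alpha_root.
have ri := alpha_root i.
have -> : sref (alpha i) (sref b q) = sref (sref (alpha i) b) (sref (alpha i) q).
  by rewrite sref_conj // srefK.
apply: below_step => //; [exact: sref_root|exact: sref_pos|].
by rewrite h_sref // srefK.
Qed.

Lemma below_sref b q : roots D b -> below q -> below (sref b q).
Proof.
move=> rb; move: b rb q; apply: root_ind => [i b rb /(par_sref_eq rb) ->
  q|i b rb IH q bq].
  exact: below_simple.
rewrite sref_conj //; last exact: alpha_root.
by apply: below_simple; apply: IH; apply: below_simple.
Qed.

Lemma below_aw w : affine_weyl D w -> below (w p - w 0).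
Proof.
elim=> [|a k u ra _ IH] /=; first by rewrite subr0; constructor.
rewrite (reflE a k (u p)) (reflE a k (u 0)) opprD addrACA subrr addr0.
have -> : sref a (u p) - sref a (u 0) = sref a (u p - u 0).
  by rewrite !srefE hB; apply/rowP => i; rewrite !mxE; ring.
exact: below_sref.
Qed.

Lemma below_coef q i : below q -> 0 <= coef (p - q) i.
Proof.
elim=> {q} [|q b _ IH rb pb hb]; first by rewrite subrr /coef ip0l mulr0 mul0r.
rewrite srefE opprB addrCA addrC coefD coefZ addr_ge0 // mulr_ge0 //.
by rewrite coef_ge0.
Qed.

End Dominance.

(** * The dual convex hull of an orbit *)

Section Hull.
Variable x : V.
Local Notation hull := (dual_convex_hull D omega ip (weyl_orbit D x)).

Lemma sph_inv u : spherical_weyl D u ->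
  exists u', [/\ spherical_weyl D u', cancel u u' & cancel u' u].
Proof.
move=> [au u0]; have [u' [au' c1 c2]] := aw_inv au.
by exists u'; split => //; split => //; rewrite -u0 c1.
Qed.

Lemma sph_comp u v : spherical_weyl D u -> spherical_weyl D v ->
  spherical_weyl D (u \o v).
Proof. by move=> [au u0] [av v0]; split; [exact: aw_comp|rewrite /= v0]. Qed.

Lemma hull_weyl u z : spherical_weyl D u -> hull z -> hull (u z).
Proof.
move=> su hz H [[w [i [k [sw HE]]]] sub]; have [u' [su' c1 c2]] := sph_inv su.
have e v : ip (w (omega i)) (u v) = ip (u' (w (omega i))) v.
  by rewrite -{1}(c2 (w (omega i))) ipW.
have orb v : weyl_orbit D x v -> weyl_orbit D x (u v).
  by case=> y sy <-; exists (u \o y) => //; apply: sph_comp.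
have suw := sph_comp su' sw.
case: HE => HE; rewrite HE /= e.
  apply: (hz [set v | ip ((u' \o w) (omega i)) v <= k]); split.
    by exists (u' \o w), i, k; split => //; left.
  by move=> v /orb /sub; rewrite HE /= e.
apply: (hz [set v | k <= ip ((u' \o w) (omega i)) v]); split.
  by exists (u' \o w), i, k; split => //; right.
by move=> v /orb /sub; rewrite HE /= e.
Qed.

Lemma hull_convex u v t : 0 <= t <= 1 -> hull u -> hull v -> hull (u + t *: (v - u)).
Proof.
move=> /andP [t0 t1] hu hv H HH; have := hu H HH; have := hv H HH.
case: HH => [[w [i [k [_ [->|->]]]]] _] /=; rewrite ipDr ipZr ipBr => a b; nra.
Qed.

Lemma hull_orbit z : weyl_orbit D x z -> hull z.
Proof. by move=> oz H [_]; apply. Qed.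

End Hull.

(** * The Bruhat order and positively folded galleries *)

(* The Bruhat order on a W^a-orbit. *)
Inductive bruhat (p : V) : V -> Prop :=
| bruhat_refl : bruhat p p
| bruhat_step q a (k : int) : bruhat p q -> roots D a ->
    (forall v, fund_alcove v -> h a v <= k%:~R) -> k%:~R <= h a q ->
    bruhat p (refl a k q).

(** Conjugating a step by the wall reflection gives a step again, unless its hyperplane is carried
    to the wall [j] itself. In that case the wall reflection undoes the step, and the first half of
    the induction hypothesis applies. *)
Lemma bruhat_lift j p q : 0 <= bary j p -> bruhat p q ->
  bruhat (wall_refl j p) q /\ bruhat (wall_refl j p) (wall_refl j q).
Proof.
move=> pj; elim=> {q} [|q a k _ [IH1 IH2] ra Ca hq].
  split; last by constructor.
  rewrite -{2}(wall_reflK j p).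
  have := bary_wall_refl j p; move: (wall_refl j p) => u bu.
  have : bary j u <= 0 by rewrite bu oppr_le0.
  case: j {pj bu} => [i|] le.
    have ri := alpha_root i.
    rewrite /wall_refl /= -refl_opp //; apply: bruhat_step.
    - by constructor.
    - exact: rootN.
    - by move=> v /(_ (Some i)); rewrite baryS pmulr_rge0 // hN_root // oppr_le0.
    - by move: le; rewrite baryS pmulr_rle0 // hN_root // oppr_ge0.
  apply: bruhat_step => //; first by constructor.
    by move=> v /(_ None); rewrite baryN subr_ge0.
  by move: le; rewrite baryN subr_le0.
split; first exact: bruhat_step.
have [a' [k0 [ra' e1 e2]]] := aw_pull (wall_refl_aw j) ra.
have -> : wall_refl j (refl a k q) = refl a' (k - k0) (wall_refl j q).
  by rewrite -{1}(wall_reflK j q) e2 wall_reflK.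
have e3 v : h a' (wall_refl j v) = h a v - k0%:~R.
  by have := e1 (wall_refl j v); rewrite wall_reflK => ->; rewrite addrK.
have [k' hk'] := strip (affine_weyl_id D) ra'.
have [le|lt] := leP (k' + 1) (k - k0).
  apply: bruhat_step => // [v /hk' /andP [_ ub]|].
    by apply: (le_trans ub); rewrite -[1]/(1%:~R) -intrD ler_int.
  by rewrite e3 intrB lerD2r.
have pn i : i != j -> h a' (vtx i) = (k - k0)%:~R.
  move=> ij; apply/eqP; rewrite eq_le; apply/andP; split.
    have := e3 (vtx i); rewrite wall_refl_vtx // => ->; rewrite intrB lerD2r.
    by apply: Ca; apply: fund_alcove_vtx.
  have /andP [lb _] := hk' _ (fund_alcove_vtx i).
  by apply: le_trans lb; rewrite ler_int; lia.
by rewrite (panel_refl (affine_weyl_id D) ra' pn) wall_reflK.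
Qed.

(** Read from the right, no letter brings the image of [vtx i] closer to the fundamental alcove. *)
Fixpoint ascending l i : Prop :=
  if l is j :: l' then 0 <= bary j (word_act l' (vtx i)) /\ ascending l' i else True.

Lemma reach_bruhat P w l i y : ascending l i -> reach P w l i y ->
  exists2 q, y = w q & bruhat (word_act l (vtx i)) q.
Proof.
elim: l w => [|j l IH] w /=; first by move=> _ ->; exists (vtx i) => //; constructor.
case=> pj al [r|[_ r]]; have [q -> bq] := IH _ al r.
  by exists (wall_refl j q) => //; apply: (bruhat_lift pj bq).2.
by exists q => //; apply: (bruhat_lift pj bq).1.
Qed.

Definition shortest l i := forall l', word_act l' (vtx i) = word_act l (vtx i) ->
  (size l <= size l')%N.

(** If the letter [j] moved the vertex towards the fundamental alcove, [exchange] would absorb [j]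
    and delete a letter of [l], leaving a word shorter by two. *)
Lemma shortest_ascending l i : shortest l i -> ascending l i.
Proof.
elim: l => //= j l IH sh; split; last first.
  by apply: IH => l' e; have := sh (j :: l') (congr1 (wall_refl j) e).
rewrite leNgt; apply/negP => lt0.
have [a [k [ra rE Ca lt_k]]] : exists a (k : int), [/\ roots D a, refl a k =
  wall_refl j,
    forall m, k%:~R <= h a (vtx m) & h a (word_act l (vtx i)) < k%:~R].
  case: j {sh} lt0 => [x|] lt0; have Cm m := fund_alcove_vtx m.
    exists (alpha x), 0; split => // [|m|]; first exact: alpha_root.
      by have := Cm m (Some x); rewrite baryS pmulr_rge0.
    by move: lt0; rewrite baryS pmulr_rlt0.
  exists (- theta), (- 1); split => [||m|]; first exact: rootN.
  - exact: refl_opp.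
  - by have := Cm m None; rewrite baryN subr_ge0 hN_root // intrN lerN2.
  - by move: lt0; rewrite baryN subr_lt0 hN_root // intrN ltrN2.
have [l' sl e] := exchange (u := id) (affine_weyl_id D) ra Ca lt_k.
have := sh l'; rewrite /= -rE -e => /(_ erefl); rewrite sl; lia.
Qed.

Lemma reach_unfold P w l i : affine_weyl D w -> reach P w l i (w (word_act l (vtx i))).
Proof. by elim: l w => //= j l IH w aw; left; apply: (IH (w \o wall_refl j));
  apply: aw_comp => //; apply: wall_refl_aw. Qed.

(** Dropping the letters at which the gallery folds leaves a word with the same target. A gallery
    without a shorter competitor thus ends where the unfolded one does. *)
Lemma reach_word P w l i y : reach P w l i y ->
  y = w (word_act l (vtx i)) \/
  exists2 l', y = w (word_act l' (vtx i)) & (size l' < size l)%N.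
Proof.
elim: l w => [|j l IH] w /=; first by left.
case=> [/IH [->|[l' -> lt]]|[_ /IH [->|[l' -> lt]]]]; first by left.
- by right; exists (j :: l').
- by right; exists l.
- by right; exists l' => //; apply: ltn_trans lt _.
Qed.

(** * Targets of folded galleries and the hull *)

Section Convexity.
Variables (x xp : V).
Hypothesis hx : special_vertex D x.
Hypothesis hxp : weyl_orbit D x xp.
Hypothesis hxpC : fundamental_chamber D alpha xp.
Variables (l : seq (option I)) (i0 : option I) (w0 : V -> V).
Hypothesis aw0 : affine_weyl D w0.
Hypothesis w00 : w0 0 = 0.
Hypothesis xpE : xp = w0 (word_act l (vtx i0)).
Local Notation hull := (dual_convex_hull D omega ip (weyl_orbit D x)).

Lemma orbit_rep : exists2 u, affine_weyl D u & xp = u x.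
Proof. by case: hxp => u [au _] <-; exists u. Qed.

Lemma vtx_orbit : exists2 u, affine_weyl D u & vtx i0 = u x.
Proof.
have [u au eu] := orbit_rep.
have [v [av c1 _]] := aw_inv (aw_comp aw0 (word_act_aw l)).
exists (v \o u); first exact: aw_comp.
by rewrite /= -eu xpE; have := c1 (vtx i0).
Qed.

Lemma special_int_vtx w : affine_weyl D w -> special_int (w (vtx i0)).
Proof.
move=> aw; have [u au ->] := vtx_orbit.
exact: special_int_aw aw (special_int_aw au (special_vertex_int hx)).
Qed.

Lemma reach_lattice P w y : affine_weyl D w -> reach P w l i0 y ->
  root_lattice D (y - x).
Proof.
move=> aw r; have [u au ->] := reach_orbit aw r; have [v av ->] := vtx_orbit.
exact: special_aw_lattice (aw_comp au av) (special_vertex_int hx).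
Qed.

Lemma bruhat_hull p q : hull p -> bruhat p q -> hull q.
Proof.
move=> hp; elim=> // {}q a k _ hq ra Ca ge_k.
have k_ge0 : 0 <= k%:~R :> R by have := Ca _ (fund_alcove_vtx None); rewrite /= h0.
have [h_eq0|h_neq0] := eqVneq (h a q) 0.
  rewrite refl_fix //; apply/eqP; rewrite eq_le ge_k andbT h_eq0 //.
have h_gt0 : 0 < h a q by rewrite lt_neqAle eq_sym h_neq0 (le_trans k_ge0).
have -> : refl a k q = q + ((h a q - k%:~R) / h a q) *: (sref a q - q).
  rewrite srefE /affine_reflection addrAC subrr add0r scalerN scalerA.
  by rewrite divfK.
apply: hull_convex => //; last by apply: hull_weyl => //; apply: sref_sph.
apply/andP; split; first by rewrite divr_ge0 ?subr_ge0 // ltW.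
by rewrite ler_pdivrMr // mul1r gerBl.
Qed.

Lemma reach_hull P w y : shortest l i0 -> affine_weyl D w -> w 0 = 0 ->
  reach P w l i0 y -> hull y.
Proof.
move=> sh aw ww0 r; have [q -> bq] := reach_bruhat (shortest_ascending sh) r.
apply: hull_weyl => //; apply: bruhat_hull bq.
have [u [su c1 _]] : exists u, [/\ spherical_weyl D u, cancel w0 u
  & cancel u w0] by apply: sph_inv.
rewrite -(c1 (word_act _ _)) -xpE; apply: hull_weyl => //; exact: hull_orbit.
Qed.

Local Notation T := (target_reachable i0 l).

Lemma int_target i w : affine_weyl D w -> exists z :
  int, h (alpha i) (w (vtx i0)) = z%:~R.
Proof.
move=> aw; apply: special_int_indivisible (special_int_vtx aw) (alpha_root i) _.
exact: simple_indivisible.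
Qed.

Lemma target_xp : T xp.
Proof. by exists w0 => //; split => //; rewrite xpE; apply: reach_unfold. Qed.

Lemma lattice_xp z : root_lattice D (z - x) -> root_lattice D (xp - z).
Proof.
move=> lz; have [u au eu] := orbit_rep.
have -> : xp - z = (xp - x) + - (z - x) by rewrite opprB addrA subrK.
apply: root_latticeD; last exact: root_latticeN.
by rewrite eu; apply: special_aw_lattice => //; apply: special_vertex_int.
Qed.

Lemma lattice_h z i : root_lattice D (z - x) -> exists k : int, h (alpha i) z = k%:~R.
Proof.
move=> lz; have [k ek] := root_lattice_h (alpha_root i) lz.
have [k' ek'] := special_int_indivisible (special_vertex_int hx) (alpha_root i)
  (@simple_indivisible i).
by exists (k + k'); rewrite intrD -ek -ek' -hD subrK.
Qed.

(** The dual half apartment through [xp] in the direction of [omega i] contains the orbit by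
    [below_aw], hence also the hull. *)
Lemma hull_coef z i : hull z -> 0 <= coef (xp - z) i.
Proof.
move=> hz; suff : ip (omega i) z <= ip (omega i) xp.
  move=> le; rewrite /coef divr_ge0 ?(ltW (alpha_sq_gt0 i)) // mulr_ge0 //.
  by rewrite ipC ipBr subr_ge0.
apply: (hz [set v | ip (omega i) v <= ip (omega i) xp]); split.
  exists id, i, (ip (omega i) xp); split; last by left.
  by split => //; constructor.
move=> _ [u [au u0] <-] /=; have [v [av v0] ev] := hxp.
have [y [[ay y0] c1 _]] := sph_inv (conj av v0).
have := below_aw hxpC (aw_comp au ay).
rewrite /= y0 u0 subr0 -{2}ev c1 => /(below_coef i).
rewrite /coef pmulr_lge0 ?invr_gt0 ?alpha_sq_gt0 // pmulr_rge0 // ipBl subr_ge0.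
by rewrite !(ipC _ (omega i)).
Qed.

(* Humphreys' argument: descend from [xp] to [y] through simple roots. *)
Lemma dominant_target y : (forall i, 0 <= h (alpha i) y) -> hull y ->
  root_lattice D (y - x) -> T y.
Proof.
move=> dom hy ly.
suff key N z : T z -> root_lattice D (z - y) -> (forall i, 0 <= coef (z - y) i) ->
    height (z - y) < N%:R -> T y.
  apply: (key (Num.trunc (height (xp - y))).+1 xp) => //.
  - exact: target_xp.
  - exact: lattice_xp.
  - by move=> i; apply: hull_coef.
  - exact: truncnS_gt.
elim: N z => [|N IH] z Tz lz cz hz.
  by move: hz; rewrite ltNge sumr_ge0.
have [zy|zy] := eqVneq (z - y) 0; first by rewrite -(subrK y z) zy add0r in Tz.
have [i ci hi] := acute_simple zy cz.
have [k ek] := root_lattice_coef i lz.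
have lx : root_lattice D (z - x).
  by rewrite -(subrK y z) -addrA; apply: root_latticeD.
have [k' ek'] := lattice_h i lx.
(* The coroot of [alpha i] is positive on [z - y] and nonnegative on the dominant [y], hence
   positive and integral on [z]. *)
have hz1 : 1 <= h (alpha i) z.
  have : 0 < h (alpha i) z by move: hi; rewrite hB; have := dom i; lra.
  by rewrite ek' ltr0z -[1]/(1%:~R) ler_int gtz0_ge1.
have eE : z - alpha i - y = z - y - alpha i by rewrite addrAC.
apply: (IH (z - alpha i)).
- exact: (target_reachable_sub (@int_target i)).
- rewrite eE; apply: root_latticeD => //; rewrite -scaleN1r.
  by have := root_lattice_mul (-1) (alpha_root i); rewrite intrN.
- move=> j; rewrite eE coefB coef_alpha; have [->|ji] := eqVneq j i;
  last by rewrite subr0.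
  by move: ci; rewrite subr_ge0 ek ltr0z -[X in X <= _]/(1%:~R) ler_int gtz0_ge1.
- have : height (z - y - alpha i) = height (z - y) - 1.
    rewrite /height (eq_bigr (fun j => coef (z - y) j - (j == i)%:R)); last first.
      by move=> j _; rewrite coefB coef_alpha.
    rewrite sumrB; congr (_ - _).
    by rewrite (bigD1 i) //= big1 ?eqxx ?addr0 // => j /negPf ->.
  by rewrite eE => ->; move: hz; rewrite -natr1; lra.
Qed.

(** Reflecting a point in a simple root with negative value keeps it in the hull and in the coset
    and lowers the height of [xp - z] by at least 1. As targets are stable under simple reflections,
    this leads back to the dominant case. *)
Lemma hull_target y : hull y -> root_lattice D (y - x) -> T y.
Proof.
suff key N z : hull z -> root_lattice D (z - x) -> height (xp - z) < N%:R -> T z.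
  move=> hy ly; apply: (key (Num.trunc (height (xp - y))).+1) => //; exact: truncnS_gt.
elim: N z => [|N IH] z hz lz lt.
  by move: lt; rewrite ltNge sumr_ge0 // => i _; apply: hull_coef.
case: (pselect (forall i, 0 <= h (alpha i) z)) => [dom|/existsNP [i /negP]].
  exact: dominant_target.
rewrite -ltNge => hi; have ri := alpha_root i.
have [k ek] := lattice_h i lz.
rewrite -(srefK z ri); apply: (target_reachable_sref (@int_target i)); apply: IH.
- by apply: hull_weyl => //; apply: sref_sph.
- rewrite srefE addrAC; apply: root_latticeD => //.
  by rewrite ek -scaleNr -intrN; apply: root_lattice_mul.
- have -> : xp - sref (alpha i) z = xp - z + h (alpha i) z *: alpha i.
    by rewrite srefE opprB addrA addrAC -addrA addrCA addrA addrAC.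
  have -> : height (xp - z + h (alpha i) z *: alpha i) = height (xp - z) + h (alpha
    i) z.
    rewrite /height (eq_bigr (fun j => coef (xp - z) j + h (alpha i) z * (j ==
      i)%:R)); last first.
      by move=> j _; rewrite coefD coefZ coef_alpha.
    rewrite big_split /= -mulr_sumr; congr (_ + _).
    by rewrite (bigD1 i) //= big1 ?eqxx ?addr0 ?mulr1 // => j /negPf ->.
  have : h (alpha i) z <= -1.
    by move: hi; rewrite ek ltrz0 -[-1]/((-1)%:~R) ler_int; lia.
  by move: lt; rewrite -natr1; lra.
Qed.

End Convexity.

Lemma complex_sub s t : K t -> s `<=` t -> s !=set0 -> K s.
Proof.
move=> /complexP [_ [w aw tw]] st s0; apply/complexP; split => //; exists w => //.
exact: subset_trans tw.
Qed.

Lemma complex_vertex s v : K s -> s v -> K [set v].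
Proof. by move=> Ks sv; apply: complex_sub Ks _ _ => [_ ->|]; [|exists v]. Qed.

Lemma vertex_complex v : vertex D v -> K [set v].
Proof.
move=> vv; have [l Cl] := fund_alcove_word v; apply/complexP; split; first by exists v.
exists (word_act (rev l)); first exact: word_act_aw.
move=> _ ->; rewrite -alcove_vertices; last exact: word_act_aw.
by split => //; exists (word_act l v) => //; rewrite word_act_revK.
Qed.

Lemma A_typeE x y : A_type D omega ip x y <->
  dual_convex_hull D omega ip (weyl_orbit D x) y /\ root_lattice D (y - x).
Proof.
split=> [[hy [q lq e]]|[hy lq]].
  by split => //; rewrite -e addrAC subrr add0r.
by split => //; exists (y - x) => //; rewrite addrCA subrr addr0.
Qed.

(** * The two inclusions inside the Coxeter complex *)

Section Galleries.
Variables (J : Type) (ty : V -> J).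
Hypothesis hty : type_function K ty.

(** Types are constant on orbits and distinct within a chamber, so 0 can only be the vertex of
    [cham w] with index [None]. *)
Lemma cham_origin w : affine_weyl D w -> cham w 0 -> w 0 = 0.
Proof.
move=> aw [j _ ej]; have : ty (vtx j) = ty (vtx None).
  by rewrite -(ty_aw hty j aw) ej.
by move/(ty_cham hty (affine_weyl_id D)) => jN; move: ej; rewrite jN.
Qed.

Lemma gallery_word g : gallery_in K g -> source g = 0 -> exists w l i,
  [/\ affine_weyl D w, w 0 = 0, reach (fun _ _ => True) w l i (target g) &
    gallery_type ty g = ty @` [set 0] :: rcons (map (panel_type ty) l) (ty @` [set
      vtx i])].
Proof.
case=> /chamberP [w aw wE] sg st tg s0; rewrite s0 wE in sg.
rewrite /last_chamber wE in st tg.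
have [l [i [el ei r]]] := gallery_reach hty aw st tg.
exists w, l, i; split => //; first exact: cham_origin.
by rewrite /gallery_type s0 el !image_set1 ei.
Qed.

Lemma word_gallery w l i y : affine_weyl D w -> w 0 = 0 -> reach posfold w l i y ->
  exists g, [/\ gallery_in K g, positively_folded D alpha g,
    gallery_type ty g = ty @` [set 0] :: rcons (map (panel_type ty) l) (ty @` [set
      vtx i]),
    source g = 0 & target g = y].
Proof.
move=> aw w00 r; have [s [s1 s2 s3 s4 s5]] := reach_gallery hty aw r.
exists (Gallery 0 (cham w) s y); split => //.
  split => //=; first by apply/chamberP; exists w.
  by exists None => //=; rewrite w00.
by rewrite /gallery_type /= s4 !image_set1 s5.
Qed.

Lemma size_gallery_type T (tyT : T -> J) (g : gallery T) :
  size (gallery_type tyT g) = (size (steps g)).+2.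
Proof. by rewrite /gallery_type /= size_rcons size_map. Qed.

Lemma gallery_type_eq l l' i i' :
  ty @` [set 0] :: rcons (map (panel_type ty) l) (ty @` [set vtx i]) =
  ty @` [set 0] :: rcons (map (panel_type ty) l') (ty @` [set vtx i']) ->
    l = l' /\ i = i'.
Proof.
case=> /rcons_inj [el ei]; split; first exact: (inj_map (panel_type_inj hty)) el.
apply: (ty_cham hty (affine_weyl_id D)).
have : (ty @` [set vtx i']) (ty (vtx i)) by rewrite -ei; exists (vtx i).
by case=> _ -> ->.
Qed.

Lemma coxeter_complex_folding x xp g0 : special_vertex D x ->
  weyl_orbit D x xp -> fundamental_chamber D alpha xp ->
  minimal_gallery K g0 -> source g0 = 0 -> target g0 = xp ->
  (forall y, A_type D omega ip x y -> exists g,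
     [/\ gallery_in K g, positively_folded D alpha g,
         gallery_type ty g = gallery_type ty g0, source g = 0 & target g = y]) /\
  (forall g, gallery_in K g -> gallery_type ty g = gallery_type ty g0 ->
     source g = 0 -> A_type D omega ip x (target g)).
Proof.
move=> hx hxp hxpC [gg0 g0min] sg0 tg0.
have [w0 [l [i [aw0 w00 r0 e0]]]] := gallery_word gg0 sg0.
rewrite tg0 in r0.
have sl : size l = size (steps g0).
  have := congr1 size e0; rewrite size_gallery_type /= size_rcons size_map.
  by case.
(* Such a word gives a gallery from 0 to [xp] with as many steps as letters, to which minimality of
   [g0] applies. *)
have short l' i' : w0 (word_act l' (vtx i')) = xp -> (size l <= size l')%N.
  move=> e; have := reach_unfold posfold l' i' aw0; rewrite e.
  case/(word_gallery aw0 w00) => g [g1 _ g2 g3 g4]; rewrite sl.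
  have := congr1 size g2; rewrite size_gallery_type /= size_rcons size_map => -[<-].
  by apply: g0min => //; rewrite ?sg0 ?tg0.
have xpE : xp = w0 (word_act l (vtx i)).
  by case: (reach_word r0) => [//|[l' e]]; have := short l' i (esym e);
    rewrite leqNgt => /negP.
have sh : shortest l i by move=> l' e; apply: (short l' i); rewrite e.
split=> [y /A_typeE [hy ly]|g gg tg sg].
  have [w aw [w_0 r]] := hull_target hx hxp hxpC aw0 w00 xpE hy ly.
  have [g [g1 g2 g3 g4 g5]] := word_gallery aw w_0 r.
  by exists g; split => //; rewrite g3 e0.
have [w [l' [i' [aw w_0 r e]]]] := gallery_word gg sg.
move: tg; rewrite e e0 => /gallery_type_eq [el ei]; rewrite el ei in r.
apply/A_typeE; split; first exact: (reach_hull hxp aw0 w00 xpE sh aw w_0 r).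
exact: (reach_lattice hx hxp aw0 xpE aw r).
Qed.

End Galleries.

(** * Galleries in the building *)

Section Building.
Variables (X : affine_building D) (J : Type) (typ : points X -> J).
Hypothesis htyp : type_function (simplices X) typ.

Lemma apartment_face A p c : apartments X A -> A c -> p `<=` c -> p !=set0 -> A p.
Proof.
move=> aA Ac pc p0; have [f f_iso] := apartment_coxeter aA.
have [s Ks cE] := iso_lift f_iso Ac.
pose q := [set v | s v /\ p (f v)].
have qE : f @` q = p.
  apply/seteqP; split => [_ [v [_ pv] <-] //|x px].
  by have := pc x px; rewrite cE => -[v sv fv]; exists v => //; split => //; rewrite fv.
rewrite -qE; apply: (iso_simplex f_iso); apply: (complex_sub Ks) => [v []//|].
by case: p0 => x; rewrite -qE => -[v qv _]; exists v.
Qed.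

Lemma apartment_vertex A s x : apartments X A -> A s -> s x -> A [set x].
Proof. by move=> aA As sx; apply: (apartment_face aA As) => [_ ->|]; [|exists x]. Qed.

(** A simplex of the building that contains [c] shares an apartment with it, and the isomorphism
    fixing [c] shows that [c] is maximal there as well. *)
Lemma apartment_chamber A c : apartments X A -> A c ->
  chamber A c <-> chamber (simplices X) c.
Proof.
move=> aA Ac; split=> [[_ cmax]|[_ cmax]]; split.
- exact: (apartment_sub aA).
- move=> s Xs cs; have [A' aA' [A'c A's]] := common_apartment (apartment_sub aA Ac) Xs.
  have [psi psi_iso psi_fix] := apartment_exchange aA aA' Ac A'c Ac A'c.
  have psi_c : psi @` c = c.
    apply/seteqP; split => [_ [x cx <-]|x cx]; first by rewrite psi_fix //; left.
    by exists x => //; apply: psi_fix; left.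
  have [_ max'] : chamber A' c.
    by rewrite -psi_c; apply: (iso_chamber _ psi_iso) => // s' x;
      apply: apartment_vertex.
  exact: max'.
- by [].
- by move=> s As; apply: cmax; apply: (apartment_sub aA).
Qed.

Variables (A0 : set (set (points X))) (f : V -> points X).
Hypothesis hA0 : apartments X A0.
Hypothesis hf : complex_iso K A0 f.

Definition typed_iso A phi := complex_iso K A phi /\
  forall v, K [set v] -> typ (phi v) = typ (f v).

Lemma type_comp A phi : apartments X A -> complex_iso K A phi ->
  type_function K (typ \o phi).
Proof.
move=> aA phi_iso c cc; have cc' : chamber (simplices X) (phi @` c).
  have cA := iso_chamber complex_vertex phi_iso cc.
  by apply/(apartment_chamber aA) => //; case: cA.
have [h1 h2 h3] := htyp cc'; have [Kc _] := cc; split => //.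
- move=> x y /set_mem cx /set_mem cy e.
  apply: (iso_vertex_inj phi_iso); [exact: complex_vertex cx|exact: complex_vertex cy|].
  by apply: h2 => //; apply: mem_set; [exists x|exists y].
- by move=> j _; have [_ [x cx <-] <-] := h3 j Logic.I; exists x.
Qed.

Lemma vertexP v : K [set v] -> exists w j, affine_weyl D w /\ v = w (vtx j).
Proof.
by move=> /complexP [_ [w aw sub]]; have [|j _ <-] := sub v; [|exists w, j].
Qed.

(* Types are determined by one chamber, so an isomorphism fixing a common
   chamber preserves them. *)
Lemma typed_exchange A A' phi c s : apartments X A -> apartments X A' ->
  typed_iso A phi -> chamber (simplices X) c -> A c -> A' c -> A s -> A' s ->
  exists phi', typed_iso A' phi' /\ forall v, (c `|` s) (phi v) -> phi' v = phi v.
Proof.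
move=> aA aA' [phi_iso phi_ty] cc Ac A'c As A's.
have [psi psi_iso psi_fix] := apartment_exchange aA aA' Ac A'c As A's.
have psiphi v : (c `|` s) (phi v) -> (psi \o phi) v = phi v by apply: psi_fix.
have iso' := iso_comp phi_iso psi_iso.
exists (psi \o phi); split => //; split => // v Kv.
have [t Kt ct] := iso_lift phi_iso Ac.
have /chamberP [w aw wE] : chamber K t.
  apply: (iso_chamber_inv complex_vertex phi_iso Kt); rewrite -ct.
  exact/(apartment_chamber aA).
have [u [j [au ->]]] := vertexP Kv.
have e1 := ty_aw (type_comp aA' iso') j; have e2 := ty_aw (type_comp hA0 hf) j.
rewrite /= in e1 e2; rewrite (e1 u au) (e2 u au) -(e1 w aw) -(e2 w aw).
have cphi : c (phi (w (vtx j))) by rewrite ct wE; exists (w (vtx j)) => //; exists j.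
rewrite psi_fix; last by left.
apply: phi_ty; apply: (complex_vertex (complex_cham aw)); by exists j.
Qed.

(* The retraction onto an apartment centered at [c0], applied one step at a time. *)
Lemma unfold_steps c0 s A phi t : chamber (simplices X) c0 -> apartments X A ->
  typed_iso A phi -> A c0 -> chamber K t -> A (phi @` t) ->
  steps_in (simplices X) (phi @` t) s ->
  exists A' phi' s', [/\ apartments X A', typed_iso A' phi', A' c0,
    phi' @` last t (unzip2 s') = last (phi @` t) (unzip2 s) &
    [/\ steps_in K t s', K (last t (unzip2 s')),
       [seq (typ \o f) @` z.1 | z <- s'] = [seq typ @` z.1 | z <- s] &
       forall v, c0 (phi v) -> phi' v = phi v]].
Proof.
move=> cc0; elim: s A phi t => [|[p d] s IH] A phi t aA tphi Ac0 ct Aphit /=.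
  by move=> _; exists A, phi, [::]; split => //; split => //; case: ct.
case=> [[Xp [x phitx pE]] [_ [y dy pE']] cd sd].
have [Kt _] := ct.
case: phitx => xt txt ex.
have phi_iso := tphi.1.
pose q := t `\ xt.
have qE : phi @` q = p by rewrite pE -ex; apply: (iso_setD1 complex_vertex phi_iso).
have p0 : p !=set0 by have [_ ? _] := building_complex Xp.
have q0 : q !=set0 by case: p0 => z; rewrite -qE => -[v qv _]; exists v.
have Kq : K q by apply: (complex_sub Kt) => // v [].
(* The next apartment contains [c0] and the chamber [d], hence its face [p], so the change of
   apartment can fix [c0] and [p]. *)
have [A' aA' [A'c0 A'd]] := common_apartment cc0.1 cd.1.
have Ap : A p by rewrite -qE; apply: (iso_simplex phi_iso).
have A'p : A' p by apply: (apartment_face aA' A'd) => //; rewrite pE' => z [].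
have [phi' [tphi' fix']] := typed_exchange aA aA' tphi cc0 Ac0 A'c0 Ap A'p.
have phi'_iso := tphi'.1.
have qE' : phi' @` q = p.
  by rewrite -qE; apply: eq_imagel => v qv; apply: fix'; right; rewrite -qE; exists v.
have [t' Kt' dE] := iso_lift phi'_iso A'd.
have ct' : chamber K t'.
  by apply: (iso_chamber_inv complex_vertex phi'_iso Kt'); rewrite -dE;
    apply/(apartment_chamber aA').
rewrite dE in sd A'd dy pE' *.
case: dy => yt tyt ey.
(* The preimages [t] and [t'] share the panel [q], so the step is also one in the Coxeter
   complex. *)
have qt' : q = t' `\ yt.
  apply: (iso_eq complex_vertex phi'_iso) => //.
    apply: (complex_sub Kt') => [v []//|].
    case: p0 => z; rewrite pE' -ey => -[[v t'v <-] ne]; exists v; split => // e.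
    by apply: ne; rewrite e.
  by rewrite (iso_setD1 complex_vertex phi'_iso) // qE' pE' ey.
have [A'' [phi'' [s' [aA'' tphi'' A''c0 le [ss Kl te fe]]]]] :=
  IH A' phi' t' aA' tphi' A'c0 ct' A'd sd.
exists A'', phi'', ((q, t') :: s'); split => //; split => //=.
- split => //; split => //; first by exists xt.
  by exists yt.
- rewrite te; congr (_ :: _); rewrite -qE image_comp; apply: eq_imagel => v qv /=.
  by apply/esym; apply: tphi.2; apply: complex_vertex Kq qv.
- move=> v c0v; have e : phi' v = phi v by apply: fix'; left.
  by rewrite -e; apply: fe; rewrite e.
Qed.

(** This is [phi] followed by the inverse of [psi]. The isomorphisms are controlled only on vertices
    of the complex, so [sigma] is obtained by choice and arbitrary elsewhere. *)
Lemma typed_automorphism A phi psi : typed_iso A phi -> typed_iso A psi ->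
  exists sigma, [/\ complex_iso K K sigma,
    forall v, K [set v] -> psi (sigma v) = phi v &
    forall v, K [set v] -> typ (f (sigma v)) = typ (f v)].
Proof.
move=> [phi_iso phi_ty] [psi_iso psi_ty].
have ex v : exists u, K [set v] -> K [set u] /\ psi u = phi v.
  case: (pselect (K [set v])) => Kv; last by exists v.
  have := iso_simplex phi_iso Kv; rewrite image_set1 => /(iso_lift psi_iso) [s Ks e].
  have : [set phi v] (phi v) by [].
  by rewrite e => -[u su eu]; exists u => _; split => //; apply: complex_vertex Ks su.
pose sigma v := projT1 (cid (ex v)).
have sigmaP v : K [set v] -> K [set sigma v] /\ psi (sigma v) = phi v.
  by rewrite /sigma; case: cid.
have sigma_image s : K s -> psi @` (sigma @` s) = phi @` s.
  move=> Ks; rewrite image_comp; apply: eq_imagel => v sv /=.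
  by apply: (sigmaP v _).2; apply: complex_vertex Ks sv.
have lift s t : K s -> K t -> psi @` t = phi @` s -> sigma @` s = t.
  move=> Ks Kt e; apply/seteqP; split => [_ [v sv <-]|u tu].
    have [Ku eu] := sigmaP v (complex_vertex Ks sv).
    have : (psi @` t) (phi v) by rewrite e; exists v.
    case=> u tu e'; rewrite -(iso_vertex_inj psi_iso (complex_vertex Kt tu) Ku) //.
    by rewrite eu.
  have : (phi @` s) (psi u) by rewrite -e; exists u.
  case=> v sv e'; exists v => //; have [Ku eu] := sigmaP v (complex_vertex Ks sv).
  by apply: (iso_vertex_inj psi_iso Ku (complex_vertex Kt tu)); rewrite eu.
exists sigma; split => [|v Kv|v Kv]; last 2 first.
- exact: (sigmaP v Kv).2.
- have [Ku eu] := sigmaP v Kv.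
  by rewrite -psi_ty // eu phi_ty.
split.
  move=> u v /set_mem Ku /set_mem Kv e; apply: (iso_vertex_inj phi_iso Ku Kv).
  by rewrite -(sigmaP u Ku).2 -(sigmaP v Kv).2 e.
apply/seteqP; split => [_ [s Ks <-]|t Kt].
  have [t Kt e] := iso_lift psi_iso (iso_simplex phi_iso Ks).
  by rewrite (lift s t Ks Kt (esym e)).
have [s Ks e] := iso_lift phi_iso (iso_simplex psi_iso Kt).
by exists s => //; apply: lift.
Qed.

Lemma map_gallery_type T (phi : V -> T) (tyT : T -> J) g :
  gallery_type tyT (map_gallery phi g) = gallery_type (tyT \o phi) g.
Proof.
rewrite /gallery_type /= !image_set1 -map_comp; congr (_ :: rcons _ _).
by apply: eq_map => z /=; rewrite image_comp.
Qed.

Lemma eq_gallery_type (ty ty' : V -> J) g : gallery_in K g ->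
  (forall v, K [set v] -> ty v = ty' v) -> gallery_type ty g = gallery_type ty' g.
Proof.
case=> -[Kc _] sg st tg e.
have Kl : K (last_chamber g).
  move: Kc st; rewrite /last_chamber; elim: (steps g) (first_chamber g) =>
    //= -[p d] s IH c _.
  by case=> _ _ [Kd _] sd; apply: IH.
rewrite /gallery_type !image_set1 (e _ (complex_vertex Kc sg)) (e _ (complex_vertex
  Kl tg)).
congr (_ :: rcons _ _); move: st Kc; elim: (steps g) (first_chamber g) =>
  //= -[p d] s IH c.
case=> [[Kp _] _ [Kd _] sd] _; congr (_ :: _); last exact: IH sd Kd.
by apply: eq_imagel => v pv; apply: e; apply: complex_vertex Kp pv.
Qed.

(** Unfolding [gamma] from its first chamber may end at a vertex [y] other than [xp]. A second route
    to the final apartment [A2], through one containing the base chamber and the last chamber of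
    [gamma], matches [xp] with the target. Comparing both gives an automorphism that fixes 0 and
    carries [y] to [xp]. *)
Lemma minimal_gallery_apartment gamma xp : K [set xp] ->
  minimal_gallery (simplices X) gamma -> source gamma = f 0 -> target gamma = f xp ->
  exists g, [/\ minimal_gallery K g, source g = 0, target g = xp
    & gallery_type (typ \o f) g = gallery_type typ gamma].
Proof.
move=> Kxp [[cc0 s0 st tl] gmin] sE tE; rewrite sE in s0; rewrite tE in tl.
have tf : typed_iso A0 f by split.
have Ke : chamber K (cham id) by apply/chamberP; exists id => //; constructor.
have ce : chamber (simplices X) (f @` cham id).
  have := iso_chamber complex_vertex hf Ke => ce.
  by apply/(apartment_chamber hA0) => //; case: ce.
have Ae : A0 (f @` cham id) by apply: (iso_simplex hf); case: Ke.
have e0 : (f @` cham id) (f 0) by exists 0 => //; exists None.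
have [A1 aA1 [A1e A1c0]] := common_apartment ce.1 cc0.1.
have [phi [tphi fixphi]] := typed_exchange hA0 aA1 tf ce Ae A1e Ae A1e.
have phi0 : phi 0 = f 0 by apply: fixphi; left.
have [t Kt cE] := iso_lift tphi.1 A1c0.
have ct : chamber K t.
  by apply: (iso_chamber_inv complex_vertex tphi.1 Kt); rewrite -cE;
    apply/(apartment_chamber aA1).
have K0 : K [set (0 : V)] by apply: complex_vertex Ke.1 _; exists None.
have t0 : t 0.
  move: s0; rewrite cE -phi0 => -[v tv e].
  by rewrite -(iso_vertex_inj tphi.1 (complex_vertex Kt tv) K0 e).
rewrite cE in st.
have A1t : A1 (phi @` t) by rewrite -cE.
have [A2 [phi2 [s [aA2 tphi2 A2c0 le [ss Kl te fe]]]]] :=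
  unfold_steps cc0 aA1 tphi A1c0 ct A1t st.
have phi20 : phi2 0 = f 0 by rewrite -phi0; apply: fe; rewrite phi0.
have A2l : A2 (last_chamber gamma).
  by rewrite /last_chamber cE -le; apply: (iso_simplex tphi2.1).
have Xl := apartment_sub aA2 A2l.
have cl : chamber (simplices X) (last_chamber gamma).
  rewrite /last_chamber; move: st; rewrite -cE; move: (cc0).
  by elim: (steps gamma) (first_chamber gamma) => //= -[p d] s' IH c _ [_ _ cd sd];
    apply: IH.
have [A3 aA3 [A3e A3l]] := common_apartment ce.1 Xl.
have Ab : A0 [set f xp] by rewrite -image_set1; apply: (iso_simplex hf).
have A3b := apartment_vertex aA3 A3l tl.
have [phi3 [tphi3 fix3]] := typed_exchange hA0 aA3 tf ce Ae A3e Ab A3b.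
have phi30 : phi3 0 = f 0 by apply: fix3; left.
have phi3x : phi3 xp = f xp by apply: fix3; right.
have A3a := apartment_vertex aA3 A3e e0.
have A2a := apartment_vertex aA2 A2c0 s0.
have [phi4 [tphi4 fix4]] := typed_exchange aA3 aA2 tphi3 cl A3l A2l A3a A2a.
have phi40 : phi4 0 = f 0 by rewrite fix4 phi30 //; right.
have phi4x : phi4 xp = f xp by rewrite fix4 phi3x //; left.
have [sigma [sigma_iso sigmaE sigma_ty]] := typed_automorphism tphi2 tphi4.
have : (phi2 @` last t (unzip2 s)) (f xp) by rewrite le -cE.
case=> y ly ey.
pose g := Gallery 0 t s y.
have gg : gallery_in K g by split.
have Ky : K [set y] := complex_vertex Kl ly.
have Ksigma v : K [set v] -> K [set sigma v].
  by move=> Kv; rewrite -image_set1; apply: (iso_simplex sigma_iso).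
have sigma0 : sigma 0 = 0.
  by apply: (iso_vertex_inj tphi4.1 (Ksigma _ K0) K0); rewrite sigmaE // phi20 phi40.
have sigmay : sigma y = xp.
  by apply: (iso_vertex_inj tphi4.1 (Ksigma _ Ky) Kxp); rewrite sigmaE // ey phi4x.
have gg' := iso_gallery complex_vertex sigma_iso gg.
have tyE : gallery_type (typ \o f) (map_gallery sigma g) = gallery_type typ gamma.
  rewrite map_gallery_type (@eq_gallery_type _ (typ \o f)) //.
  rewrite /gallery_type /= te sE tE !image_set1 /=.
  by have := sigma_ty y Ky; rewrite sigmay => ->.
exists (map_gallery sigma g); split => //.
split=> // g' gg1 sg' tg'.
have := iso_gallery complex_vertex hf gg1 => -[h1 h2 h3 h4].
have sz : size (steps (map_gallery sigma g)) = size (steps gamma).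
  by have := congr1 size tyE; rewrite !size_gallery_type => -[].
have Xsteps c u : A0 c -> steps_in A0 c u -> steps_in (simplices X) c u.
  elim: u c => //= -[p d] u IH c A0c [[A0p H1] [_ H2] [A0d H3] H4]; split => //.
  - by split => //; apply: (apartment_sub hA0).
  - by split => //; apply: (apartment_sub hA0).
  - by apply/(apartment_chamber hA0).
  - exact: IH.
(* A competitor in the Coxeter complex is carried by [f] to a gallery of the building with the
   endpoints of [gamma]. *)
rewrite sz; have := gmin (map_gallery f g'); rewrite /= size_map; apply.
- split => //; first by apply/(apartment_chamber hA0) => //; case: h1.
  by apply: Xsteps => //; case: h1.
- by rewrite sg' /= sigma0 sE.
- by rewrite tg' /= sigmay tE.
Qed.

End Building.

End RootSystem.

Theorem proposition3p2 (R : realType) (n : nat) (D : root_system R n)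
  (I : finType) (alpha omega : I -> 'rV[R]_n)
  (ip : {dot 'rV[R]_n for idfun})
  (X : affine_building D) (J : Type) (typ : points X -> J)
  (A : set (set (points X))) (f : 'rV[R]_n -> points X)
  (x xp : 'rV[R]_n) (gamma : gallery (points X))
  (hD : irreducible_roots D)
  (halpha : root_basis D alpha)
  (homega : fundamental_coweights D alpha omega)
  (hip : weyl_invariant D ip)
  (htyp : type_function (simplices X) typ)
  (hA : apartments X A)
  (hf : complex_iso (coxeter_complex D) A f)
  (hx : special_vertex D x)
  (hxp : weyl_orbit D x xp)
  (hxpC : fundamental_chamber D alpha xp)
  (hgamma : minimal_gallery (simplices X) gamma)
  (hsource : source gamma = f 0)
  (htarget : target gamma = f xp) :
  (forall y, A_type D omega ip x y ->
     exists g : gallery 'rV[R]_n,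
       [/\ gallery_in (coxeter_complex D) g,
           positively_folded D alpha g,
           gallery_type (typ \o f) g = gallery_type typ gamma,
           source g = 0
         & target g = y]) /\
  (forall g : gallery 'rV[R]_n,
     gallery_in (coxeter_complex D) g ->
     positively_folded D alpha g ->
     gallery_type (typ \o f) g = gallery_type typ gamma ->
     source g = 0 ->
     A_type D omega ip x (target g)).
Proof.
have ipC u v : ip u v = ip v u by rewrite hermC expr0 mul1r.
have ipP c u v w : ip (c *: u + v) w = c * ip u w + ip v w by rewrite linearPl.
have ip_gt0 u : u != 0 -> 0 < ip u u by apply: neq0_dnorm_gt0.
have [theta [theta_root theta_gt0 theta_max]] :=
  highest_coroot ipC ipP ip_gt0 hip halpha homega hD.
have Kxp : coxeter_complex D [set xp].
  apply: (vertex_complex ipC ipP ip_gt0 hip halpha homega hD theta_root theta_gt0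
    theta_max).
  case: hx hxp => vx _ [w [aw _] <-].
  exact: (vertex_aw ipC ipP ip_gt0 hip aw vx).
have [g0 [g0_min sg0 tg0 <-]] := minimal_gallery_apartment ipC ipP ip_gt0 hip
  halpha homega hD
  theta_root theta_gt0 theta_max htyp hA hf Kxp hgamma hsource htarget.
have hty := type_comp ipC ipP ip_gt0 hip halpha homega hD theta_root theta_gt0
  theta_max htyp hA hf.
have [fwd bwd] := coxeter_complex_folding ipC ipP ip_gt0 hip halpha homega hD
  theta_root theta_gt0 theta_max hty hx hxp hxpC g0_min sg0 tg0.
by split => // g gg _; apply: bwd.
Qed.
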